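(* If the canonicity checking problem restricted to adjacency matrices of square-free graphs belongs to NP, then the graph isomorphism problem for arbitrary finite graphs belongs to co-NP.
   Context: A graph is square-free if it contains no 4-cycle as a (not necessarily induced) subgraph. For an $n\times n$ adjacency matrix $\mathbf{M}$ of a finite simple graph (with respect to some ordering of its vertices), its bit-string is obtained by concatenating the entries strictly above the diagonal column by column, left to right, reading each column from top to bottom. The canonical adjacency matrix of a graph $G$ is the unique adjacency matrix of $G$ (over all orderings of its vertices) whose bit-string is lexicographically greatest. The canonicity checking problem for square-free graphs is: given the adjacency matrix of a square-free graph, decide whether it is the canonical adjacency matrix of that graph. The graph isomorphism problem is: given two finite graphs, decide whether they are isomorphic. *)

(* Defs.v *)
From mathcomp Require Import all_boot.
From mathcomp Require Import fingroup perm.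
Set Implicit Arguments. Unset Strict Implicit. Unset Printing Implicit Defensive.

(* Machine model: deterministic single-tape Turing machines over the   *)
(* tape alphabet {0,1,blank} (blank = None).                           *)

Inductive move := MoveL | MoveR | MoveS.

Record TM := {
  tm_Q : finType;
  tm_start : tm_Q;
  tm_halt : pred tm_Q;
  tm_accept : pred tm_Q;
  tm_delta : tm_Q -> option bool -> tm_Q * option bool * move
}.
Arguments tm_start : clear implicits.
Arguments tm_halt : clear implicits.
Arguments tm_accept : clear implicits.
Arguments tm_delta : clear implicits.

(* configuration: state, tape left of head (nearest cell first),
   symbol under head, tape right of head (nearest cell first) *)
Definition config (M : TM) : Type :=
  (tm_Q M * seq (option bool) * option bool * seq (option bool))%type.

Definition init_config (M : TM) (x : seq bool) : config M :=
  match x with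
  | [::] => (tm_start M, [::], None, [::])
  | b :: x' => (tm_start M, [::], Some b, map Some x')
  end.

Definition tm_step (M : TM) (c : config M) : config M :=
  let: (q, l, a, r) := c in
  if tm_halt M q then c else
  let: (q', w, m) := tm_delta M q a in
  match m with
  | MoveL => match l with
             | [::] => (q', [::], w, r)
             | b :: l' => (q', l', b, w :: r)
             end
  | MoveR => match r with
             | [::] => (q', w :: l, None, [::])
             | b :: r' => (q', w :: l, b, r')
             end
  | MoveS => (q', l, w, r)
  end.

Definition tm_run (M : TM) (t : nat) (x : seq bool) : config M :=
  iter t (@tm_step M) (init_config M x).

Definition cfg_state (M : TM) (c : config M) : tm_Q M :=
  let: (q, _, _, _) := c in q.

Definition language := seq bool -> Prop.

Definition inP (L : language) : Prop :=
  exists (M : TM) (c k : nat), forall x : seq bool,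
    let q := cfg_state (tm_run M (c * size x ^ k + c) x) in
    tm_halt M q /\ (tm_accept M q <-> L x).

Definition pair_enc (x y : seq bool) : seq bool :=
  flatten [seq [:: b; b] | b <- x] ++ [:: false; true] ++ y.

Definition inNP (L : language) : Prop :=
  exists V : language, inP V /\
  exists c k : nat, forall x : seq bool,
    L x <-> exists y : seq bool, size y <= c * size x ^ k + c /\ V (pair_enc x y).

Definition inCoNP (L : language) : Prop := inNP (fun x => ~ L x).

Definition adjm (n : nat) := 'I_n -> 'I_n -> bool.

Definition is_adj_matrix n (A : adjm n) : Prop :=
  (forall i j, A i j = A j i) /\ (forall i, A i i = false).

Definition square_free n (A : adjm n) : Prop :=
  ~ exists a b c d : 'I_n,
      [/\ uniq [:: a; b; c; d], A a b, A b c & A c d] /\ A d a.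

Definition bitstring n (A : adjm n) : seq bool :=
  flatten [seq [seq A i j | i <- [seq i <- enum 'I_n | (nat_of_ord i < nat_of_ord j)%N]] | j : 'I_n <- enum 'I_n].

Definition reorder n (A : adjm n) (s : {perm 'I_n}) : adjm n :=
  fun i j => A (s i) (s j).

Fixpoint lexle (s t : seq bool) : bool :=
  match s, t with
  | [::], _ => true
  | _ :: _, [::] => false
  | a :: s', b :: t' => (~~ a && b) || ((a == b) && lexle s' t')
  end.

Definition canonical n (A : adjm n) : Prop :=
  forall s : {perm 'I_n}, lexle (bitstring (reorder A s)) (bitstring A).

Definition isomorphic n1 n2 (A1 : adjm n1) (A2 : adjm n2) : Prop :=
  exists f : 'I_n1 -> 'I_n2, bijective f /\ forall i j, A1 i j = A2 (f i) (f j).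

Definition decode_mx n (s : seq bool) : adjm n :=
  fun i j => nth false s (i * n + j).
Arguments decode_mx : clear implicits.

Definition encodes_graph (s : seq bool) n (A : adjm n) : Prop :=
  size s = n * n /\ A = decode_mx n s /\ is_adj_matrix A.

Definition CANON_SQFREE : language := fun s =>
  exists n (A : adjm n), encodes_graph s A /\ square_free A /\ canonical A.

Definition GI : language := fun s =>
  exists n1 n2 (A1 : adjm n1) (A2 : adjm n2) s1 s2,
    s = pair_enc s1 s2 /\ encodes_graph s1 A1 /\ encodes_graph s2 A2 /\
    isomorphic A1 A2.

(* Main.v *)
Require Import Defs.
From mathcomp Require Import all_boot.
From mathcomp Require Import fingroup perm.
From mathcomp Require Import zify.
From Stdlib Require Import Classical_Prop.
Set Implicit Arguments. Unset Strict Implicit. Unset Printing Implicit Defensive.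

(** Attach to a graph G the square-free graph S(G) obtained by subdividing the
    edges of G and marking the original vertices by high degree; G is recovered
    from S(G) up to isomorphism.  Hence G1 and G2 are not isomorphic iff the
    canonical matrices of S(G1) and S(G2) differ, and a certificate of this
    consists of these two matrices, isomorphisms onto them, and accepting
    computations of the NP verifier of their canonicity.

    To check such certificates by a single-tape machine we prove a form of
    Fagin's theorem: a property of bit strings x expressed by a first-order
    sentence over a polynomially long initial segment of nat, with guessed
    ternary relations, is in NP.  The guessed relations are laid out as a table
    of D^3 blocks; the machine runs through all assignments of the K variables
    of the sentence as through the values of a K-digit counter in base D, by
    left-to-right sweeps that move marks, and feeds the order of the marks to a
    finite automaton that evaluates the sentence.  The three lowest digits
    address the table. *)

(** * Sweeping machines *)

(** The model is a concrete single-tape machine with a concrete time bound, so all programming is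
    moved into a sentence and only one kind of machine is ever analysed. The base D is chosen by the
    certificate; soundness is therefore proved for every D and all relations, and a polynomial bound
    on D enters only in completeness. Consequently the sentence must pin down everything it uses.
    Addition and multiplication are themselves guessed relations, subject to recursion equations.
    The length bound for certificates of the canonicity verifier is also written out, because
    acceptance of an overlong certificate would prove nothing about canonicity. Relations are
    ternary since addition, multiplication and the isomorphisms, which send pairs to vertices, need
    three arguments; this is the origin of the exponent in D^3. An edge of G is subdivided twice, so
    that the new vertices are indexed by ordered pairs and the vertex set of the gadget is a full
    product. *)

(* The machine repeatedly rewrites a bit word from left to right.  Its first
   letter is only passed to [sw_start]: the Turing machine overwrites it by a
   blank in order to find the left end again. *)
Record sweeper := Sweeper {
  sw_S : finType;
  sw_start : bool -> sw_S;
  sw_step : sw_S -> bool -> sw_S * bool;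
  sw_turn : sw_S -> sw_S + bool
}.

Section Sweeper.
Variable W : sweeper.
Notation S := (sw_S W).

Fixpoint sweep (s : S) (u : seq bool) : S * seq bool :=
  if u is b :: u' then
    let s1 := sw_step s b in
    let s2 := sweep s1.1 u' in (s2.1, s1.2 :: s2.2)
  else (s, [::]).

Lemma sweep_cons s b u : sweep s (b :: u) =
  ((sweep (sw_step s b).1 u).1, (sw_step s b).2 :: (sweep (sw_step s b).1 u).2).
Proof. by []. Qed.

Lemma size_sweep s u : size (sweep s u).2 = size u.
Proof. by elim: u s => //= b u IH s; rewrite IH. Qed.

Fixpoint sw_run (n : nat) (s : S) (u : seq bool) : option bool :=
  if n is n'.+1 then
    let s' := sweep s u in
    match sw_turn s'.1 with
    | inl s2 => sw_run n' s2 s'.2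
    | inr r => Some r
    end
  else None.

Lemma sw_runS n s u : sw_run n.+1 s u =
  match sw_turn (sweep s u).1 with
  | inl s2 => sw_run n s2 (sweep s u).2
  | inr r => Some r
  end.
Proof. by []. Qed.

Lemma sw_run_det n1 n2 s u r1 r2 :
  sw_run n1 s u = Some r1 -> sw_run n2 s u = Some r2 -> r1 = r2.
Proof.
elim: n1 n2 s u => [|n1 IH] [|n2] s u //=.
by case: (sw_turn _) => [s2|r]; [apply: IH | move=> [<-] [<-]].
Qed.

Definition swQ : finType := ((unit + bool) + (S + S))%type.
Definition qHalt (r : bool) : swQ := inl (inr r).
Definition qRight (s : S) : swQ := inr (inl s).
Definition qLeft (s : S) : swQ := inr (inr s).

Definition sw_halt (q : swQ) : bool := if q is inl (inr _) then true else false.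
Definition sw_accept (q : swQ) : bool := if q is inl (inr r) then r else false.

Definition sw_delta (q : swQ) (a : option bool) : swQ * option bool * move :=
  match q, a with
  | inl (inr r), _ => (q, a, MoveS)
  | inl (inl _), None => (qHalt false, None, MoveS)
  | inl (inl _), Some b => (qRight (sw_start W b), None, MoveR)
  | inr (inl s), Some b => let t := sw_step s b in (qRight t.1, Some t.2, MoveR)
  | inr (inl s), None =>
      match sw_turn s with
      | inl s2 => (qLeft s2, None, MoveL)
      | inr r => (qHalt r, None, MoveS)
      end
  | inr (inr s), Some b => (qLeft s, Some b, MoveL)
  | inr (inr s), None => (qRight s, None, MoveR)
  end.

Definition swTM : TM :=
  @Build_TM swQ (inl (inl tt)) sw_halt sw_accept sw_delta.

(* The head cell and the right part of the tape as one list, possibly with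
   trailing blanks. *)
Definition zcfg (q : swQ) (l z : seq (option bool)) : config swTM :=
  (q, l, head None z, behead z).

Definition blanks k : seq (option bool) := nseq k None.

(** The [k] trailing blanks are a matter of representation: once the head has stepped past the word,
    the blank met there stays in the list of cells. *)
Lemma right_pass s l u k :
  iter (size u) (@tm_step swTM) (zcfg (qRight s) l (map Some u ++ blanks k))
  = zcfg (qRight (sweep s u).1) (rev (map Some (sweep s u).2) ++ l) (blanks k).
Proof.
elim: u s l => [|b u IH] s l //.
rewrite [size _]/= iterSr.
have -> : tm_step (zcfg (qRight s) l (map Some (b :: u) ++ blanks k)) =
  zcfg (qRight (sw_step s b).1) (Some (sw_step s b).2 :: l)
       (map Some u ++ blanks k).
  by rewrite /zcfg /=; case: (map Some u ++ blanks k).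
by rewrite IH /= rev_cons cat_rcons.
Qed.

(** The head has just turned: it stands on the last letter of [u], or on the blank at the left end
    if [u] is empty. The expressions with [head] and [behead] cover both cases. *)
Lemma left_pass s u z :
  iter (size u).+1 (@tm_step swTM)
    (zcfg (qLeft s) (behead (rev (map Some u) ++ [:: None]))
       (head None (rev (map Some u) ++ [:: None]) :: z))
  = zcfg (qRight s) [:: None] (map Some u ++ z).
Proof.
elim/last_ind: u z => [|u b IH] z.
  by rewrite /= /zcfg /=; case: z.
rewrite size_rcons iterSr map_rcons rev_rcons.
have -> : tm_step (zcfg (qLeft s) (behead ((Some b :: rev (map Some u)) ++ [:: None]))
    (head None ((Some b :: rev (map Some u)) ++ [:: None]) :: z)) =
  zcfg (qLeft s) (behead (rev (map Some u) ++ [:: None]))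
       (head None (rev (map Some u) ++ [:: None]) :: (Some b :: z)).
  by rewrite /zcfg /=; case: (rev (map Some u)).
by rewrite -cats1 -catA -IH.
Qed.

(** A round costs [size u + 1] steps to the right, including the turn at the blank, and as many back
    to the left end. *)
Lemma sw_run_tm n s u r k : sw_run n s u = Some r ->
  exists2 t, t <= n * ((size u).*2 + 3) &
  cfg_state (iter t (@tm_step swTM) (zcfg (qRight s) [:: None] (map Some u ++ blanks k)))
  = qHalt r.
Proof.
elim: n s u k => [|n IH] s u k //=.
set s' := sweep s u => run.
have sz : size s'.2 = size u by rewrite size_sweep.
have pass := right_pass s [:: None] u k.
case E: (sw_turn s'.1) run => [s2|r'] run; last first.
  case: run => <-; exists (size u).+1; first by lia.
  rewrite iterS pass -/s' /zcfg.
  by case: k {pass} => [|k] /=; rewrite E.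
(* After the turn at least one blank is stored explicitly behind the word, even if [k] was 0. *)
have [t le_t Ht] := IH s2 s'.2 k.-1.+1 run.
exists (t + ((size u).+1 + (size u).+1)).
  by move: le_t; rewrite sz -mul2n mulSn; lia.
rewrite iterD iterD.
have -> : iter (size u).+1 (@tm_step swTM)
    (zcfg (qRight s) [:: None] (map Some u ++ blanks k)) =
  zcfg (qLeft s2) (behead (rev (map Some s'.2) ++ [:: None]))
       (head None (rev (map Some s'.2) ++ [:: None]) :: blanks k.-1.+1).
  rewrite iterS pass -/s' /zcfg.
  by case: k {Ht pass} => [|k] /=; rewrite E; case: (rev _) => [|? ?] /=.
by rewrite -sz left_pass.
Qed.

Lemma halt_stable M q0 (c : config M) t :
  cfg_state c = q0 -> tm_halt M q0 -> iter t (@tm_step M) c = c.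
Proof.
case: c => [[[q l] a] r] /= <- hq; elim: t => //= t ->.
by rewrite /tm_step hq.
Qed.

Lemma halt_unique M (c : config M) t1 t2 :
  tm_halt M (cfg_state (iter t1 (@tm_step M) c)) ->
  tm_halt M (cfg_state (iter t2 (@tm_step M) c)) ->
  cfg_state (iter t1 (@tm_step M) c) = cfg_state (iter t2 (@tm_step M) c).
Proof.
wlog le12 : t1 t2 / t1 <= t2 => [W'|].
  by case: (leqP t1 t2) => [|/ltnW] le12 h1 h2; [|apply/esym]; apply: W'.
move=> h1 _; rewrite -(subnK le12) iterD.
by rewrite (halt_stable _ erefl h1).
Qed.

Definition sw_lang : language :=
  fun w => if w is b :: u then exists n, sw_run n (sw_start W b) u = Some true
           else False.

(** Every sweep with its return fits into 3 * (size u + 1) steps, which raises the exponent by one;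
    the additional 1 pays for the step that erases the first letter. *)
Lemma sw_lang_inP c k :
  (forall b u, exists n r,
     n <= c * (size u).+1 ^ k /\ sw_run n (sw_start W b) u = Some r) ->
  inP sw_lang.
Proof.
move=> H; exists swTM, (c * 3 + 1), k.+1 => w.
case: w => [|b u].
  rewrite addn1 addnS /tm_run iterSr.
  by rewrite (@halt_stable swTM (qHalt false)).
have [n [r [le_n run]]] := H b u.
have [t le_t Ht] := sw_run_tm 0 run.
set T := _ + _.
have leT : t.+1 <= T.
  rewrite /T /= expnS.
  apply: leq_ltn_trans le_t _.
  set X := (size u).+1 ^ k in le_n *.
  have : n * ((size u).*2 + 3) <= (c * X) * ((size u).*2 + 3) by rewrite leq_mul2r le_n orbT.
  rewrite -mul2n; move: (size u) => m le2.
  have X0 : c * X * (2 * m + 3) <= c * 3 * (m.+1 * X).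
    have -> : c * 3 * (m.+1 * X) = c * X * (3 * m.+1) by lia.
    by rewrite leq_mul2l; apply/orP; right; lia.
  lia.
have -> : cfg_state (tm_run swTM T (b :: u)) = qHalt r.
  rewrite /tm_run -(subnK leT) iterD iterSr.
  have -> : tm_step (init_config swTM (b :: u)) =
            zcfg (qRight (sw_start W b)) [:: None] (map Some u ++ blanks 0).
    by rewrite /= cats0 /zcfg; case: u {run H le_n le_t Ht T leT}.
  by rewrite (halt_stable _ Ht).
split=> //=; split=> [rt|[n' run']].
  by exists n; rewrite run; case: r rt {run Ht}.
by rewrite (sw_run_det run run').
Qed.

End Sweeper.

(** All that one sweep reveals: the order of the counter digits, which of them equal D - 1, the
    table entries under the table pointer, and the letter of [x] under its pointer, [None] beyond
    the end. *)
Record obs (I : Type) := Obs {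
  ole : nat -> nat -> bool;
  omax : nat -> bool;
  oq : I -> bool;
  ox : option bool
}.

Record automaton (I : Type) := Automaton {
  au_S : finType;
  au_init : au_S;
  au_step : au_S -> obs I -> au_S;
  au_out : au_S -> bool
}.

(** Commands for a mark: stay, advance by one, or jump to 0. [newbit] executes them within a
    left-to-right pass, from the old bits of the current and the preceding cell. *)
Definition newpos (a : option bool) (p : nat) : nat :=
  match a with None => p | Some true => p.+1 | Some false => 0 end.

Definition newbit (a : option bool) (fst prev old : bool) : bool :=
  match a with None => old | Some true => prev | Some false => fst end.

Lemma newbit_pos a p k :
  newbit a (k == 0) (p.+1 == k) (k == p) = (k == newpos a p).
Proof. by case: a => [[]|] //=; rewrite eq_sym. Qed.

Fixpoint marked_pairs (x : seq bool) (m : nat -> bool) : seq bool :=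
  if x is b :: x' then b :: (b (+) m 0) :: marked_pairs x' (fun j => m j.+1) else [::].

Lemma eq_marked_pairs x m m' : m =1 m' -> marked_pairs x m = marked_pairs x m'.
Proof. by elim: x m m' => //= b x IH m m' E; rewrite E (IH _ (fun j => m' j.+1)). Qed.

Lemma pair_encE x y : pair_enc x y = marked_pairs x (fun=> false) ++ [:: false, true & y].
Proof. by rewrite /pair_enc; elim: x => //= b x ->; rewrite addbF. Qed.

Lemma pair_enc_inj s1 s2 t1 t2 : pair_enc s1 s2 = pair_enc t1 t2 -> s1 = t1 /\ s2 = t2.
Proof.
rewrite !pair_encE; elim: s1 t1 => [|b s IH] [|c t] //=.
- by case=> ->.
- by case: c.
- by case: b.
- by case=> -> _ /IH [-> ->].
Qed.

(** * A sweeping machine that evaluates automata over counters *)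

(* The machine reads [pair_enc x y], where [y] is a list of blocks of bits, one
   bit per [cell]: a flag for the block number D - 1, the table entries, and
   marks for a table pointer and for the K digits of a counter in base D.  The
   pointer in [x] is represented by flipping the second bit of the pair under
   it, and the true value of that pair is kept in the state. *)
Section Machine.
Variables (I : finType) (K' : nat) (A : automaton I).
Notation K := K'.+1.

Definition cell : finType := option (I + option 'I_K).
Definition bsize := #|{: cell}|.

Lemma bsize_gt0 : 0 < bsize.
Proof. by apply/card_gt0P; exists None. Qed.

Definition pos0 : 'I_bsize := Ordinal bsize_gt0.

Definition block : finType := {ffun 'I_bsize -> bool}.
Definition cidx (c : cell) : 'I_bsize := enum_rank c.
Definition cLast := cidx None.
Definition cPay l := cidx (Some (inl l)).
Definition cQ := cidx (Some (inr None)).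
Definition cMark a := cidx (Some (inr (Some a))).

Definition ffset (f : block) (c : 'I_bsize) (b : bool) : block :=
  [ffun c' => if c' == c then b else f c'].

(* last flag seen, marks seen, maximal marks, order of marks, payload under q *)
Definition oacc : finType :=
  (bool * {ffun 'I_K -> bool} * {ffun 'I_K -> bool} *
   {ffun 'I_K * 'I_K -> bool} * {ffun I -> bool})%type.

Definition oacc0 : oacc :=
  (false, [ffun=> false], [ffun=> false], [ffun=> false], [ffun=> false]).

(** The mark [p.1] is not to the right of [p.2] iff it has been seen by the time [p.2] turns up; so
    digits of unbounded size are compared with finite memory. *)
Definition oupd (o : oacc) (f : block) : oacc :=
  let: (hl, seen, mx, le, qp) := o in
  (hl || f cLast,
   [ffun a => seen a || f (cMark a)],
   [ffun a => mx a || f (cMark a) && f cLast],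
   [ffun p => le p || f (cMark p.2) && (seen p.1 || f (cMark p.1))],
   [ffun l => qp l || f cQ && f (cPay l)]).

Definition mkobs (o : oacc) (x : option bool) : obs I :=
  let: (hl, seen, mx, le, qp) := o in
  Obs (fun i j => le (inord i, inord j)) (fun i => mx (inord i)) qp x.

Definition actF : finType := {ffun 'I_bsize -> option bool}.

(* first bit of the word, cell actions, action on the mark of x, bit under the
   mark of x, automaton state *)
Definition ctl : finType :=
  (bool * actF * option bool * option bool * au_S A)%type.

(* first pair, mark just passed, mark passed, bit under the new mark *)
Definition xloc : finType := (bool * bool * bool * option bool)%type.
Definition yloc : finType := ('I_bsize * bool * block * block * oacc)%type.
Definition mS : finType :=
  option (ctl * (xloc * option bool + option bool * yloc)).

Definition xstate0 : xloc := (true, false, false, None).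
Definition ystate0 : yloc := (pos0, true, [ffun=> false], [ffun=> false], oacc0).

(** An unequal pair is either the marked pair or the separator, and a marked 0 looks exactly like
    the separator. The two are told apart because the letter under the mark is known from the
    previous sweep and the mark occurs at most once. *)
Definition xstep (xa xs : option bool) (s : xloc) (b1 b2 : bool) :
  option xloc * bool :=
  let: (fst, carry, seen, xs') := s in
  let wasmark := [&& b1 != b2, ~~ seen & xs == Some b1] in
  if (b1 == b2) || wasmark then
    let nm := newbit xa fst carry wasmark in
    (Some (false, wasmark, seen || wasmark, if nm then Some b1 else xs'),
     b1 (+) nm)
  else (None, b2).

Definition ystep (acts : actF) (s : yloc) (b : bool) : yloc * bool :=
  let: (t, fst, prev, news, o) := s in
  let nb := newbit (acts t) fst (prev t) b in
  let prev' := ffset prev t b in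
  let news' := ffset news t nb in
  ((ordS t, if t.+1 == bsize then false else fst, prev', news',
    if t.+1 == bsize then oupd o news' else o), nb).

Definition mstep (s : mS) (b : bool) : mS * bool :=
  match s with
  | None => (None, b)
  | Some (c, inl (xl, None)) => (Some (c, inl (xl, Some b)), b)
  | Some (c, inl (xl, Some b1)) =>
      let: (_, _, xa, xs, _) := c in
      let r := xstep xa xs xl b1 b in
      (match r.1 with
       | Some xl' => Some (c, inl (xl', None))
       | None => if b1 then None else Some (c, inr (xl.2, ystate0))
       end, r.2)
  | Some (c, inr (xs', yl)) =>
      let: (_, acts, _, _, _) := c in
      let r := ystep acts yl b in
      (Some (c, inr (xs', r.1)), r.2)
  end.

Definition mstart (c : ctl) : mS :=
  let: (b0, _, _, _, _) := c in Some (c, inl (xstate0, Some b0)).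

Definition marksact (f : 'I_K -> option bool) (q : option bool) : actF :=
  [ffun t => match enum_val t with
             | Some (inr (Some a)) => f a
             | Some (inr None) => q
             | _ => None
             end].

(** The first sweep resets all marks in [y], whatever bits the certificate holds there; the [None]
    says that no pair of [x] is marked yet. *)
Definition ctl0 (b : bool) : ctl :=
  (b, marksact (fun=> Some false) (Some false), Some false, None, au_init A).

Definition allmax (o : obs I) (n : nat) : bool := all (omax o) (iota 0 n).

(** The carry of an odometer: a digit moves only if all lower digits are maximal, and wraps around
    if it is maximal itself. *)
Definition odo (o : obs I) (a : nat) : option bool :=
  if allmax o a then Some (~~ omax o a) else None.

(** The table pointer advances at every count and wraps together with the three lowest digits, so it
    stands at the block whose number has these digits in base D. The pointer in [x] copies digit
    0. *)
Definition nextctl (b : bool) (o : obs I) (s : au_S A) : ctl :=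
  (b, marksact (odo o) (Some (~~ allmax o 3)), Some (~~ omax o 0), ox o, s).

(** The format is checked here: a sweep has to end at a block boundary and to have met the flag of
    block D - 1. *)
Definition mturn (s : mS) : mS + bool :=
  if s is Some ((b, _, _, _, a), inr (xs', (t, _, _, _, o))) then
    let: (hl, _, _, _, _) := o in
    if (t == pos0) && hl then
      let ob := mkobs o xs' in
      let a' := au_step a ob in
      if allmax ob K then inr (au_out a') else inl (mstart (nextctl b ob a'))
    else inr false
  else inr false.

Definition mach : sweeper :=
  @Sweeper mS (fun b => mstart (ctl0 b)) mstep mturn.

(** Loop invariant: [st k] is the control after [k] pairs, while the mark is moved from [p] to
    [newpos xa p] and the letter found there is remembered for the next sweep. *)
Lemma sweepX c xa xs X p x1 x2 v :
  let: (_, _, xa', xs', _) := c in xa' = xa /\ xs' = xs ->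
  X = x1 ++ x2 -> xs = onth X p ->
  let st k : xloc := (k == 0, p.+1 == k, p < k,
    if newpos xa p < k then onth X (newpos xa p) else None) in
  @sweep mach (Some (c, inl (st (size x1), None)))
     (marked_pairs x2 (fun j => size x1 + j == p) ++ v) =
  let s := @sweep mach (Some (c, inl (st (size X), None))) v in
  (s.1, marked_pairs x2 (fun j => size x1 + j == newpos xa p) ++ s.2).
Proof.
case: c => [[[[b acts] xa'] xs'] a] [-> ->] {xa' xs'}.
elim: x2 x1 => [|b2 x2 IH] x1 EX Exs st.
  by rewrite EX /st cats0 /=; case: (sweep _ _).
have ons : onth X (size x1) = Some b2.
  by rewrite EX onth_cat ltnn subnn.
have:= IH (rcons x1 b2); rewrite size_rcons cat_rcons => /(_ EX Exs) /= {}IH.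
rewrite /= addn0.
have -> : (b2 != b2 (+) (size x1 == p)) = (size x1 == p).
  by case: b2 {EX IH ons}; case: (_ == p).
have -> : (b2 == b2 (+) (size x1 == p)) = (size x1 != p).
  by case: b2 {EX IH ons}; case: (_ == p).
have -> : [&& size x1 == p, ~~ (p < size x1) & xs == Some b2] = (size x1 == p).
  case: eqP => // ep; rewrite -ep ltnn /=.
  by rewrite Exs -ep ons eqxx.
rewrite orNb /= newbit_pos.
have -> : (p < size x1) || (size x1 == p) = (p < (size x1).+1) by lia.
have -> : (size x1 == p) = (p.+1 == (size x1).+1) by rewrite eqSS eq_sym.
have E1 : (if size x1 == newpos xa p then Some b2 else
   if newpos xa p < size x1 then onth X (newpos xa p) else None) =
   if newpos xa p < (size x1).+1 then onth X (newpos xa p) else None.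
  rewrite ltnS [newpos xa p <= _]leq_eqVlt [in RHS]eq_sym.
  by case: eqP => [<-|_] //=; rewrite ons.
rewrite E1 -[false]/((size x1).+1 == 0).
rewrite (@eq_marked_pairs _ _ (fun j => (size x1).+1 + j == p)); last by move=> j; rewrite addnS.
rewrite IH /=; congr (_, _ :: _ :: _).
congr (_ ++ _); apply: eq_marked_pairs => j; by rewrite addnS.
Qed.
Definition bbits (f : block) : seq bool := [seq f t | t <- enum 'I_bsize].

Lemma sweepY_block (b : bool) (acts : actF) (xa xs : option bool) (a : au_S A)
    (xs' : option bool) (fst : bool) (prev news : block) (o : oacc) (f : block) v :
  let c : ctl := (b, acts, xa, xs, a) in
  let g : block := [ffun t => newbit (acts t) fst (prev t) (f t)] in
  @sweep mach (Some (c, inr (xs', (pos0, fst, prev, news, o)))) (bbits f ++ v) =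
  let s := @sweep mach (Some (c, inr (xs', (pos0, false, f, g, oupd o g)))) v in
  (s.1, bbits g ++ s.2).
Proof.
move=> c g.
have step n (t : 'I_bsize) (p' w' : block) : t + n.+1 = bsize ->
  (forall j : 'I_bsize, j < t -> p' j = f j /\ w' j = g j) ->
  (forall j : 'I_bsize, t <= j -> p' j = prev j) ->
  @sweep mach (Some (c, inr (xs', (t, fst, p', w', o))))
     ([seq f t | t <- drop t (enum 'I_bsize)] ++ v) =
  let s := @sweep mach (Some (c, inr (xs', (pos0, false, f, g, oupd o g)))) v in
  (s.1, [seq g t | t <- drop t (enum 'I_bsize)] ++ s.2).
  elim: n t p' w' => [|n IH] t p' w' Et lo hi.
    rewrite (drop_nth t) ?size_enum_ord // nth_ord_enum drop_oversize; last first.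
      by move: Et; rewrite size_enum_ord addn1 => ->.
    have EtB : t.+1 = bsize by rewrite -addn1.
    have EtB' : (t.+1 == bsize) = true by apply/eqP.
    rewrite /= EtB'.
    have -> : newbit (acts t) fst (p' t) (f t) = g t by rewrite ffunE hi.
    have -> : ordS t = pos0 by apply: val_inj; rewrite /= EtB modnn.
    have lt j : j <> t -> (j < t)%N.
      move=> jt; have := ltn_ord j; rewrite -[X in _ < X]EtB ltnS leq_eqVlt.
      by case/orP=> // /eqP /val_inj.
    have -> : ffset p' t (f t) = f.
      by apply/ffunP=> j; rewrite ffunE; case: eqP => [->|/lt /lo []].
    have -> // : ffset w' t (g t) = g.
    by apply/ffunP=> j; rewrite [LHS]ffunE; case: eqP => [->|/lt /lo []].
  have lt1 : t.+1 < bsize by rewrite -[X in _ < X]Et !addnS !ltnS leq_addr.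
  have vS : ordS t = t.+1 :> nat by rewrite /= modn_small.
  rewrite (drop_nth t) ?size_enum_ord // nth_ord_enum.
  rewrite /= (ltn_eqF lt1).
  have -> : newbit (acts t) fst (p' t) (f t) = g t by rewrite ffunE hi.
  have := IH (ordS t) (ffset p' t (f t)) (ffset w' t (g t)).
  rewrite vS addSnnS => /(_ Et) IH'.
  rewrite {}IH' //.
    move=> j; rewrite ltnS => le_jt; rewrite ![ffset _ _ _ _]ffunE.
    by case: eqP => [->|/eqP ne] //; apply: lo; rewrite ltn_neqAle le_jt andbT.
  move=> j lt_tj; rewrite ffunE; case: eqP => [ej|_]; last by apply: hi; apply: ltnW.
  by rewrite ej ltnn in lt_tj.
have := step bsize.-1 pos0 prev news; rewrite drop0 add0n prednK ?bsize_gt0 //.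
by move=> /(_ erefl) ->.
Qed.

Definition blk (mk : pred 'I_bsize) (base : nat -> block) (pos : 'I_bsize -> nat) (j : nat) : block :=
  [ffun t => if mk t then j == pos t else base j t].

(** On mark cells the old contents are prescribed only where the action is not a reset. This covers
    the first sweep, which meets arbitrary bits there. *)
Lemma sweepY (mk : pred 'I_bsize) (base : nat -> block) (b : bool) (acts : actF)
    (xa xs : option bool) (a : au_S A) (xs' : option bool) pos (old : nat -> block) n v :
  let c : ctl := (b, acts, xa, xs, a) in
  (forall t, ~~ mk t -> acts t = None) ->
  (forall t j, mk t -> acts t = Some false \/ old j t = (j == pos t)) ->
  (forall t j, ~~ mk t -> old j t = base j t) ->
  let pos' t := newpos (acts t) (pos t) in
  exists prev' news' : block,
  @sweep mach (Some (c, inr (xs', ystate0)))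
     (flatten [seq bbits (old j) | j <- iota 0 n] ++ v) =
  let s := @sweep mach (Some (c, inr (xs', (pos0, n == 0, prev', news',
             foldl oupd oacc0 [seq blk mk base pos' j | j <- iota 0 n])))) v in
  (s.1, flatten [seq bbits (blk mk base pos' j) | j <- iota 0 n] ++ s.2).
Proof.
move=> c noact oldE baseE pos'.
have oldc k t : newbit (acts t) (k == 0) (if k is k'.+1 then old k' t else false) (old k t) = blk mk base pos' k t.
  rewrite ffunE; case mt: (mk t); last by rewrite noact ?mt //= baseE ?mt.
  rewrite /pos'; case: (oldE t k mt) => [->|Ek] //=.
  rewrite Ek; case: k Ek => [|k] Ek.
    by case: (acts t) => [[]|].
  case: (oldE t k mt) => [->|Ek'] //=.
  rewrite Ek' -[k == _]eqSS [k.+1 == (pos t).+1]eq_sym; exact: newbit_pos.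
have gen n0 k (prev news : block) (o : oacc) :
  (forall t, prev t = if k is k'.+1 then old k' t else false) ->
  exists prev' news' : block,
  @sweep mach (Some (c, inr (xs', (pos0, k == 0, prev, news, o))))
     (flatten [seq bbits (old j) | j <- iota k n0] ++ v) =
  let s := @sweep mach (Some (c, inr (xs', (pos0, k + n0 == 0, prev', news',
             foldl oupd o [seq blk mk base pos' j | j <- iota k n0])))) v in
  (s.1, flatten [seq bbits (blk mk base pos' j) | j <- iota k n0] ++ s.2).
  elim: n0 k prev news o => [|n0 IH] k prev news o Ep.
    by exists prev, news; rewrite addn0 /=; case: (sweep _ _).
  rewrite /= -catA sweepY_block.
  set g : block := finfun _.
  have -> : g = blk mk base pos' k by apply/ffunP=> t; rewrite [LHS]ffunE Ep oldc.
  have [|prev' [news' E]] := IH k.+1 (old k) (blk mk base pos' k)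
    (oupd o (blk mk base pos' k)); first by [].
  exists prev', news'; rewrite -[false]/(k.+1 == 0) E /= addSnnS.
  by rewrite catA.
have [//|p' [w' E]] := gen n 0 [ffun=> false] [ffun=> false] oacc0.
  by move=> t; rewrite ffunE.
by exists p', w'; rewrite E.
Qed.

Lemma foldl_oupd (mk : pred 'I_bsize) base pos n :
  mk cQ -> (forall a, mk (cMark a)) -> ~~ mk cLast -> (forall l, ~~ mk (cPay l)) ->
  foldl oupd oacc0 [seq blk mk base pos j | j <- iota 0 n] =
  (has (fun j => base j cLast) (iota 0 n),
   [ffun a => pos (cMark a) < n],
   [ffun a => (pos (cMark a) < n) && base (pos (cMark a)) cLast],
   [ffun p => (pos (cMark p.2) < n) && (pos (cMark p.1) <= pos (cMark p.2))],
   [ffun l => (pos cQ < n) && base (pos cQ) (cPay l)]).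
Proof.
move=> mq mm ml mp; elim: n => [|n IH].
  by rewrite /= /oacc0; congr (_, _, _, _, _); apply/ffunP=> a; rewrite !ffunE.
rewrite -addn1 iotaD map_cat foldl_cat IH /= has_cat /= orbF add0n.
have lt1 p : (p < n + 1) = (p < n) || (n == p) by rewrite addn1 ltnS leq_eqVlt orbC eq_sym.
congr (_, _, _, _, _).
- by rewrite !ffunE (negPf ml).
- by apply/ffunP=> a; rewrite !ffunE mm lt1.
- apply/ffunP=> a; rewrite !ffunE mm (negPf ml) lt1.
  by case: (eqVneq n (pos (cMark a))) => [->|]; rewrite ?orbF ?ltnn.
- apply/ffunP=> p; rewrite !ffunE !mm lt1 /=.
  case: (eqVneq n (pos (cMark p.2))) => [<-|]; rewrite ?orbF ?ltnn //=.
  by rewrite [in RHS]leq_eqVlt orbC eq_sym.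
- apply/ffunP=> l; rewrite !ffunE mq (negPf (mp l)) lt1.
  by case: (eqVneq n (pos cQ)) => [->|]; rewrite ?orbF ?ltnn.
Qed.
Definition blocks_word (x : seq bool) (m : nat -> bool) (f : nat -> block) n :=
  marked_pairs x m ++ [:: false, true & flatten [seq bbits (f j) | j <- iota 0 n]].

(** The erased first letter explains [behead]. Marking flips second bits only, so this letter never
    changes; for empty [x] it is the first letter of the separator, [false], which is the default of
    [head]. *)
Lemma full_sweep (mk : pred 'I_bsize) (base old : nat -> block) (pos : 'I_bsize -> nat) x p
    (acts : actF) (xa : option bool) (a : au_S A) n :
  let c : ctl := (head false x, acts, xa, onth x p, a) in
  (forall t, ~~ mk t -> acts t = None) ->
  (forall t j, mk t -> acts t = Some false \/ old j t = (j == pos t)) ->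
  (forall t j, ~~ mk t -> old j t = base j t) ->
  let pos' t := newpos (acts t) (pos t) in
  exists prev' news' : block,
  @sweep mach (mstart c) (behead (blocks_word x (pred1 p) old n)) =
  (Some (c, inr (onth x (newpos xa p), (pos0, n == 0, prev', news',
             foldl oupd oacc0 [seq blk mk base pos' j | j <- iota 0 n]))),
   behead (blocks_word x (pred1 (newpos xa p)) (blk mk base pos') n)).
Proof.
move=> c noact oldE baseE pos'.
have [prev' [news' E]] := @sweepY mk base (head false x) acts xa (onth x p) a
  (onth x (newpos xa p)) pos old n [::] noact oldE baseE.
exists prev', news'.
move: E; rewrite /= !cats0 -/c -/pos' => E.
have := @sweepX c xa (onth x p) x p [::] x
  [:: false, true & flatten [seq bbits (old j) | j <- iota 0 n]] (conj erefl erefl)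
  erefl erefl.
rewrite [LHS]/= -/(blocks_word x (pred1 p) old n) => EX.
have {}EX : @sweep mach (Some (c, inl (xstate0, None))) (blocks_word x (pred1 p) old n) =
  (Some (c, inr (onth x (newpos xa p), (pos0, n == 0, prev', news',
     foldl oupd oacc0 [seq blk mk base pos' j | j <- iota 0 n]))),
   blocks_word x (pred1 (newpos xa p)) (blk mk base pos') n).
  rewrite EX.
  (* The separator is not mistaken for a marked 0: the mark has been passed already or the pointer
     lies beyond [x]. *)
  have seen0 : ~~ (p < size x) && (onth x p == Some false) = false.
    by case: ltnP => //= le; rewrite onth_default.
  rewrite /= seen0 /= {EX seen0}.
  have -> : (if newpos xa p < size x then onth x (newpos xa p) else None) =
    onth x (newpos xa p) by case: ltnP => // le; rewrite onth_default.
  by rewrite -/ystate0 E.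
have Ew m f : blocks_word x m f n = head false x :: behead (blocks_word x m f n).
  by rewrite /blocks_word; case: (x).
move: EX; rewrite (Ew _ old) [LHS]/= -/(mstart c).
case E': (sweep _ _) => [s' u'] /=; rewrite Ew => -[-> ->].
by [].
Qed.

(* After [t] steps digit number [a] of the counter is [digit a t], the table
   pointer is at [t %% D ^ 3] and the pointer in [x] at [t %% D]. *)
Section Odometer.
Variables (x : seq bool) (base : nat -> block) (n D : nat).
Hypothesis D_gt0 : 0 < D.
Hypothesis K_ge3 : 3 <= K.
Hypothesis le_Dn : D <= n.
Hypothesis lastE : forall j, j < D -> base j cLast = (j == D.-1).

Definition digit (i t : nat) := (t %/ D ^ i) %% D.

Definition isMark (c : 'I_bsize) : bool := if enum_val c is Some (inr _) then true else false.

Definition posn (t : nat) (c : 'I_bsize) : nat :=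
  match enum_val c with
  | Some (inr (Some a)) => digit a t
  | Some (inr None) => t %% D ^ 3
  | _ => 0
  end.

Definition obsT (t : nat) : obs I :=
  mkobs (true, [ffun=> true], [ffun a : 'I_K => digit a t == D.-1],
    [ffun p : 'I_K * 'I_K => digit p.1 t <= digit p.2 t],
    [ffun l => (t %% D ^ 3 < n) && base (t %% D ^ 3) (cPay l)]) (onth x (t %% D)).

Lemma digit_lt i t : digit i t < D. Proof. by rewrite ltn_mod. Qed.

Lemma omaxE t i : i < K -> omax (obsT t) i = (digit i t == D.-1).
Proof. by move=> lt; rewrite /= ffunE inordK. Qed.

Lemma oleE t i j : i < K -> j < K -> ole (obsT t) i j = (digit i t <= digit j t).
Proof. by move=> lti ltj; rewrite /= ffunE /= !inordK. Qed.

Lemma modD_max m : (m %% D == D.-1) = (D %| m.+1).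
Proof.
rewrite /dvdn -addn1 -modnDml addn1; have := ltn_pmod m D_gt0.
move: (m %% D) => r; rewrite leq_eqVlt => /orP[/eqP <-|lt].
  by rewrite modnn /= !eqxx.
by rewrite modn_small //; apply/eqP => E; rewrite E prednK ?ltnn in lt.
Qed.

(** Adding 1 to [t] carries past the [i] lowest digits exactly when each of them is D - 1. *)
Lemma allmaxE t i : i <= K -> allmax (obsT t) i = (D ^ i %| t.+1).
Proof.
elim: i => [|i IH] lti; first by rewrite dvd1n.
rewrite /allmax -addn1 iotaD all_cat add0n -/(allmax _ _) IH; last by apply: ltnW.
rewrite /= andbT -/(omax (obsT t) i) -[X in _ && X]/(omax (obsT t) i) omaxE // /digit modD_max.
rewrite addn1 expnSr.
case dv: (D ^ i %| t.+1) => /=.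
  have := divnS t (d := D ^ i); rewrite expn_gt0 D_gt0 dv /= add1n => <- //.
  by rewrite -[X in _ = (_ %| X)](divnK dv) [_ %/ _ * _]mulnC dvdn_pmul2l // expn_gt0 D_gt0.
by apply/esym/negP=> dv'; move: dv; rewrite (dvdn_trans _ dv') ?dvdn_mulr.
Qed.

Lemma odoE t i : i < K -> newpos (odo (obsT t) i) (digit i t) = digit i t.+1.
Proof.
move=> lti; rewrite /odo allmaxE ?(ltnW lti) // omaxE // {3}/digit divnS ?expn_gt0 ?D_gt0 //.
case: ifP => _ //=; rewrite add1n modnS -modD_max -/(digit i t).
by case: (_ == _).
Qed.

Definition actsT t := marksact (odo (obsT t)) (Some (~~ allmax (obsT t) 3)).

Lemma actsT_pos t c : isMark c -> newpos (actsT t c) (posn t c) = posn t.+1 c.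
Proof.
rewrite /isMark ffunE /posn; case: (enum_val c) => [[//|[a|]]|//] _.
  by rewrite odoE.
by rewrite allmaxE // [in RHS]modnS; case: (_ %| _).
Qed.

Lemma xact_pos t : newpos (Some (~~ omax (obsT t) 0)) (t %% D) = t.+1 %% D.
Proof. by rewrite omaxE // /digit expn0 divn1 modD_max modnS; case: (_ %| _). Qed.

Lemma isMarkQ : isMark cQ. Proof. by rewrite /isMark enum_rankK. Qed.
Lemma isMarkM a : isMark (cMark a). Proof. by rewrite /isMark enum_rankK. Qed.
Lemma isMarkL : ~~ isMark cLast. Proof. by rewrite /isMark enum_rankK. Qed.
Lemma isMarkP l : ~~ isMark (cPay l). Proof. by rewrite /isMark enum_rankK. Qed.

Lemma has_last : has (fun j => base j cLast) (iota 0 n).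
Proof.
apply/hasP; exists D.-1; last by rewrite lastE ?eqxx // prednK.
by rewrite mem_iota /= add0n (leq_trans _ le_Dn) // prednK.
Qed.

Lemma turn_obs t xo : mkobs (foldl oupd oacc0 [seq blk isMark base (posn t) j | j <- iota 0 n]) xo =
  mkobs (true, [ffun=> true], [ffun a : 'I_K => digit a t == D.-1],
    [ffun p : 'I_K * 'I_K => digit p.1 t <= digit p.2 t],
    [ffun l => (t %% D ^ 3 < n) && base (t %% D ^ 3) (cPay l)]) xo.
Proof.
rewrite foldl_oupd ?isMarkQ ?isMarkL //; [|exact: isMarkM|exact: isMarkP].
have pM a : posn t (cMark a) = digit a t by rewrite /posn enum_rankK.
have pQ : posn t cQ = t %% D ^ 3 by rewrite /posn enum_rankK.
have ltn_ a : digit a t < n by apply: leq_trans (digit_lt _ _) le_Dn.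
rewrite /mkobs /=.
set f1 := finfun _; set f2 := finfun _; set f3 := finfun _.
have -> : f2 = [ffun a : 'I_K => digit a t == D.-1].
  by apply/ffunP=> a; rewrite !ffunE pM ltn_ lastE ?digit_lt.
have -> : f1 = [ffun p : 'I_K * 'I_K => digit p.1 t <= digit p.2 t].
  by apply/ffunP=> a; rewrite !ffunE !pM ltn_.
have -> // : f3 = [ffun l => (t %% D ^ 3 < n) && base (t %% D ^ 3) (cPay l)].
by apply/ffunP=> a; rewrite !ffunE !pQ.
Qed.

Definition stateT t : au_S A := foldl (@au_step I A) (au_init A) [seq obsT j | j <- iota 0 t].

Lemma stateTS t : stateT t.+1 = au_step (stateT t) (obsT t).
Proof. by rewrite /stateT -addn1 iotaD map_cat foldl_cat. Qed.

Definition wordT t := behead (blocks_word x (pred1 (t %% D)) (blk isMark base (posn t)) n).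

Lemma turnT t (acts : actF) xa xs prev news :
  t < D ^ K ->
  @sw_turn mach (Some ((head false x, acts, xa, xs, stateT t), inr (onth x (t %% D),
    (pos0, n == 0, prev, news,
     foldl oupd oacc0 [seq blk isMark base (posn t) j | j <- iota 0 n])))) =
  if t.+1 == D ^ K then inr (au_out (stateT t.+1))
  else inl (mstart (nextctl (head false x) (obsT t) (stateT t.+1))).
Proof.
move=> ltt; rewrite [LHS]/(mturn _) /mturn turn_obs -/(obsT t) -stateTS.
rewrite foldl_oupd ?isMarkQ ?isMarkL //; [|exact: isMarkM|exact: isMarkP].
rewrite has_last /= allmaxE //; congr (if _ then _ else _).
apply/idP/eqP => [dv|<- //]; apply/eqP; rewrite eqn_leq ltt.
by rewrite dvdn_leq.
Qed.

Lemma runT m t : t.+1 + m = D ^ K ->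
  @sw_run mach m (mstart (nextctl (head false x) (obsT t) (stateT t.+1))) (wordT t) =
  if m == 0 then None else Some (au_out (stateT (D ^ K))).
Proof.
elim: m t => [//|m IH] t Em.
have noact c : ~~ isMark c -> actsT t c = None.
  by rewrite /isMark ffunE; case: (enum_val c) => [[|[]]|].
have [c j mc|c j /negPf mc|prev [news E]] := @full_sweep isMark base
  (blk isMark base (posn t)) (posn t) x (t %% D) (actsT t) (Some (~~ omax (obsT t) 0))
  (stateT t.+1) n noact.
- by right; rewrite ffunE mc.
- by rewrite ffunE mc.
have Eblk j : blk isMark base (fun c => newpos (actsT t c) (posn t c)) j = blk isMark base (posn t.+1) j.
  by apply/ffunP=> c; rewrite [LHS]ffunE [RHS]ffunE; case: ifP => // mc; rewrite actsT_pos.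
have Emap : [seq blk isMark base (fun c => newpos (actsT t c) (posn t c)) j | j <- iota 0 n] =
  [seq blk isMark base (posn t.+1) j | j <- iota 0 n] by apply: eq_map.
have Ewd m' : behead (blocks_word x m' (blk isMark base (fun c => newpos (actsT t c) (posn t c))) n) =
  behead (blocks_word x m' (blk isMark base (posn t.+1)) n).
  by rewrite /blocks_word; congr (behead (_ ++ [:: _, _ & flatten _])); apply: eq_map => j; rewrite Eblk.
have En : nextctl (head false x) (obsT t) (stateT t.+1) =
  (head false x, actsT t, Some (~~ omax (obsT t) 0), onth x (t %% D), stateT t.+1) by [].
rewrite sw_runS En /wordT E Emap Ewd xact_pos turnT; last by rewrite -Em; lia.
have [m0|m_gt0] := posnP m.
  have et : t.+2 = D ^ K by rewrite -Em m0 addn1.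
  by rewrite et eqxx.
have -> : (t.+2 == D ^ K) = false by rewrite -Em; apply/eqP; lia.
have := IH t.+1; rewrite addSnnS eqn0Ngt m_gt0 => /(_ Em) /= <-.
by rewrite -/(wordT t.+1).
Qed.

Lemma runD (old : nat -> block) :
  (forall c j, ~~ isMark c -> old j c = base j c) ->
  @sw_run mach (D ^ K) (mstart (ctl0 (head false x)))
    (behead (blocks_word x (fun=> false) old n)) = Some (au_out (stateT (D ^ K))).
Proof.
move=> baseE.
have noact c : ~~ isMark c -> marksact (fun=> Some false) (Some false) c = None.
  by rewrite /isMark ffunE; case: (enum_val c) => [[|[]]|].
have mact c : isMark c -> marksact (fun=> Some false) (Some false) c = Some false.
  by rewrite /isMark ffunE; case: (enum_val c) => [[|[]]|].
(* Before the first sweep the pointer in [x] counts as standing at [size x], just past the end,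
   where it marks no pair. *)
have [c j mc|c j mc|prev [news E]] := @full_sweep isMark base old
  (fun=> 0) x (size x) (marksact (fun=> Some false) (Some false)) (Some false)
  (au_init A) n noact.
- by left; exact: mact.
- exact: baseE.
have p0 c : posn 0 c = 0.
  by rewrite /posn /digit; case: (enum_val c) => [[|[a|]]|] //; rewrite ?div0n mod0n.
have Eblk j : blk isMark base (fun c => newpos (marksact (fun=> Some false) (Some false) c) 0) j = blk isMark base (posn 0) j.
  by apply/ffunP=> c; rewrite [LHS]ffunE [RHS]ffunE p0; case: ifP => // mc; rewrite mact.
have Emap : [seq blk isMark base (fun c => newpos (marksact (fun=> Some false) (Some false) c) 0) j | j <- iota 0 n] =
  [seq blk isMark base (posn 0) j | j <- iota 0 n] by apply: eq_map.
have Ewd m' : behead (blocks_word x m' (blk isMark base (fun c => newpos (marksact (fun=> Some false) (Some false) c) 0)) n) =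
  behead (blocks_word x m' (blk isMark base (posn 0)) n).
  by rewrite /blocks_word; congr (behead (_ ++ [:: _, _ & flatten _])); apply: eq_map => j; rewrite Eblk.
have Epx : blocks_word x (pred1 (size x)) old n = blocks_word x (fun=> false) old n.
  rewrite /blocks_word; congr (_ ++ _).
  by elim: (x) => //= b s IH; rewrite IH.
move: E; rewrite onth_default // Epx Emap Ewd [newpos _ _]/= => E.
have DK : 0 < D ^ K by rewrite expn_gt0 D_gt0.
rewrite -{1}(prednK DK) sw_runS E.
have T0 acts xa xs := @turnT 0 acts xa xs prev news DK.
rewrite mod0n in T0; rewrite -[au_init A]/(stateT 0) {}T0.
have := @runT (D ^ K).-1 0; rewrite add1n prednK // => /(_ erefl) /= R.
rewrite /wordT mod0n in R.
case: eqP => [<- //|ne]; rewrite R.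
by case: eqP => // e0; case: ne; rewrite -e0 prednK.
Qed.

End Odometer.

(** * Malformed inputs and the language of the machine *)

Lemma parseX b acts xa a xl u c' st :
  let c : ctl := (b, acts, xa, None, a) in
  (@sweep mach (Some (c, inl (xl, None))) u).1 = Some (c', inr st) ->
  exists x y xs',
    u = pair_enc x y /\ (@sweep mach (Some (c, inr (xs', ystate0))) y).1 = Some (c', inr st).
Proof.
move=> c; have [m] := ubnP (size u); elim: m u xl => // m IH [|b1 [|b2 u]] [[[fs ca] se] x'] //.
rewrite !ltnS => lem; rewrite /=.
have -> : (None == Some b1 :> option bool) = false by [].
rewrite !andbF !orbF; case: (eqVneq b1 b2) => [<-|]; last first.
  clear lem; case: b1 b2 => [] [] //= _ E; last by exists [::], u, x'.
  suff: (@sweep mach None u).1 = None by rewrite E.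
  by elim: (u) => //= b' u' ->.
move=> /= E; have [|x [y [xs' [Eu Es]]]] := IH u _ _ E; first by apply: ltnW.
by exists (b1 :: x), y, xs'; rewrite Eu.
Qed.

Lemma sweepY_pos b acts xa xs a xs' (yl : yloc) v :
  let c : ctl := (b, acts, xa, xs, a) in
  exists fst prev news o (t : 'I_bsize),
    (@sweep mach (Some (c, inr (xs', yl))) v).1 =
      Some (c, inr (xs', (t, fst, prev, news, o))) /\
    t = (yl.1.1.1.1 + size v) %% bsize :> nat.
Proof.
move=> c; elim: v yl => [|b' v IH] [[[[t fs] prev] news] o].
  by exists fs, prev, news, o, t; rewrite addn0 modn_small.
rewrite [sweep _ _]/=; set yl' := (ordS t, _, _, _, _).
have [fs1 [prev1 [news1 [o1 [t1 [-> Et]]]]]] := IH yl'.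
exists fs1, prev1, news1, o1, t1; split=> //.
by rewrite Et /= modnDml addSnnS.
Qed.

Lemma bbits_chunk y : bsize %| size y -> exists bs : seq block, y = flatten (map bbits bs).
Proof.
have [m] := ubnP (size y); elim: m y => // m IH y ltm dv.
case: (posnP (size y)) => [/size0nil ->|y0]; first by exists [::].
have leB : bsize <= size y by rewrite dvdn_leq.
have [||bs E] := IH (drop bsize y).
- by rewrite size_drop; have := bsize_gt0; lia.
- by rewrite size_drop dvdn_sub.
exists ([ffun t : 'I_bsize => nth false y t] :: bs); rewrite /= -E.
rewrite -{1}(cat_take_drop bsize y); congr (_ ++ _).
apply: (@eq_from_nth _ false); first by rewrite size_map size_enum_ord size_takel.
move=> i; rewrite size_takel // => lti.
by rewrite (nth_map pos0) ?size_enum_ord // ffunE nth_enum_ord // nth_take.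
Qed.

Lemma mach_malformed b u :
  (exists x (bs : seq block), b :: u = pair_enc x (flatten (map bbits bs)) /\
     has (fun f : block => f cLast) bs)
  \/ @sw_run mach 1 (mstart (ctl0 b)) u = Some false.
Proof.
rewrite sw_runS; case E: (sweep _ _) => [s' u'].
have [T|T] : mturn s' = inr false \/ mturn s' <> inr false.
- by case: (mturn s') => [?|[]]; [right|right|left].
- by right; have -> : @sw_turn mach (s', u').1 = inr false by exact: T.
left; move: T {E}(congr1 fst E); rewrite [(s', u').1]/= /mturn.
case: s' => [[[[[[b' acts] xa] xs] a] [//|[xs' [[[[t fs] prev] news] o]]]]|//].
case: o => [[[[hl seen] mx] le] qp].
case: ifP => // /andP [/eqP t_0 hlT] _ E.
pose acts0 := marksact (fun=> Some false) (Some false).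
pose c0 : ctl := (b, acts0, Some false, None, au_init A).
have {}E : (@sweep mach (Some (c0, inl (xstate0, None))) (b :: u)).1 =
   Some ((b', acts, xa, xs, a), inr (xs', (t, fs, prev, news, (hl, seen, mx, le, qp)))).
  by rewrite sweep_cons [LHS]/= -E.
have [x [y [xs2 [Eu Es]]]] := parseX E; rewrite Eu.
have [fs1 [prev1 [news1 [o1 [t1 [Es' Et]]]]]] := sweepY_pos b
  acts0 (Some false) None (au_init A) xs2 ystate0 y.
have [Et1 Eo] : t1 = t /\ o1 = (hl, seen, mx, le, qp).
  by move: Es; rewrite Es' => -[].
rewrite {}Et1 t_0 /= add0n in Et.
have [|bs Ey] := @bbits_chunk y; first by rewrite /dvdn -Et.
exists x, bs; rewrite Ey; split=> //.
pose old j := nth [ffun=> false] bs j.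
have Ebs : bs = [seq old j | j <- iota 0 (size bs)] by rewrite -/(mkseq _ _) mkseq_nth.
have [||p1 [n1 E1]] := @sweepY isMark old b acts0 (Some false) None (au_init A) xs2
  (fun=> 0) old (size bs) [::] _ _ (fun _ _ _ => erefl).
- by move=> c; rewrite /isMark ffunE; case: (enum_val c) => [[|[]]|].
- by move=> c j; rewrite /isMark ffunE; case: (enum_val c) => [[|[]]|] //; left.
have Eyy : flatten (map bbits bs) = flatten [seq bbits (old j) | j <- iota 0 (size bs)] ++ [::].
  by rewrite {1}Ebs -map_comp cats0.
have Eo1 : o1 = foldl oupd oacc0
    [seq blk isMark old (fun c => newpos (acts0 c) 0) j | j <- iota 0 (size bs)].
  by move: (congr1 fst E1); rewrite -Eyy -Ey Es' => -[].
move: Eo1; rewrite Eo foldl_oupd ?isMarkQ ?isMarkL //; try exact: isMarkM; try exact: isMarkP.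
by case=> hlE _ _ _ _; rewrite Ebs has_map; move: hlT; rewrite -hlE.
Qed.

(** The base D of the counter, which the certificate chooses by its first flagged block. *)
Definition lastpos (bs : seq block) := (find (fun f : block => f cLast) bs).+1.
Definition bnth (bs : seq block) (j : nat) : block := nth [ffun=> false] bs j.

Lemma size_bbits f : size (bbits f) = bsize.
Proof. by rewrite size_map size_enum_ord. Qed.

Lemma size_bits bs : size (flatten (map bbits bs)) = bsize * size bs.
Proof. by elim: bs => [|f bs IH] /=; rewrite ?muln0 // size_cat IH size_bbits mulnS. Qed.

Hypothesis K_ge3 : 3 <= K.

Lemma mach_run b u x (bs : seq block) :
  b :: u = pair_enc x (flatten (map bbits bs)) ->
  has (fun f : block => f cLast) bs ->
  let D := lastpos bs in
  @sw_run mach (D ^ K) (mstart (ctl0 b)) u =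
  Some (au_out (stateT x (bnth bs) (size bs) D (D ^ K))).
Proof.
move=> Ew hs D.
have := @runD x (bnth bs) (size bs) D isT K_ge3 _ _ (bnth bs) (fun _ _ _ => erefl).
rewrite /blocks_word.
have Eb : b = head false x /\ u = behead (pair_enc x (flatten (map bbits bs))).
  by rewrite -Ew; split=> //; move: Ew; case: (x) => [|? ?] [].
case: Eb => -> ->; rewrite pair_encE.
have Ebs : flatten (map bbits bs) = flatten [seq bbits (bnth bs j) | j <- iota 0 (size bs)].
  by rewrite -{1}(mkseq_nth [ffun=> false] bs) /mkseq -map_comp.
move=> H; rewrite Ebs; apply: H; first by rewrite /D /lastpos -has_find.
move=> j; rewrite /D /lastpos ltnS /= leq_eqVlt => /orP [/eqP ->|lt].
  by rewrite eqxx; exact: (nth_find [ffun=> false] hs).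
by rewrite (ltn_eqF lt); exact: (before_find [ffun=> false] lt).
Qed.

(** D is at most the number of blocks, hence at most the length of the word, and D^K sweeps are
    polynomially many because K is fixed. *)
Lemma mach_inP : inP (sw_lang mach).
Proof.
apply: (@sw_lang_inP _ 1 K) => b u.
have [[x [bs [Ew hs]]]|R] := mach_malformed b u; last first.
  by exists 1, false; split=> //; rewrite mul1n expn_gt0.
exists (lastpos bs ^ K); eexists; split; last exact: mach_run Ew hs.
rewrite mul1n leq_exp2r //.
have : lastpos bs <= size bs by rewrite /lastpos -has_find.
move/leq_trans; apply.
have -> : (size u).+1 = size (b :: u) by [].
rewrite Ew pair_encE size_cat /= size_bits.
apply: leq_trans (leq_pmull (size bs) bsize_gt0) _.
by rewrite !addnS; do 2 apply: leqW; apply: leq_addl.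
Qed.

Lemma mach_lang x (bs : seq block) :
  has (fun f : block => f cLast) bs ->
  let D := lastpos bs in
  sw_lang mach (pair_enc x (flatten (map bbits bs))) <->
  au_out (stateT x (bnth bs) (size bs) D (D ^ K)).
Proof.
move=> hs D; case Ew: (pair_enc _ _) => [|b u].
  by move: Ew; rewrite pair_encE; case: (x).
have R := mach_run (esym Ew) hs; split=> [[n R']|out].
  by rewrite (sw_run_det R R').
by exists (D ^ K); rewrite R; case: (au_out _) out.
Qed.

Lemma mach_lang_blocks x y : sw_lang mach (pair_enc x y) ->
  exists2 bs : seq block, y = flatten (map bbits bs) & has (fun f : block => f cLast) bs.
Proof.
case Ew: (pair_enc _ _) => [//|b u] [n R].
have [[x' [bs [Ew' hs]]]|R'] := mach_malformed b u; last first.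
  by have := sw_run_det R R'.
exists bs => //; by have [_] := pair_enc_inj (etrans Ew Ew').
Qed.

End Machine.

(** * First-order sentences over an initial segment of nat *)

(* Parametric higher-order abstract syntax: [V] is instantiated by values in
   [den] and by variable names in [form_aut]. *)
Inductive form (I V : Type) : Type :=
| FLe of V & V
| FRel of I & V & V & V
| FX of V
| FIn of V
| FNot of form I V
| FAnd of form I V & form I V
| FEx of (V -> form I V).
Arguments FLe {I V}. Arguments FRel {I V}. Arguments FX {I V}. Arguments FIn {I V}.
Arguments FNot {I V}. Arguments FAnd {I V}. Arguments FEx {I V}.

Section Den.
Variables (I : Type) (D : nat) (x : seq bool) (R : I -> nat -> nat -> nat -> bool).

Fixpoint den (p : form I nat) : Prop :=
  match p with
  | FLe i j => i <= j
  | FRel l i j k => R l i j k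
  | FX i => nth false x i
  | FIn i => i < size x
  | FNot p => ~ den p
  | FAnd p q => den p /\ den q
  | FEx f => exists2 i, i < D & den (f i)
  end.

End Den.

Section Frel.
Variables (I : Type) (K : nat).

Definition upd (env : nat -> nat) (r v : nat) (y : nat) : nat :=
  if y == r then v else env y.

(* [varel r env p q]: [p] is a formula over variable names, [q] the same formula
   over values, and [env] maps the names in [[r, K)] to values. *)
Inductive varel : nat -> (nat -> nat) -> form I nat -> form I nat -> Prop :=
| RLe r env i j : r <= i < K -> r <= j < K -> varel r env (FLe i j) (FLe (env i) (env j))
| RRel r env l i j k : r <= i < K -> r <= j < K -> r <= k < K ->
    varel r env (FRel l i j k) (FRel l (env i) (env j) (env k))
| RX r env i : r <= i < K -> varel r env (FX i) (FX (env i))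
| RIn r env i : r <= i < K -> varel r env (FIn i) (FIn (env i))
| RNot r env p q : varel r env p q -> varel r env (FNot p) (FNot q)
| RAnd r env p q p' q' : varel r env p q -> varel r env p' q' ->
    varel r env (FAnd p p') (FAnd q q')
| REx r env f g : 3 <= r -> (forall v, varel r (upd env r v) (f r) (g v)) ->
    varel r.+1 env (FEx f) (FEx g).

End Frel.

(** * Compiling formulas into automata *)

Section Comp.
Variable I : finType.

Definition oeq (o : obs I) i j := ole o i j && ole o j i.

(* [form_aut r p] reads the observations at D^r consecutive counter values, on which
   the digits >= r are constant.  A quantifier at level [r.+1] binds digit [r],
   and the table is searched by means of the digits 2, 1, 0. *)
Fixpoint form_aut (r : nat) (p : form I nat) : automaton I :=
  match p with
  | FLe i j => @Automaton I bool false (fun s o => s || ole o i j) id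
  | FRel l i j k => @Automaton I bool false (fun s o =>
      s || [&& oeq o i 2, oeq o j 1, oeq o k 0 & oq o l]) id
  | FX i => @Automaton I bool false (fun s o =>
      s || [&& oeq o i 0 & ox o == Some true]) id
  | FIn i => @Automaton I bool false (fun s o =>
      s || [&& oeq o i 0 & isSome (ox o)]) id
  | FNot p => let a := form_aut r p in
      @Automaton I (au_S a) (au_init a) (@au_step I a) (fun s => ~~ au_out s)
  | FAnd p q => let a := form_aut r p in let b := form_aut r q in
      @Automaton I (au_S a * au_S b)%type (au_init a, au_init b)
        (fun s o => (au_step s.1 o, au_step s.2 o)) (fun s => au_out s.1 && au_out s.2)
  | FEx f => let a := form_aut r.-1 (f r.-1) in
      @Automaton I (au_S a * bool)%type (au_init a, false)
        (fun s o => let s' := au_step s.1 o in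
           if allmax o r.-1 then (au_init a, s.2 || au_out s') else (s', s.2)) snd
  end.

Section Correct.
Variables (K' : nat) (AA : automaton I) (x : seq bool) (D n : nat).
Notation K := K'.+1.
Variable base : nat -> block I K'.
Hypothesis D_gt0 : 0 < D.
Hypothesis K_ge3 : 3 <= K.

Notation ob := (obsT x base n D).

Definition tabrel (l : I) (i j k : nat) : bool :=
  let q := i * D ^ 2 + j * D + k in (q < n) && base q (cPay K' l).

Definition run (a : automaton I) (s : au_S a) (ts : seq nat) : au_S a :=
  foldl (@au_step I a) s [seq ob t | t <- ts].

Lemma run_cat a s t1 t2 : @run a s (t1 ++ t2) = run (run s t1) t2.
Proof. by rewrite /run map_cat foldl_cat. Qed.

Lemma run_has (P : obs I -> bool) ts :
  @run (@Automaton I bool false (fun s o => s || P o) id) false ts = has (P \o ob) ts.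
Proof.
rewrite /run -[RHS]orFb; elim: ts false => [|t ts IH] s /=; first by rewrite orbF.
by rewrite IH orbA.
Qed.

Lemma digit_block y r A t : r <= y -> A * D ^ r <= t < A.+1 * D ^ r ->
  digit D y t = digit D y (A * D ^ r).
Proof.
move=> le_ry /andP [le lt]; have P0 : 0 < D ^ r by rewrite expn_gt0 D_gt0.
rewrite /digit -(subnKC le_ry) expnD !divnMA mulnK //.
have -> // : t %/ D ^ r = A.
by apply/eqP; rewrite eqn_leq -ltnS ltn_divLR // lt leq_divRL.
Qed.

(** The three lowest digits run through all triples while the digits from [r] on stay fixed; this is
    why variables live on digits 3 and above. *)
Lemma exists_block r A i j k : 3 <= r -> i < D -> j < D -> k < D ->
  exists t, [/\ A * D ^ r <= t < A.+1 * D ^ r, digit D 2 t = i, digit D 1 t = j,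
    digit D 0 t = k & t %% D ^ 3 = i * D ^ 2 + j * D + k].
Proof.
move=> r3 lti ltj ltk; pose s := i * D ^ 2 + j * D + k.
have e3 : D ^ 3 = D * D ^ 2 by rewrite expnS.
have e2 : D ^ 2 = D * D by rewrite expnS expn1.
have s2 : j * D + k < D ^ 2.
  rewrite e2; apply: leq_trans (_ : j.+1 * D <= _); last by rewrite leq_mul2r ltj orbT.
  by rewrite mulSn; lia.
have s3 : s < D ^ 3.
  rewrite e3; apply: leq_trans (_ : i.+1 * D ^ 2 <= _); last by rewrite leq_mul2r lti orbT.
  by rewrite mulSn /s; lia.
have [m Em] : exists m, D ^ r = m * D ^ 3.
  by exists (D ^ (r - 3)); rewrite -expnD subnK.
exists (A * D ^ r + s).
have tm : (A * D ^ r + s) %% D ^ 3 = s.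
  by rewrite Em mulnA modnMDl modn_small.
have ds y : y < 3 -> digit D y (A * D ^ r + s) = digit D y s.
  move=> lty; rewrite /digit Em mulnA.
  have -> : D ^ 3 = D ^ (2 - y) * D * D ^ y.
    by rewrite -expnSr -expnD; congr (_ ^ _); lia.
  by rewrite !mulnA divnMDl ?expn_gt0 ?D_gt0 // modnMDl.
split=> //.
- rewrite leq_addr /= mulSn addnC ltn_add2r (leq_trans s3) //.
  by rewrite leq_pexp2l.
- rewrite ds // /digit /s -addnA divnMDl ?expn_gt0 ?D_gt0 // divn_small //.
  by rewrite addn0 modn_small.
- rewrite ds // /digit /s e2 mulnA -mulnDl expn1 divnMDl // divn_small // addn0.
  by rewrite modnMDl modn_small.
- by rewrite ds // /digit /s e2 mulnA -mulnDl expn0 divn1 modnMDl modn_small.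
Qed.

Lemma iota_block A P : 0 < P -> iota (A * P) P = iota (A * P) P.-1 ++ [:: (A.+1 * P).-1].
Proof.
move=> P0; rewrite -{2}(prednK P0) -addn1 iotaD mulSn; congr (_ ++ [:: _]).
by lia.
Qed.

(** Within the block the [r] lowest digits are all maximal only at the last count; there the inner
    automaton is evaluated and reset. *)
Lemma run_ex_block r f A acc : r < K ->
  @run (form_aut r.+1 (FEx f)) (au_init (form_aut r (f r)), acc) (iota (A * D ^ r) (D ^ r)) =
  (au_init (form_aut r (f r)),
   acc || au_out (@run (form_aut r (f r)) (au_init _) (iota (A * D ^ r) (D ^ r)))).
Proof.
move=> ltr; have P0 : 0 < D ^ r by rewrite expn_gt0 D_gt0.
have early s ts : all (fun t => ~~ (D ^ r %| t.+1)) ts ->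
  @run (form_aut r.+1 (FEx f)) (s, acc) ts = (@run (form_aut r (f r)) s ts, acc).
  elim: ts s => //= t ts IH s /andP [nt al]; rewrite /run [LHS]/=.
  rewrite -/(obsT x base n D t) allmaxE ?(ltnW ltr) // (negPf nt).
  exact: IH.
rewrite iota_block // !run_cat early; last first.
  apply/allP=> t; rewrite mem_iota => /andP [le lt].
  apply/negP=> dv; have [q Eq] := dvdnP dv.
  have : A * D ^ r < q * D ^ r < A.+1 * D ^ r.
    by rewrite -Eq mulSn; move: le lt P0; lia.
  by rewrite !ltn_mul2r P0 /=; lia.
rewrite {1}/run [LHS]/= allmaxE ?(ltnW ltr) // prednK ?dvdn_mull //.
by rewrite muln_gt0.
Qed.

(** A block of D^(r+1) counts splits into D blocks of D^r counts, one for each value of digit [r],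
    which is the bound variable. *)
Lemma run_ex r f A : r < K ->
  au_out (@run (form_aut r.+1 (FEx f)) (au_init _) (iota (A * D ^ r.+1) (D ^ r.+1))) =
  has (fun v => au_out (@run (form_aut r (f r)) (au_init _) (iota ((A * D + v) * D ^ r) (D ^ r))))
    (iota 0 D).
Proof.
move=> ltr.
suff E m : @run (form_aut r.+1 (FEx f)) (au_init _) (iota (A * D ^ r.+1) (m * D ^ r)) =
  (au_init (form_aut r (f r)), has (fun v => au_out (@run (form_aut r (f r)) (au_init _)
     (iota ((A * D + v) * D ^ r) (D ^ r)))) (iota 0 m)).
  by rewrite [in X in iota _ X]expnS E.
elim: m => [//|m IH].
have -> : iota 0 m.+1 = iota 0 m ++ [:: m] by rewrite -addn1 iotaD.
rewrite mulSn addnC iotaD run_cat IH has_cat /= orbF.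
have -> : A * D ^ r.+1 + m * D ^ r = (A * D + m) * D ^ r by rewrite mulnDl expnS mulnA.
by rewrite run_ex_block.
Qed.

Lemma modn_mul t a b : 0 < b -> t %% (a * b) = (t %/ b %% a) * b + t %% b.
Proof.
move=> b0; case: (posnP a) => [->|a0]; first by rewrite mul0n !modn0 -divn_eq.
rewrite {1}(divn_eq t b) {1}(divn_eq (t %/ b) a) mulnDl -mulnA -addnA modnMDl modn_small //.
have := ltn_pmod (t %/ b) a0; have := ltn_pmod t b0.
move: (t %% b) (t %/ b %% a) => u v ub va.
apply: leq_trans (_ : v.+1 * b <= _); last by rewrite leq_mul2r va orbT.
by rewrite mulSn; lia.
Qed.

Lemma mod_digits t : t %% D ^ 3 = digit D 2 t * D ^ 2 + digit D 1 t * D + digit D 0 t.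
Proof.
rewrite expnS modn_mul ?expn_gt0 ?D_gt0 // -addnA; congr (_ + _).
by rewrite expnS expn1 modn_mul // /digit expn1 expn0 divn1.
Qed.

Lemma mem_block t A P : (t \in iota (A * P) P) = (A * P <= t < A.+1 * P).
Proof. by rewrite mem_iota mulSn addnC. Qed.

Lemma oeqE t i j : i < K -> j < K -> oeq (ob t) i j = (digit D i t == digit D j t).
Proof. by move=> iK jK; rewrite /oeq !oleE // -eqn_leq. Qed.

Lemma run_x (P : option bool -> bool) r i A : 3 <= r -> r <= i -> i < K ->
  has ((fun o => oeq o i 0 && P (ox o)) \o ob) (iota (A * D ^ r) (D ^ r)) =
  P (onth x (digit D i (A * D ^ r))).
Proof.
move=> r3 ri iK; apply/hasP/idP => [[t]|Pi].
  rewrite mem_block => ht /= /andP []; rewrite oeqE // (digit_block ri ht) => /eqP ->.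
  by rewrite /digit expn0 divn1.
have [t [ht Ei Ej Ek Em]] := exists_block A r3 D_gt0 D_gt0
  (digit_lt D_gt0 i (A * D ^ r)).
exists t; first by rewrite mem_block.
rewrite /= oeqE // (digit_block ri ht) Ek eqxx /=.
have -> : t %% D = digit D 0 t by rewrite /digit expn0 divn1.
by rewrite Ek.
Qed.

(** The number [A] consists of the digits from [r] on, that is, of the current values of the free
    variables. *)
Lemma form_autP R r env p q A : varel K r env p q -> r <= K -> 3 <= r ->
  (forall y, r <= y < K -> env y = digit D y (A * D ^ r)) ->
  (forall l i j k, i < D -> j < D -> k < D -> R l i j k = tabrel l i j k) ->
  au_out (@run (form_aut r p) (au_init _) (iota (A * D ^ r) (D ^ r))) <-> den D x R q.
Proof.
move=> h; elim: h A => {r env p q}.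
- move=> r env i j hi hj A rK r3 E ER; rewrite run_has /=.
  have P0 : 0 < D ^ r by rewrite expn_gt0 D_gt0.
  have oE t : A * D ^ r <= t < A.+1 * D ^ r -> ole (ob t) i j = (env i <= env j).
    move=> ht; move: (hi) (hj) => /andP [ri iK] /andP [rj jK].
    by rewrite oleE // !E // (digit_block ri ht) (digit_block rj ht).
  split=> [/hasP [t]|le]; first by rewrite mem_block => /oE /= ->.
  have hA : A * D ^ r <= A * D ^ r < A.+1 * D ^ r by rewrite leqnn ltn_mul2r P0 ltnSn.
  apply/hasP; exists (A * D ^ r); first by rewrite mem_block.
  by have := oE _ hA => /= ->.
- move=> r env l i j k hi hj hk A rK r3 E ER.
  rewrite run_has /=; move: (hi) (hj) (hk) => /andP [ri iK] /andP [rj jK] /andP [rk kK].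
  have K2 : 2 < K by []. have K1 : 1 < K by apply: ltnW. have nlevels : 0 < K by [].
  rewrite ER ?E ?digit_lt //; split=> [/hasP [t]|].
    rewrite mem_block => ht /= /and4P [].
    rewrite !oeqE // (digit_block ri ht) (digit_block rj ht) (digit_block rk ht).
    move=> /eqP -> /eqP -> /eqP ->; rewrite ffunE /tabrel.
    by rewrite mod_digits.
  move=> Rt; have [t [ht Ei Ej Ek Em]] := exists_block A r3
    (digit_lt D_gt0 i (A * D ^ r)) (digit_lt D_gt0 j (A * D ^ r)) (digit_lt D_gt0 k (A * D ^ r)).
  apply/hasP; exists t; first by rewrite mem_block.
  rewrite /= !oeqE // (digit_block ri ht) (digit_block rj ht) (digit_block rk ht).
  by rewrite Ei Ej Ek !eqxx ffunE Em.
- move=> r env i /andP [ri iK] A rK r3 E ER; rewrite run_has (run_x (fun o => o == Some true)) //.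
  by rewrite /= -odflt_onth E ?ri //; case: (onth _ _) => [[]|].
- move=> r env i /andP [ri iK] A rK r3 E ER; rewrite run_has (run_x isSome) //.
  by rewrite /= -onthTE E ?ri.
- by move=> r env p q _ IH A rK r3 E ER /=; rewrite -(IH A) //; split=> /negP.
- move=> r env p q p' q' _ IH _ IH' A rK r3 E ER /=; rewrite -(IH A) // -(IH' A) //.
  have -> : @run (form_aut r (FAnd p p')) (au_init (form_aut r p), au_init (form_aut r p'))
     (iota (A * D ^ r) (D ^ r)) = (run (au_init _) (iota (A * D ^ r) (D ^ r)),
      run (au_init _) (iota (A * D ^ r) (D ^ r))).
    by rewrite /run; elim: [seq _ | _ <- _] (au_init _) (au_init _) => //= o os IHo s1 s2; rewrite IHo.
  by rewrite /=; split=> /andP.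
move=> r env f g r3 _ IH A rK _ E ER.
rewrite run_ex //=.
have H v : v < D -> au_out (@run (form_aut r (f r)) (au_init _)
   (iota ((A * D + v) * D ^ r) (D ^ r))) <-> den D x R (g v).
  move=> ltv; apply: IH => // [|y /andP [le ltK]]; first exact: ltnW.
  rewrite /upd; have [->|ne] := eqVneq y r.
    by rewrite /digit mulnK ?expn_gt0 ?D_gt0 // modnMDl modn_small.
  have lt : r < y by rewrite ltn_neqAle eq_sym ne.
  rewrite E ?lt //; apply/esym; apply: digit_block lt _.
  rewrite expnS mulnA leq_mul2r leq_addr orbT /= mulnA ltn_mul2r expn_gt0 D_gt0 /=.
  by rewrite mulSn addnC ltn_add2r.
split=> [/hasP [v]|[v ltv /(H v ltv) Hv]].
  by rewrite mem_iota /= add0n => ltv /(H v ltv); exists v.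
by apply/hasP; exists v => //; rewrite mem_iota.
Qed.

End Correct.
End Comp.

(** * Fagin's theorem for bit strings *)

Lemma poly_succ c k n : c * n.+1 ^ k <= c * 2 ^ k * n ^ k + c * 2 ^ k.
Proof.
rewrite -mulnA -mulnDr leq_mul2l; apply/orP; right.
case: n => [|n]; first by rewrite exp1n addn_gt0 [0 < 2 ^ k]expn_gt0 orbT.
apply: leq_trans (leq_addr _ _); rewrite -expnMn.
by case: k => // k; rewrite leq_exp2r //; lia.
Qed.

Theorem fagin (I : finType) (K : nat) (p : form I nat) (L : language) (c k : nat) :
  3 <= K -> (forall env, varel K K env p p) ->
  (forall x D R, 0 < D -> den D x R p -> L x) ->
  (forall x, L x -> exists D R, 0 < D <= c * (size x).+1 ^ k /\ den D x R p) ->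
  inNP L.
Proof.
case: K => // K' K3 fp sound complete.
pose A := form_aut K'.+1 p.
exists (sw_lang (mach K' A)); split; first exact: mach_inP.
(* The certificate has D^3 blocks of [bsize] bits; [poly_succ] turns the bound in [size x + 1] into
   the form that [inNP] demands. *)
pose c1 := bsize I K' * c ^ 3; exists (c1 * 2 ^ (k * 3)), (k * 3) => x.
have correct R (bs : seq (block I K')) : has (fun f : block I K' => f (cLast I K')) bs ->
  (forall l i j k, i < lastpos bs -> j < lastpos bs -> k < lastpos bs ->
     R l i j k = tabrel (lastpos bs) (size bs) (bnth bs) l i j k) ->
  sw_lang (mach K' A) (pair_enc x (flatten (map (@bbits I K') bs))) <->
  den (lastpos bs) x R p.
  move=> hs ER; rewrite mach_lang //.
  have := @form_autP I K' x (lastpos bs) (size bs) (bnth bs) isT K3 R K'.+1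
    (fun=> 0) p p 0 (fp _) (leqnn _) K3.
  rewrite mul0n /run; by apply=> // y /andP [le lt]; move: (leq_ltn_trans le lt); rewrite ltnn.
split=> [Lx|[y [_ Vxy]]]; last first.
  have [bs Ey hs] := mach_lang_blocks Vxy; rewrite Ey in Vxy.
  have := (correct _ bs hs (fun _ _ _ _ _ _ _ => erefl)).1 Vxy.
  by apply: sound.
have [D [R [/andP [D0 leD] Hd]]] := complete x Lx.
(* Block [j] stores the values of the relations at the three base-D digits of [j]. The flag at D - 1
   lets the machine recover D. *)
pose f j : block I K' := [ffun t => match enum_val t with
  | None => j == D.-1
  | Some (inl l) => R l (j %/ D ^ 2) (j %/ D %% D) (j %% D)
  | _ => false end].
pose bs := mkseq f (D ^ 3).
have fL j : f j (cLast I K') = (j == D.-1) by rewrite ffunE enum_rankK.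
have D3 : D.-1 < D ^ 3.
  by rewrite prednK // -{1}(expn1 D) leq_pexp2l.
have hs : has (fun g : block I K' => g (cLast I K')) bs.
  apply/(has_nthP [ffun=> false]); exists D.-1; rewrite ?size_mkseq //.
  by rewrite nth_mkseq // fL eqxx.
have ED : lastpos bs = D.
  rewrite /lastpos -[RHS](prednK D0); congr _.+1; apply/eqP; rewrite eqn_leq.
  rewrite leqNgt; apply/andP; split; last first.
    rewrite leqNgt; apply/negP=> lt.
    have lt3 := ltn_trans lt D3.
    have := nth_find [ffun=> false] hs.
    by rewrite nth_mkseq // fL => /eqP E; rewrite E ltnn in lt.
  apply/negP=> lt; have := before_find [ffun=> false] lt.
  by rewrite nth_mkseq // fL eqxx.
exists (flatten (map (@bbits I K') bs)); split.
  rewrite size_bits size_mkseq; apply: leq_trans (poly_succ c1 (k * 3) (size x)).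
  by rewrite /c1 -mulnA leq_mul2l expnM -expnMn leq_exp2r // leD orbT.
apply/(correct R bs hs); last by rewrite ED.
move=> l i j m; rewrite ED => lti ltj ltm; rewrite /tabrel.
have e2 : D ^ 2 = D * D by rewrite expnS expn1.
have s2 : j * D + m < D ^ 2.
  rewrite e2; apply: leq_trans (_ : j.+1 * D <= _); last by rewrite leq_mul2r ltj orbT.
  by rewrite mulSn; lia.
have s3 : i * D ^ 2 + j * D + m < D ^ 3.
  rewrite expnS; apply: leq_trans (_ : i.+1 * D ^ 2 <= _); last by rewrite leq_mul2r lti orbT.
  by rewrite mulSn; lia.
rewrite size_mkseq s3 /bnth nth_mkseq // ffunE enum_rankK.
rewrite -addnA divnMDl ?expn_gt0 ?D0 // (divn_small s2) addn0.
rewrite addnA e2 mulnA -mulnDl divnMDl // (divn_small ltm) addn0 !modnMDl.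
by rewrite !modn_small.
Qed.

(** * The square-free gadget and canonical matrices *)

Definition iso_rel (T1 T2 : Type) (e1 : rel T1) (e2 : rel T2) : Prop :=
  exists2 f : T1 -> T2, bijective f & forall a b, e1 a b = e2 (f a) (f b).

Lemma iso_rel_sym T1 T2 (e1 : rel T1) (e2 : rel T2) : iso_rel e1 e2 -> iso_rel e2 e1.
Proof.
by case=> f [g fK gK] E; exists g => [|a b]; [exists f | rewrite E !gK].
Qed.

Lemma iso_rel_trans T1 T2 T3 (e1 : rel T1) (e2 : rel T2) (e3 : rel T3) :
  iso_rel e1 e2 -> iso_rel e2 e3 -> iso_rel e1 e3.
Proof.
case=> f bf E [g bg E']; exists (g \o f) => [|a b]; first exact: bij_comp.
by rewrite E E'.
Qed.

(* Every vertex i of G becomes a centre (i,n) with private neighbours (i,j),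
   j <> n, and an edge ij of G becomes the edge between (i,j) and (j,i); the
   last three columns only serve to give every centre degree at least 3. *)
Definition gadget n (G : adjm n) : rel ('I_n * 'I_(n + 4)) :=
  fun a b => (a.1 == b.1) && ((a.2 == n :> nat) != (b.2 == n :> nat)) ||
    [&& b.1 == a.2 :> nat, b.2 == a.1 :> nat & G a.1 b.1].

Section Gadget.
Variables (n : nat) (G : adjm n).
Hypothesis adjG : is_adj_matrix G.

Let n_lt : n < n + 4. Proof. by rewrite -[X in X < _]addn0 ltn_add2l. Qed.

Definition centre (i : 'I_n) : 'I_n * 'I_(n + 4) := (i, Ordinal n_lt).
Definition arc (i j : 'I_n) : 'I_n * 'I_(n + 4) := (i, lshift 4 j).
Lemma gadget_sym a b : gadget G a b = gadget G b a.
Proof.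
have [sym _] := adjG; rewrite /gadget sym [b.1 == a.1]eq_sym; congr (_ || _).
  by rewrite [_ == (a.2 == n :> nat)]eq_sym.
rewrite (eq_sym (b.1 : nat)) (eq_sym (b.2 : nat)) andbCA. by [].
Qed.

Lemma gadget_irr a : gadget G a a = false.
Proof.
have [_ irr] := adjG; by rewrite /gadget irr !andbF orbF !eqxx.
Qed.

Lemma nbr_centre (a b : 'I_n * 'I_(n + 4)) : gadget G a b -> a.2 == n :> nat ->
  b.1 = a.1 /\ b.2 != n :> nat.
Proof.
move=> + /eqP an; rewrite /gadget an eqxx => /orP [/andP [/eqP -> ne]|/and3P [/eqP b1]].
  by split=> //; case: (_ == n) ne.
by have := ltn_ord b.1; rewrite b1 ltnn.
Qed.

Lemma nbr_arc a b : gadget G a b -> a.2 != n :> nat ->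
  b = centre a.1 \/ (b.1 = a.2 :> nat /\ b.2 = a.1 :> nat).
Proof.
move=> + an; rewrite /gadget (negPf an) => /orP [/andP [/eqP -> ne]|/and3P [/eqP -> /eqP -> _]];
  last by right.
left; case: b ne => b1 b2 /=; rewrite eq_sym eqbF_neg negbK => /eqP b2n; congr pair; exact: val_inj.
Qed.

(** Pigeonhole: the only possible neighbours of a vertex that is not a centre are its centre and the
    reversed arc. *)
Lemma nbr_arc_uniq a b c d : gadget G a b -> gadget G a c -> gadget G a d ->
  a.2 != n :> nat -> ~~ uniq [:: b; c; d].
Proof.
move=> ab ac ad an.
have eqv (u v : 'I_n * 'I_(n + 4)) : u.1 = a.2 :> nat /\ u.2 = a.1 :> nat ->
    v.1 = a.2 :> nat /\ v.2 = a.1 :> nat -> u = v.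
  case: u v => [u1 u2] [v1 v2] /= [e1 e2] [e3 e4].
  by congr (_, _); apply: val_inj; rewrite /= ?e1 ?e2 ?e3 ?e4.
apply/negP; rewrite /= !inE negb_or andbT => /andP [/andP [bc bd] cd].
have [eb|eb] := nbr_arc ab an; have [ec|ec] := nbr_arc ac an; have [ed|ed] := nbr_arc ad an;
  try by rewrite eb ec eqxx in bc.
all: try by rewrite eb ed eqxx in bd.
all: try by rewrite ec ed eqxx in cd.
all: try by rewrite (eqv b c) ?eqxx in bc.
all: try by rewrite (eqv b d) ?eqxx in bd.
all: by rewrite (eqv c d) ?eqxx in cd.
Qed.

Lemma centre_deg (a : 'I_n * 'I_(n + 4)) : a.2 == n :> nat ->
  exists b c d, [/\ uniq [:: b; c; d], gadget G a b, gadget G a c & gadget G a d].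
Proof.
move=> an; pose l k : 'I_n * 'I_(n + 4) := (a.1, rshift n (inord k.+1 : 'I_4)).
have gl k : k < 3 -> gadget G a (l k).
  move=> k3; rewrite /gadget /= eqxx an inordK ?ltnS //.
  by have -> : (n + k.+1 == n) = false by lia.
exists (l 0), (l 1), (l 2); split; rewrite ?gl //.
by rewrite /= !inE !xpair_eqE !eqxx /= !(inj_eq (@rshift_inj _ _)) -!val_eqE /= !inordK.
Qed.

(** Centres are pairwise non-adjacent, so a 4-cycle contains a vertex [u] that is no centre; its two
    neighbours on the cycle are its centre and the reversed arc [z]. The fourth vertex is adjacent
    to [z], so it is [u] or a centre, but it is also adjacent to the centre of [u]: a contradiction
    in both cases. *)
Lemma gadget_square_free (a b c d : 'I_n * 'I_(n + 4)) : uniq [:: a; b; c; d] ->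
  gadget G a b -> gadget G b c -> gadget G c d -> gadget G d a -> False.
Proof.
have key (u v w z : 'I_n * 'I_(n + 4)) : uniq [:: u; v; w; z] -> gadget G u v -> gadget G v w ->
    gadget G w z -> gadget G z u -> u.2 != n :> nat ->
    v = centre u.1 -> z.1 = u.2 :> nat /\ z.2 = u.1 :> nat -> False.
  move=> un uv vw wz zu un2 ev [z1 z2].
  have zn : z.2 != n :> nat by rewrite z2 neq_ltn ltn_ord.
  move: wz; rewrite gadget_sym => /nbr_arc /(_ zn) [ew|[w1 w2]].
    have [] := nbr_centre vw; first by rewrite ev /= eqxx.
    by rewrite ew /= eqxx.
  have ewu : w = u.
    case: (w) (u) w1 w2 z1 z2 => [w1 w2] [u1 u2] /= e1 e2 e3 e4.
    by congr (_, _); apply: val_inj; rewrite /= ?e1 ?e2 -?e3 -?e4.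
  by move: un; rewrite ewu /= !inE eqxx orbT.
have key2 (u v w z : 'I_n * 'I_(n + 4)) : uniq [:: u; v; w; z] -> gadget G u v -> gadget G v w ->
    gadget G w z -> gadget G z u -> u.2 != n :> nat -> False.
  move=> un uv vw wz zu un2.
  have uz : gadget G u z by rewrite gadget_sym.
  have vz : v != z by move: un => /and4P [_ + _ _]; rewrite !inE negb_or => /andP [].
  have [ev|ev] := nbr_arc uv un2; have [ez|ez] := nbr_arc uz un2.
  - by rewrite ev ez eqxx in vz.
  - exact: (key u v w z).
  - apply: (key u z w v) => //; try by rewrite gadget_sym.
    have : perm_eq [:: u; z; w; v] [:: u; v; w; z].
      rewrite perm_cons; apply/seq.permP => P /=; lia.
    by move=> /perm_uniq ->.
  case/eqP: vz; case: (v) (z) ev ez => [v1 v2] [z1 z2] /= [e1 e2] [e3 e4].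
  by congr (_, _); apply: val_inj; rewrite /= ?e1 ?e2 ?e3 ?e4.
move=> un ab bc cd da.
have [an|an] := boolP (a.2 == n :> nat); last exact: (key2 a b c d).
have [_ bn] := nbr_centre ab an.
apply: (key2 b c d a) => //.
have -> : [:: b; c; d; a] = rot 1 [:: a; b; c; d] by [].
by rewrite rot_uniq.
Qed.

(** An edge of [G] has become a path of length 3 between two centres; so adjacency in [G] can be
    read off the gadget once its centres are known. *)
Lemma gadget_path (i j : 'I_n) :
  G i j <-> i <> j /\ exists a b, [/\ gadget G (centre i) a, gadget G a b & gadget G b (centre j)].
Proof.
have [sym irr] := adjG.
have lts (k : 'I_n) : (lshift 4 k == n :> nat) = false by rewrite /= ltn_eqF.
split=> [Gij|[ne [a [b [ia ab bj]]]]].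
  split; first by move=> ij; rewrite ij irr in Gij.
  exists (arc i j), (arc j i); split.
  - by rewrite /gadget /= !eqxx lts.
  - by rewrite /gadget /= !eqxx Gij orbT.
  - by rewrite /gadget /= !eqxx lts.
have [a1 an] := nbr_centre ia (eqxx _).
move: bj; rewrite gadget_sym => bj; have [b1 bn] := nbr_centre bj (eqxx _).
move: ab; rewrite /gadget a1 b1 /= (negPf an) (negPf bn) andbF /=.
by case/and3P.
Qed.

End Gadget.

(** Centres have degree at least 3 and all other vertices at most 2, so isomorphisms of gadgets map
    centres to centres, and they preserve the paths of length 3 between them. *)
Lemma gadget_iso_inv n1 n2 (G1 : adjm n1) (G2 : adjm n2) :
  is_adj_matrix G1 -> is_adj_matrix G2 ->
  iso_rel (gadget G1) (gadget G2) -> isomorphic G1 G2.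
Proof.
move=> adj1 adj2 [g [g' gK g'K] E].
have E' a b : gadget G2 a b = gadget G1 (g' a) (g' b) by rewrite E !g'K.
have cen n n' (G : adjm n) (G' : adjm n') f : injective f ->
   (forall a b, gadget G a b = gadget G' (f a) (f b)) ->
   forall i, f (centre i) = centre (f (centre i)).1.
  move=> injf Ef i.
  have [b [c [d [un ib ic id]]]] := centre_deg G (eqxx _ : (centre i).2 == n :> nat).
  rewrite !Ef in ib ic id.
  have [fn|fn] := boolP ((f (centre i)).2 == n' :> nat).
    case: (f _) fn => u v /= /eqP vn; congr (_, _); exact: val_inj.
  have := nbr_arc_uniq ib ic id fn.
  by rewrite -/(map f [:: b; c; d]) map_inj_uniq ?un.
pose h i := (g (centre i)).1; pose h' i := (g' (centre i)).1.
have gc i : g (centre i) = centre (h i) by apply: cen E i; apply: can_inj gK.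
have g'c i : g' (centre i) = centre (h' i) by apply: cen E' i; apply: can_inj g'K.
exists h; split.
  exists h' => i.
    by have := congr1 fst (gK (centre i)); rewrite gc g'c.
  by have := congr1 fst (g'K (centre i)); rewrite g'c gc.
have injh : injective h.
  move=> i j e; have : g (centre i) = g (centre j) by rewrite !gc e.
  by move/(can_inj gK) => [].
move=> i j; apply/idP/idP.
  move=> /(gadget_path adj1) [ne [a [b [ia ab bj]]]]; apply/(gadget_path adj2).
  split; first by move/injh.
  by exists (g a), (g b); rewrite -!gc -!E.
move=> /(gadget_path adj2) [ne [a [b [ia ab bj]]]]; apply/(gadget_path adj1).
split; first by move=> e; rewrite e in ne.
exists (g' a), (g' b); rewrite -!gc in ia bj.
by rewrite !E' !gK in ia ab bj.
Qed.

Lemma gadget_iso n1 n2 (G1 : adjm n1) (G2 : adjm n2) :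
  isomorphic G1 G2 -> iso_rel (gadget G1) (gadget G2).
Proof.
case=> f [bf E].
have en : n1 = n2 by have := bij_eq_card bf; rewrite !card_ord.
subst n2; have [f' fK f'K] := bf.
(* Columns of arcs are permuted by the isomorphism; the column of centres and the three spare
   columns stay fixed. *)
pose ext (h : 'I_n1 -> 'I_n1) (j : 'I_(n1 + 4)) : 'I_(n1 + 4) :=
  match split j with inl j0 => lshift 4 (h j0) | inr k => rshift n1 k end.
have extK h h' : cancel h h' -> cancel (ext h) (ext h').
  move=> hK j; rewrite /ext -{2}(splitK j).
  case: (split j) => k /=.
    by rewrite (unsplitK (inl _ (h k))) /= hK.
  by rewrite (unsplitK (inr _ k)).
have ext_n h (j : 'I_(n1 + 4)) : (ext h j == n1 :> nat) = (j == n1 :> nat).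
  rewrite /ext -{2}(splitK j); case: (split j) => k //=.
  by rewrite !ltn_eqF.
have ext_v (h : 'I_n1 -> 'I_n1) (i : 'I_n1) (j : 'I_(n1 + 4)) : injective h -> (h i == ext h j :> nat) = (i == j :> nat).
  move=> ih; rewrite /ext -{2}(splitK j); case: (split j) => k /=.
    by rewrite !val_eqE inj_eq.
  by rewrite !ltn_eqF // (leq_trans (ltn_ord _)) // leq_addr.
exists (fun a => (f a.1, ext f a.2)).
  exists (fun a => (f' a.1, ext f' a.2)); move=> [i j] /=; congr pair.
  - exact: fK.
  - exact: extK.
  - exact: f'K.
  - exact: extK.
have fi := bij_inj bf.
move=> a b; rewrite /gadget /= !ext_n (inj_eq fi) ext_v // -E.
by rewrite [in RHS](eq_sym (ext f b.2 : nat)) ext_v // [in RHS](eq_sym (a.1 : nat)).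
Qed.

(** * Lexicographic order and canonical matrices *)

Lemma lexle_refl : reflexive lexle.
Proof. by elim=> //= b s ->; case: b. Qed.

Lemma lexle_trans : transitive lexle.
Proof.
elim=> [|b t IH] [|a s] [|c u] //=.
by case: a b c => [] [] [] //=; apply: IH.
Qed.

Lemma lexle_total : total lexle.
Proof. by elim=> [|a s IH] [|b t] //=; case: a b => [] [] //=. Qed.

Lemma lexle_anti s t : size s = size t -> lexle s t -> lexle t s -> s = t.
Proof.
elim: s t => [|a s IH] [|b t] //= [sz].
by case: a b => [] [] //= h1 h2; rewrite (IH _ sz).
Qed.

Lemma eq_bitstring n (A B : adjm n) : A =2 B -> bitstring A = bitstring B.
Proof. by move=> E; congr flatten; apply: eq_map => j; apply: eq_map => i. Qed.

(** Take a maximum over the finite set of permutations; a reordering of the resulting matrix is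
    again a reordering of [A], by the product of the permutations. *)
Lemma ex_canonical m (A : adjm m) : exists s : {perm 'I_m}, canonical (reorder A s).
Proof.
pose F (s : {perm 'I_m}) := bitstring (reorder A s).
have [|||s _ Hs] := @extremumP _ _ (fun x y => lexle y x) 1%g predT F _ _ _ isT.
- exact: lexle_refl.
- by move=> y x z /= h1 h2; apply: lexle_trans h2 h1.
- by move=> x y; apply: lexle_total.
exists s => s'; have := Hs (s' * s)%g isT; rewrite /F.
have -> // : bitstring (reorder A (s' * s)) = bitstring (reorder (reorder A s) s').
by apply: eq_bitstring => i j; rewrite /reorder !permM.
Qed.

Lemma size_bitstring n (A B : adjm n) : size (bitstring A) = size (bitstring B).
Proof.
rewrite !size_flatten /shape -!map_comp; congr sumn.
by apply: eq_map => j /=; rewrite !size_map.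
Qed.

Lemma bitstring_inj n (A B : adjm n) : is_adj_matrix A -> is_adj_matrix B ->
  bitstring A = bitstring B -> A =2 B.
Proof.
move=> [symA irrA] [symB irrB] E.
have up (i j : 'I_n) : i < j -> A i j = B i j.
  move=> lt; pose col (C : adjm n) (j : 'I_n) := [seq C i j | i <- [seq i <- enum 'I_n | nat_of_ord i < nat_of_ord j]].
  have sh : shape (map (col A) (enum 'I_n)) = shape (map (col B) (enum 'I_n)).
    by apply: (@eq_from_nth _ 0) => [|k]; rewrite !size_map // => ltk;
       rewrite !(nth_map [::]) ?size_map // !(nth_map j) // !size_map.
  have /eq_in_map Ej := eq_from_flatten_shape E sh.
  have /eq_in_map Ei := Ej j (mem_enum _ j).
  by apply: Ei; rewrite mem_filter lt mem_enum.
move=> i j; case: (ltngtP i j) => [|lt|/val_inj ->]; first exact: up.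
  by rewrite symA symB up.
by rewrite irrA irrB.
Qed.

Definition natadj m (A : adjm m) (u v : nat) : bool :=
  if (insub u : option 'I_m, insub v : option 'I_m) is (Some i, Some j) then A i j else false.

Definition encmx m (A : adjm m) : seq bool :=
  mkseq (fun q => natadj A (q %/ m) (q %% m)) (m * m).

Lemma encmxK m (A : adjm m) : decode_mx m (encmx A) =2 A.
Proof.
move=> i j; have m0 : 0 < m by apply: leq_ltn_trans (ltn_ord i).
have lt : i * m + j < m * m.
  apply: leq_trans (_ : i.+1 * m <= _); last by rewrite leq_mul2r ltn_ord orbT.
  by rewrite mulSn addnC ltn_add2r.
rewrite /decode_mx nth_mkseq // divnMDl // divn_small // addn0 modnMDl modn_small //.
by rewrite /natadj !valK.
Qed.

Definition entry m (s : seq bool) (u v : nat) : bool := nth false s (u * m + v).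

Definition differ m1 s1 m2 s2 : Prop :=
  m1 <> m2 \/ exists u v, [/\ u < m1, v < m1 & entry m1 s1 u v <> entry m2 s2 u v].

(** Isomorphic matrices are reorderings of each other, so maximality bounds each bit-string by the
    other. *)
Lemma canonical_eq n (A B : adjm n) : is_adj_matrix A -> is_adj_matrix B ->
  canonical A -> canonical B -> iso_rel A B -> A =2 B.
Proof.
move=> adjA adjB cA cB [f bf E].
have Ep : reorder B (perm (bij_inj bf)) =2 A by move=> i j; rewrite /reorder !permE E.
have [g fK gK] := bf.
have Ep' : reorder A (perm (can_inj gK)) =2 B by move=> i j; rewrite /reorder !permE E !gK.
apply: bitstring_inj => //; apply: lexle_anti; first exact: size_bitstring.
  by rewrite -(eq_bitstring Ep).
by rewrite -(eq_bitstring Ep').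
Qed.

(** An isomorphism of the graphs would extend to the gadgets and force their canonical matrices to
    coincide. *)
Lemma canon_sound n1 n2 (G1 : adjm n1) (G2 : adjm n2) m1 s1 m2 s2 :
  CANON_SQFREE s1 -> CANON_SQFREE s2 -> size s1 = m1 * m1 -> size s2 = m2 * m2 ->
  iso_rel (gadget G1) (decode_mx m1 s1) -> iso_rel (gadget G2) (decode_mx m2 s2) ->
  differ m1 s1 m2 s2 -> ~ isomorphic G1 G2.
Proof.
have sq a b : a * a = b * b -> a = b by move/eqP; rewrite !mulnn eqn_sqr => /eqP.
move=> [k1 [A1 [[sz1 [-> adj1]] [_ can1]]]] [k2 [A2 [[sz2 [-> adj2]] [_ can2]]]].
rewrite sz1 sz2 => /sq e1 /sq e2; rewrite -e1 -e2 {m1 m2 e1 e2} => iso1 iso2 df iso.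
have I12 : iso_rel (decode_mx k1 s1) (decode_mx k2 s2).
  apply: iso_rel_trans (iso_rel_sym iso1) _; apply: iso_rel_trans iso2; exact: gadget_iso.
have ek : k1 = k2 by case: I12 => f bf _; have := bij_eq_card bf; rewrite !card_ord.
subst k2; case: df => // [[u [v [ltu ltv]]]]; apply.
exact: (canonical_eq adj1 adj2 can1 can2 I12 (Ordinal ltu) (Ordinal ltv)).
Qed.

Lemma ex_canon_sqfree n (G : adjm n) : is_adj_matrix G ->
  exists s, let m := n * (n + 4) in
  [/\ CANON_SQFREE s, size s = m * m & iso_rel (gadget G) (decode_mx m s)].
Proof.
move=> adjG; pose T : finType := ('I_n * 'I_(n + 4))%type.
have -> : n * (n + 4) = #|{: T}| by rewrite card_prod !card_ord.
pose A : adjm #|{: T}| := fun i j => gadget G (enum_val i) (enum_val j).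
have [s can] := ex_canonical A.
pose C := encmx (reorder A s).
have CE : decode_mx #|{: T}| C =2 reorder A s by exact: encmxK.
exists C; split; last first.
- exists (fun a => (s^-1)%g (enum_rank a)).
    exists (fun i => enum_val (s i)) => i; first by rewrite permKV enum_rankK.
    by rewrite enum_valK permK.
  by move=> a b; rewrite CE /reorder /A !permKV !enum_rankK.
- by rewrite size_mkseq.
exists #|{: T}|, (decode_mx #|{: T}| C); split; [|split].
- split; first by rewrite size_mkseq.
  by split=> //; split=> [i j|i]; rewrite !CE /reorder /A ?gadget_irr // gadget_sym.
- move=> [a [b [c [d [[un ab bc cd] da]]]]].
  rewrite !CE /reorder /A in ab bc cd da.
  apply: (@gadget_square_free _ _ adjG _ _ _ _ _ ab bc cd da).
  rewrite -/(map (fun i => enum_val (s i)) [:: a; b; c; d]) map_inj_uniq //.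
  by move=> i j /enum_val_inj /perm_inj.
move=> s'; rewrite (eq_bitstring CE); have := can s'.
by rewrite -(@eq_bitstring _ (reorder (decode_mx #|{: T}| C) s')) // => i j; rewrite /reorder CE.
Qed.

Lemma canon_complete n1 n2 (G1 : adjm n1) (G2 : adjm n2) :
  is_adj_matrix G1 -> is_adj_matrix G2 -> ~ isomorphic G1 G2 ->
  let m1 := n1 * (n1 + 4) in let m2 := n2 * (n2 + 4) in
  exists s1 s2,
  [/\ CANON_SQFREE s1, size s1 = m1 * m1 & iso_rel (gadget G1) (decode_mx m1 s1)] /\
  [/\ CANON_SQFREE s2, size s2 = m2 * m2 & iso_rel (gadget G2) (decode_mx m2 s2)] /\
  differ m1 s1 m2 s2.
Proof.
move=> adj1 adj2 niso m1 m2.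
have [s1 H1] := ex_canon_sqfree adj1; have [s2 H2] := ex_canon_sqfree adj2.
exists s1, s2; do 2 split=> //; rewrite -/m1 -/m2 in H1 H2.
have [em|] := eqVneq m1 m2; last by left; apply/eqP.
right; have [/existsP [u /existsP [v ne]]|none] :=
  boolP [exists u : 'I_m1, exists v : 'I_m1, entry m1 s1 u v != entry m2 s2 u v].
  by exists u, v; split; rewrite ?ltn_ord //; apply/eqP.
case: niso; apply: gadget_iso_inv => //.
case: H1 H2 => _ _ I1 [_ _ I2]; apply: iso_rel_trans I1 (iso_rel_trans _ (iso_rel_sym I2)).
move: none {I2}; rewrite -em => none; exists id; first by exists id.
move=> u v; move: none; rewrite negb_exists => /forallP /(_ u).
by rewrite negb_exists => /forallP /(_ v); rewrite negbK => /eqP.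
Qed.

(** * Turing machines with functional tapes *)

Section FunctionalTM.
Variable M : TM.
Notation Q := (tm_Q M).

(** Halting states idle, as in [tm_step], so that computation tables of every height are defined. *)
Definition delta1 (q : Q) (a : option bool) : Q * option bool * move :=
  if tm_halt M q then (q, a, MoveS) else tm_delta M q a.

Definition movehead (m : move) (h : nat) : nat :=
  match m with MoveL => h.-1 | MoveR => h.+1 | MoveS => h end.

(** With absolute tape positions a run becomes a set of relations between times and positions, the
    form in which a sentence can speak of it. *)
Record fcfg := Fcfg { fq : Q; fh : nat; ftape : nat -> option bool }.

Definition fstep (c : fcfg) : fcfg :=
  let d := delta1 (fq c) (ftape c (fh c)) in
  Fcfg d.1.1 (movehead d.2 (fh c))
       (fun p => if p == fh c then d.1.2 else ftape c p).

Definition frun (inp : seq bool) (t : nat) : fcfg :=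
  iter t fstep (Fcfg (tm_start M) 0 (onth inp)).

Lemma fh_le inp t : fh (frun inp t) <= t.
Proof.
elim: t => // t IH; rewrite /frun iterS -/(frun inp t) /=.
case: (_.2) => //=; last exact: leqW.
by apply: leq_trans (leq_pred _) _; apply: leqW.
Qed.

Definition frep (c : config M) (f : fcfg) : Prop :=
  let: (q, l, a, r) := c in
  [/\ fq f = q, fh f = size l & forall p, ftape f p = nth None (rev l ++ a :: r) p].

Lemma frep_step c f : frep c f -> frep (tm_step c) (fstep f).
Proof.
case: c => [[[q l] a] r] [Eq Eh Et] /=; rewrite /fstep.
have Ea : ftape f (fh f) = a by rewrite Et Eh nth_cat size_rev ltnn subnn.
rewrite Ea Eq /delta1; case: (tm_halt M q) => /=.
  split=> //= p; rewrite Et; case: eqP => // ->.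
  by rewrite Eh nth_cat size_rev ltnn subnn.
case: (tm_delta M q a) => [[q' w] m] /=.
have Et' p : (if p == fh f then w else ftape f p) = nth None (rev l ++ w :: r) p.
  rewrite Et Eh !nth_cat size_rev; case: ltngtP => //.
    by move=> lt; rewrite -(subnSK lt).
  by move=> ->; rewrite subnn.
case: m => /=.
- case: l Et' Eh {Et Ea} => [|b l] Et' Eh; split=> //=; try by rewrite Eh.
  by move=> p; rewrite Et' rev_cons cat_rcons.
(* A move past the right end of the list creates a blank, which is also the default of [nth]. *)
- case: r Et' {Et Ea} => [|b r] Et'; split=> //=; try by rewrite Eh.
    move=> p; rewrite Et' rev_cons -[in RHS]cats1 -catA /= !nth_cat.
    by case: ltnP => // _; case: (_ - _) => [|[|k]]; rewrite /= ?nth_nil.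
  by move=> p; rewrite Et' rev_cons cat_rcons.
- by split.
Qed.

Lemma frun_state inp t : fq (frun inp t) = cfg_state (tm_run M t inp).
Proof.
have : frep (tm_run M t inp) (frun inp t).
  elim: t => [|t IH]; last exact: frep_step.
  rewrite /tm_run /frun /=; case: inp => [|b inp]; split=> //= p; rewrite onthE //.
  by case: p => [|[]].
by case: (tm_run M t inp) => [[[q l] a] r] [].
Qed.

Definition faccept inp t : bool :=
  tm_halt M (fq (frun inp t)) && tm_accept M (fq (frun inp t)).

(** Halting configurations are stable, so acceptance at any time agrees with acceptance at the
    clock; the sentence may therefore ask for some accepting time. *)
Lemma inP_faccept (V : language) c k :
  (forall x : seq bool, let q := cfg_state (tm_run M (c * size x ^ k + c) x) in
     tm_halt M q /\ (tm_accept M q <-> V x)) ->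
  (forall x t, faccept x t -> V x) /\
  (forall x, V x -> faccept x (c * size x ^ k + c)).
Proof.
move=> H; split=> x.
  move=> t; rewrite /faccept frun_state => /andP [h a].
  have [h' E] := H x; apply/E.
  by rewrite (halt_unique h' h).
by move=> Vx; have [h E] := H x; rewrite /faccept frun_state h /=; apply/E.
Qed.

End FunctionalTM.

(** * Derived connectives and order predicates *)

Section Derived.
Variables (I V : Type).
Implicit Types p q : form I V.

Definition fOr p q := FNot (FAnd (FNot p) (FNot q)).
Definition fImp p q := FNot (FAnd p (FNot q)).
Definition fIff p q := FAnd (fImp p q) (fImp q p).
Definition fAll (f : V -> form I V) : form I V := FNot (FEx (fun v => FNot (f v))).
Definition fTrue : form I V := fAll (fun v => FLe v v).
Definition fLt (i j : V) : form I V := FNot (FLe j i).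
Definition fEq (i j : V) : form I V := FAnd (FLe i j) (FLe j i).
Definition fZero (i : V) : form I V := fAll (fun j => FLe i j).
Definition fSucc (i j : V) : form I V :=
  FAnd (fLt i j) (fAll (fun k => fOr (FLe k i) (FLe j k))).
Definition fAnds (s : seq (form I V)) := foldr FAnd fTrue s.
Definition fOrs (s : seq (form I V)) := foldr fOr (FNot fTrue) s.

End Derived.
Arguments fTrue {I V}. Arguments fLt {I V}. Arguments fEq {I V}.
Arguments fZero {I V}. Arguments fSucc {I V}.

Section DenDerived.
Variables (I : Type) (D : nat) (x : seq bool) (R : I -> nat -> nat -> nat -> bool).
Notation dn := (den D x R).

Lemma ex2_dec (P : nat -> Prop) n : (forall i, P i \/ ~ P i) ->
  (exists2 i, i < n & P i) \/ ~ (exists2 i, i < n & P i).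
Proof.
move=> dP; elim: n => [|n [[i lt Pi]|no]]; first by right; case.
  by left; exists i => //; apply: leqW.
have [Pn|nPn] := dP n; first by left; exists n.
by right=> -[i]; rewrite ltnS leq_eqVlt => /orP [/eqP ->|lt Pi] //; apply: no; exists i.
Qed.

(** Atoms are boolean and quantifiers bounded. Thus the connectives encoded by negation and
    conjunction have their usual meaning. *)
Lemma den_dec p : dn p \/ ~ dn p.
Proof.
have decb (b : bool) : b \/ ~ b by case: b; [left|right].
elim: p => /=; try by move=> *; exact: decb.
- by move=> p [H|H]; [right|left] => // H'; apply: H'.
- by move=> p [H|H] q [H'|H']; [left|right=> -[]|right=> -[]|right=> -[]].
by move=> f; apply: ex2_dec.
Qed.

Lemma den_or p q : dn (fOr p q) <-> dn p \/ dn q.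
Proof.
rewrite /=; split=> [H|[H|H] []] //.
by have [Hp|Hp] := den_dec p; [left|right; have [//|Hq] := den_dec q; case: H].
Qed.

Lemma den_imp p q : dn (fImp p q) <-> (dn p -> dn q).
Proof.
rewrite /=; split=> [H Hp|H [Hp Hq]]; last by apply: Hq; apply: H.
by have [//|Hq] := den_dec q; case: H.
Qed.

Lemma den_iff p q : dn (fIff p q) <-> (dn p <-> dn q).
Proof.
rewrite -[dn (fIff p q)]/(dn (fImp p q) /\ dn (fImp q p)).
by rewrite !den_imp; split.
Qed.

Lemma den_all f : dn (fAll f) <-> forall i, i < D -> dn (f i).
Proof.
rewrite /=; split=> [H i lti|H [i lti]]; last by apply; apply: H.
by have [//|Hi] := den_dec (f i); case: H; exists i.
Qed.

Lemma den_true : dn fTrue.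
Proof. by apply/den_all=> i _ /=. Qed.

Lemma den_lt i j : dn (fLt i j) <-> i < j.
Proof. by rewrite /= ltnNge; split=> /negP. Qed.

Lemma den_eq i j : dn (fEq i j) <-> i = j.
Proof. by rewrite /=; split=> [[h1 h2]|-> //]; apply/eqP; rewrite eqn_leq h1. Qed.

Lemma den_zero i : i < D -> dn (fZero i) <-> i = 0.
Proof.
move=> lti; rewrite den_all; split=> [H|-> //].
by have := H 0 (leq_ltn_trans (leq0n i) lti) => /=; case: (i).
Qed.

Lemma den_succ i j : i < D -> j < D -> dn (fSucc i j) <-> j = i.+1.
Proof.
move=> lti ltj; have -> : dn (fSucc i j) <->
  dn (fLt i j) /\ dn (fAll (fun k => fOr (FLe k i) (FLe j k))) by [].
rewrite den_lt den_all; split=> [[lt H]|->]; last first.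
  by split=> // k _; apply/den_or; rewrite /=; case: (leqP k i); [left|right].
have ltD : i.+1 < D by apply: leq_ltn_trans ltj.
have /den_or [] := H i.+1 ltD; rewrite /= ?ltnn // => le.
by apply/eqP; rewrite eqn_leq le lt.
Qed.

Lemma den_ands T (s : seq T) (f : T -> form I nat) :
  dn (fAnds (map f s)) <-> foldr and True [seq dn (f t) | t <- s].
Proof.
elim: s => [|t s IH] /=; first by split=> // _; exact: den_true.
by rewrite -/(fAnds _) IH.
Qed.

Lemma den_ors T (s : seq T) (f : T -> form I nat) :
  dn (fOrs (map f s)) <-> foldr or False [seq dn (f t) | t <- s].
Proof.
elim: s => [|t s IH]; first by split=> // H; apply: H; exact: den_true.
by rewrite -[fOrs _]/(fOr (f t) (fOrs (map f s))) den_or IH.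
Qed.

Lemma den_andsQ (Q : finType) (f : Q -> form I nat) :
  dn (fAnds (map f (enum Q))) <-> forall q, dn (f q).
Proof.
rewrite den_ands; split=> [H q|H]; last by elim: (enum Q) => //= q s IH; split.
have: q \in enum Q by rewrite mem_enum.
elim: (enum Q) H => //= q' s IH [Hq Hs]; rewrite inE => /orP [/eqP ->|] //.
exact: IH.
Qed.

Lemma den_orsQ (Q : finType) (f : Q -> form I nat) :
  dn (fOrs (map f (enum Q))) <-> exists q, dn (f q).
Proof.
rewrite den_ors; split=> [|[q Hq]].
  by elim: (enum Q) => //= q s IH [Hq|/IH //]; exists q.
have: q \in enum Q by rewrite mem_enum.
elim: (enum Q) => //= q' s IH; rewrite inE => /orP [/eqP <-|]; first by left.
by move=> /IH; right.
Qed.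

End DenDerived.

(* Richer formulas with arithmetic, translated into [form]; the [Q]-indexed
   connectives do not bind a variable. *)
Inductive fm (I Q V : Type) : Type :=
| MLe of V & V
| MLt of V & V
| MEq of V & V
| MZero of V
| MSucc of V & V
| MAdd of V & V & V
| MMul of V & V & V
| MRel of I & V & V & V
| MX of V
| MIn of V
| MC of bool
| MNot of fm I Q V
| MAnd of fm I Q V & fm I Q V
| MOr of fm I Q V & fm I Q V
| MImp of fm I Q V & fm I Q V
| MIff of fm I Q V & fm I Q V
| MAll of (V -> fm I Q V)
| MEx of (V -> fm I Q V)
| MAllQ of (Q -> fm I Q V)
| MExQ of (Q -> fm I Q V).
Arguments MLe {I Q V}. Arguments MLt {I Q V}. Arguments MEq {I Q V}.
Arguments MZero {I Q V}. Arguments MSucc {I Q V}. Arguments MAdd {I Q V}.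
Arguments MMul {I Q V}. Arguments MRel {I Q V}. Arguments MX {I Q V}.
Arguments MIn {I Q V}. Arguments MC {I Q V}. Arguments MNot {I Q V}.
Arguments MAnd {I Q V}. Arguments MOr {I Q V}. Arguments MImp {I Q V}.
Arguments MIff {I Q V}. Arguments MAll {I Q V}. Arguments MEx {I Q V}.
Arguments MAllQ {I Q V}. Arguments MExQ {I Q V}.

Section RDen.
Variables (I Q : Type) (D : nat) (x : seq bool) (R : I -> nat -> nat -> nat -> bool).

Variables padd pmul : nat -> nat -> nat -> Prop.

(** Addition and multiplication are parameters because [arith] has to be interpreted before the
    guessed relations are known to be true arithmetic. *)
Fixpoint rdenG (p : fm I Q nat) : Prop :=
  match p with
  | MLe i j => i <= j
  | MLt i j => i < j
  | MEq i j => i = j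
  | MZero i => i = 0
  | MSucc i j => j = i.+1
  | MAdd i j k => padd i j k
  | MMul i j k => pmul i j k
  | MRel l i j k => R l i j k
  | MX i => nth false x i
  | MIn i => i < size x
  | MC b => b
  | MNot p => ~ rdenG p
  | MAnd p q => rdenG p /\ rdenG q
  | MOr p q => rdenG p \/ rdenG q
  | MImp p q => rdenG p -> rdenG q
  | MIff p q => rdenG p <-> rdenG q
  | MAll f => forall i, i < D -> rdenG (f i)
  | MEx f => exists2 i, i < D & rdenG (f i)
  | MAllQ f => forall q, rdenG (f q)
  | MExQ f => exists q, rdenG (f q)
  end.

End RDen.
Notation rden D x R :=
  (rdenG D x R (fun i j k => i + j = k) (fun i j k => i * j = k)).

Section Tr.
Variables (I : Type) (ad mu : I).

Fixpoint tr (Q : finType) (V : Type) (p : fm I Q V) : form I V :=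
  match p with
  | MLe i j => FLe i j
  | MLt i j => fLt i j
  | MEq i j => fEq i j
  | MZero i => fZero i
  | MSucc i j => fSucc i j
  | MAdd i j k => FRel ad i j k
  | MMul i j k => FRel mu i j k
  | MRel l i j k => FRel l i j k
  | MX i => FX i
  | MIn i => FIn i
  | MC b => if b then fTrue else FNot fTrue
  | MNot p => FNot (tr p)
  | MAnd p q => FAnd (tr p) (tr q)
  | MOr p q => fOr (tr p) (tr q)
  | MImp p q => fImp (tr p) (tr q)
  | MIff p q => fIff (tr p) (tr q)
  | MAll f => fAll (fun v => tr (f v))
  | MEx f => FEx (fun v => tr (f v))
  | MAllQ f => fAnds [seq tr (f q) | q <- enum Q]
  | MExQ f => fOrs [seq tr (f q) | q <- enum Q]
  end.

Variables (Q : finType) (K : nat).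

Definition okv (r : nat) (env : nat -> nat) (i i' : nat) : Prop :=
  (r <= i < K) && (env i == i').

(** The condition [4 <= r] reserves a digit for the quantifier hidden in a translation. Values are
    tied to names by equations in [okv], so that the rules apply by unification alone. *)
Inductive rrel : nat -> (nat -> nat) -> fm I Q nat -> fm I Q nat -> Prop :=
| QLe r env i j i' j' : okv r env i i' -> okv r env j j' ->
    rrel r env (MLe i j) (MLe i' j')
| QLt r env i j i' j' : okv r env i i' -> okv r env j j' ->
    rrel r env (MLt i j) (MLt i' j')
| QEq r env i j i' j' : okv r env i i' -> okv r env j j' ->
    rrel r env (MEq i j) (MEq i' j')
| QZero r env i i' : 4 <= r -> okv r env i i' ->
    rrel r env (MZero i) (MZero i')
| QSucc r env i j i' j' : 4 <= r -> okv r env i i' -> okv r env j j' ->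
    rrel r env (MSucc i j) (MSucc i' j')
| QAdd r env i j k i' j' k' : okv r env i i' -> okv r env j j' -> okv r env k k' ->
    rrel r env (MAdd i j k) (MAdd i' j' k')
| QMul r env i j k i' j' k' : okv r env i i' -> okv r env j j' -> okv r env k k' ->
    rrel r env (MMul i j k) (MMul i' j' k')
| QRel r env l i j k i' j' k' : okv r env i i' -> okv r env j j' -> okv r env k k' ->
    rrel r env (MRel l i j k) (MRel l i' j' k')
| QX r env i i' : okv r env i i' -> rrel r env (MX i) (MX i')
| QIn r env i i' : okv r env i i' -> rrel r env (MIn i) (MIn i')
| QC r env b : 4 <= r -> rrel r env (MC b) (MC b)
| QNot r env p q : rrel r env p q -> rrel r env (MNot p) (MNot q)
| QAnd r env p q p' q' : rrel r env p q -> rrel r env p' q' ->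
    rrel r env (MAnd p p') (MAnd q q')
| QOr r env p q p' q' : rrel r env p q -> rrel r env p' q' ->
    rrel r env (MOr p p') (MOr q q')
| QImp r env p q p' q' : rrel r env p q -> rrel r env p' q' ->
    rrel r env (MImp p p') (MImp q q')
| QIff r env p q p' q' : rrel r env p q -> rrel r env p' q' ->
    rrel r env (MIff p p') (MIff q q')
| QAll r env f g : 3 <= r -> (forall v, rrel r (upd env r v) (f r) (g v)) ->
    rrel r.+1 env (MAll f) (MAll g)
| QEx r env f g : 3 <= r -> (forall v, rrel r (upd env r v) (f r) (g v)) ->
    rrel r.+1 env (MEx f) (MEx g)
| QAllQ r env f g : 4 <= r -> (forall q, rrel r env (f q) (g q)) ->
    rrel r env (MAllQ f) (MAllQ g)
| QExQ r env f g : 4 <= r -> (forall q, rrel r env (f q) (g q)) ->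
    rrel r env (MExQ f) (MExQ g).

Notation varelK := (@varel I K).

Lemma varel_le r env i j i' j' : okv r env i i' -> okv r env j j' ->
  varelK r env (FLe i j) (FLe i' j').
Proof. by move=> /andP [hi /eqP <-] /andP [hj /eqP <-]; constructor. Qed.

Lemma varel_all r env f g : 3 <= r -> (forall v, varelK r (upd env r v) (f r) (g v)) ->
  varelK r.+1 env (fAll f) (fAll g).
Proof.
move=> r3 H; apply: RNot; apply: REx => [|v]; first exact: r3.
by apply: RNot; exact: H.
Qed.

Lemma varel_or r env p q p' q' : varelK r env p q -> varelK r env p' q' ->
  varelK r env (fOr p p') (fOr q q').
Proof. by move=> H H'; do ! constructor. Qed.

Lemma varel_imp r env p q p' q' : varelK r env p q -> varelK r env p' q' ->
  varelK r env (fImp p p') (fImp q q').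
Proof. by move=> H H'; do ! constructor. Qed.

Lemma okv_upd r env v i i' : okv r.+1 env i i' -> okv r (upd env r v) i i'.
Proof.
move=> /andP [/andP [ri iK] e]; rewrite /okv iK (ltnW ri) /= /upd.
by case: (eqVneq i r) => // ei; rewrite ei ltnn in ri.
Qed.

Lemma okv_new r env v : r < K -> okv r (upd env r v) r v.
Proof. by move=> rK; rewrite /okv leqnn rK /upd !eqxx. Qed.

Lemma varel_true r env : 4 <= r <= K -> varelK r env fTrue fTrue.
Proof.
case: r => // r /andP [r3 rK]; apply: varel_all => // v.
by apply: (@varel_le _ _ r r v v); apply: okv_new.
Qed.

Lemma rrel_varel r env p q : rrel r env p q -> r <= K -> varelK r env (tr p) (tr q).
Proof.
elim=> {r env p q}.
- by move=> r env i j i' j' hi hj _; exact: varel_le hi hj.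
- by move=> r env i j i' j' hi hj _; constructor; exact: varel_le hj hi.
- by move=> r env i j i' j' hi hj _; constructor; [exact: varel_le hi hj|exact: varel_le hj hi].
- move=> [//|r] env i i' r3 hi rK; apply: varel_all => // v.
  exact: varel_le (okv_upd v hi) (okv_new env v rK).
- move=> [//|r] env i j i' j' r3 hi hj rK; constructor; first by constructor; exact: varel_le hj hi.
  apply: varel_all => // v; apply: varel_or.
    exact: varel_le (okv_new env v rK) (okv_upd v hi).
  exact: varel_le (okv_upd v hj) (okv_new env v rK).
- by move=> r env i j k i' j' k' /andP [hi /eqP <-] /andP [hj /eqP <-] /andP [hk /eqP <-] _; constructor.
- by move=> r env i j k i' j' k' /andP [hi /eqP <-] /andP [hj /eqP <-] /andP [hk /eqP <-] _; constructor.
- by move=> r env l i j k i' j' k' /andP [hi /eqP <-] /andP [hj /eqP <-] /andP [hk /eqP <-] _; constructor.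
- by move=> r env i i' /andP [hi /eqP <-] _; constructor.
- by move=> r env i i' /andP [hi /eqP <-] _; constructor.
- move=> r env [] r3 rK /=; [|constructor]; apply: varel_true; by rewrite r3.
- by move=> r env p q _ IH rK; constructor; apply: IH.
- by move=> r env p q p' q' _ IH _ IH' rK; constructor; [apply: IH|apply: IH'].
- by move=> r env p q p' q' _ IH _ IH' rK; apply: varel_or; [apply: IH|apply: IH'].
- by move=> r env p q p' q' _ IH _ IH' rK; apply: varel_imp; [apply: IH|apply: IH'].
- by move=> r env p q p' q' _ IH _ IH' rK; constructor; apply: varel_imp; [apply: IH|apply: IH'|apply: IH'|apply: IH].
- by move=> r env f g r3 _ IH rK; apply: varel_all => // v; apply: IH; apply: ltnW.
- by move=> r env f g r3 _ IH rK; constructor=> // v; apply: IH; apply: ltnW.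
- move=> r env f g r3 _ IH rK /=; elim: (enum Q) => [|q s IHs] /=.
    by apply: varel_true; rewrite r3.
  by constructor; [apply: IH|].
- move=> r env f g r3 _ IH rK /=; elim: (enum Q) => [|q s IHs].
    by constructor; apply: varel_true; rewrite r3.
  by apply: varel_or; [apply: IH|].
Qed.

Lemma rrel_den D x (R : I -> nat -> nat -> nat -> bool) (pa pm : nat -> nat -> nat -> Prop) r env p q :
  rrel r env p q -> 0 < D ->
  (forall y, r <= y < K -> env y < D) ->
  (forall i j k, i < D -> j < D -> k < D -> R ad i j k <-> pa i j k) ->
  (forall i j k, i < D -> j < D -> k < D -> R mu i j k <-> pm i j k) ->
  den D x R (tr q) <-> rdenG D x R pa pm q.
Proof.
move=> h D0 + EA EM.
have okD r' env' i i' : okv r' env' i i' -> (forall y, r' <= y < K -> env' y < D) -> i' < D.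
  by move=> /andP [hi /eqP <-]; apply.
have updD r' (env' : nat -> nat) v : v < D -> (forall y, r'.+1 <= y < K -> env' y < D) ->
    forall y, r' <= y < K -> upd env' r' v y < D.
  move=> ltv H y /andP [le ltK]; rewrite /upd; case: eqP => // /eqP ne.
  by apply: H; rewrite ltK andbT ltn_neqAle eq_sym ne.
elim: h => {r env p q}.
- by [].
- by move=> r env i j i' j' hi hj lt; exact: den_lt.
- by move=> r env i j i' j' hi hj lt; exact: den_eq.
- by move=> r env i i' r3 hi lt; apply: den_zero; apply: okD hi lt.
- by move=> r env i j i' j' r3 hi hj lt; apply: den_succ; [apply: okD hi lt|apply: okD hj lt].
- move=> r env i j k i' j' k' hi hj hk lt /=.
  by apply: EA; [exact: okD hi lt|exact: okD hj lt|exact: okD hk lt].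
- move=> r env i j k i' j' k' hi hj hk lt /=.
  by apply: EM; [exact: okD hi lt|exact: okD hj lt|exact: okD hk lt].
- by [].
- by [].
- by [].
- by move=> r env [] r3 lt; split=> // H; [exact: den_true|case: (H (@den_true I D x R))].
- by move=> r env p q _ IH lt /=; rewrite IH.
- by move=> r env p q p' q' _ IH _ IH' lt /=; rewrite IH ?IH'.
- by move=> r env p q p' q' _ IH _ IH' lt; rewrite [tr _]/= den_or /= IH ?IH'.
- by move=> r env p q p' q' _ IH _ IH' lt; rewrite [tr _]/= den_imp /= IH ?IH'.
- by move=> r env p q p' q' _ IH _ IH' lt; rewrite [tr _]/= den_iff /= IH ?IH'.
- move=> r env f g r3 _ IH lt; rewrite [tr _]/= den_all /=.
  have H v : v < D -> den D x R (tr (g v)) <-> rdenG D x R pa pm (g v).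
    by move=> ltv; apply: IH; exact: updD.
  by split=> H' v ltv; apply/(H v ltv); apply: H'.
- move=> r env f g r3 _ IH lt /=.
  have H v : v < D -> den D x R (tr (g v)) <-> rdenG D x R pa pm (g v).
    by move=> ltv; apply: IH; exact: updD.
  by split=> -[v ltv /(H v ltv) H']; exists v.
- move=> r env f g r3 _ IH lt; rewrite [tr _]/= (den_andsQ D x R (fun q => tr (g q))) /=.
  by split=> H q; apply/(IH q lt); apply: H.
move=> r env f g r3 _ IH lt; rewrite [tr _]/= (den_orsQ D x R (fun q => tr (g q))) /=.
by split=> -[q /(IH q lt) H]; exists q.
Qed.

(* Recursion equations that pin the relations [ad] and [mu] down to the graphs
   of addition and multiplication below D. *)
Definition arith V : fm I Q V :=
  MAll (fun i => MAll (fun j => MAll (fun k =>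
    MAnd (MImp (MZero j) (MAnd (MIff (MRel ad i j k) (MEq i k))
                               (MIff (MRel mu i j k) (MZero k))))
      (MAll (fun j' => MImp (MSucc j j') (MAnd
        (MIff (MRel ad i j' k) (MEx (fun k0 => MAnd (MSucc k0 k) (MRel ad i j k0))))
        (MIff (MRel mu i j' k) (MEx (fun k0 =>
            MAnd (MRel mu i j k0) (MRel ad k0 i k)))))))))).

(** Induction on the second argument. A result below D has all its partial sums and products below D
    too, so truncation at D does no harm. *)
Lemma arith_den D x (R : I -> nat -> nat -> nat -> bool) pa pm :
  rdenG D x R pa pm (arith nat) <->
  (forall i j k, i < D -> j < D -> k < D -> R ad i j k = (i + j == k)) /\
  (forall i j k, i < D -> j < D -> k < D -> R mu i j k = (i * j == k)).
Proof.
split=> [H|[HA HM]]; last first.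
  move=> i lti j ltj k ltk; split=> [j0|j' ltj' ejj'].
    rewrite HA ?HM // j0 addn0 muln0 [0 == k]eq_sym.
    by split; split=> /eqP.
  rewrite HA ?HM // ejj' addnS mulnS; split; split.
  - move=> /eqP ek; have lt0 : i + j < D by lia.
    by exists (i + j); rewrite ?HA.
  - by case=> k0 lt0 [->]; rewrite HA // => /eqP ->.
  - move=> /eqP ek; have lt0 : i * j < D by lia.
    by exists (i * j); rewrite // HM // HA // eqxx addnC ek.
  - by case=> k0 lt0; rewrite HM // HA // => -[/eqP -> /eqP <-]; rewrite addnC.
have HA i j k : i < D -> j < D -> k < D -> R ad i j k = (i + j == k).
  move=> lti; elim: j k => [|j IH] k ltj ltk.
    have [/(_ erefl) [E _] _] := H i lti 0 ltj k ltk.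
    by rewrite addn0; apply/idP/eqP => /E.
  have ltj' := ltnW ltj.
  have [_ /(_ j.+1 ltj erefl) [E _]] := H i lti j ltj' k ltk.
  rewrite addnS; apply/idP/eqP => [/E [k0 lt0 [->]]|ek].
    by rewrite IH // => /eqP ->.
  have lt0 : i + j < D by lia.
  by apply/E; exists (i + j); rewrite ?IH.
split=> // i j k lti; elim: j k => [|j IH] k ltj ltk.
  have [/(_ erefl) [_ E] _] := H i lti 0 ltj k ltk.
  by rewrite muln0 eq_sym; apply/idP/eqP => /E.
have ltj' := ltnW ltj.
have [_ /(_ j.+1 ltj erefl) [_ E]] := H i lti j ltj' k ltk.
rewrite mulnS; apply/idP/eqP => [/E [k0 lt0]|ek].
  by rewrite IH // HA // => -[/eqP -> /eqP <-]; rewrite addnC.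
have lt0 : i * j < D by lia.
by apply/E; exists (i * j); rewrite ?IH // HA // addnC ek.
Qed.

End Tr.

Ltac rrel_var := apply/andP; split; [done | apply/eqP; reflexivity].
Ltac rrel_step :=
  match goal with
  | |- rrel _ _ _ (MAll _) _ => eapply QAll; [done | intros ?; cbv beta]
  | |- rrel _ _ _ (MEx _) _ => eapply QEx; [done | intros ?; cbv beta]
  | |- rrel _ _ _ (MAllQ _) _ => eapply QAllQ; [done | intros ?; cbv beta]
  | |- rrel _ _ _ (MExQ _) _ => eapply QExQ; [done | intros ?; cbv beta]
  | |- rrel _ _ _ (MAnd _ _) _ => apply: QAnd
  | |- rrel _ _ _ (MOr _ _) _ => apply: QOr
  | |- rrel _ _ _ (MImp _ _) _ => apply: QImp
  | |- rrel _ _ _ (MIff _ _) _ => apply: QIff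
  | |- rrel _ _ _ (MNot _) _ => apply: QNot
  | |- rrel _ _ _ (MLe _ _) _ => apply: QLe; rrel_var
  | |- rrel _ _ _ (MLt _ _) _ => apply: QLt; rrel_var
  | |- rrel _ _ _ (MEq _ _) _ => apply: QEq; rrel_var
  | |- rrel _ _ _ (MZero _) _ => apply: QZero; [done | rrel_var]
  | |- rrel _ _ _ (MSucc _ _) _ => apply: QSucc; [done | rrel_var | rrel_var]
  | |- rrel _ _ _ (MAdd _ _ _) _ => apply: QAdd; rrel_var
  | |- rrel _ _ _ (MMul _ _ _) _ => apply: QMul; rrel_var
  | |- rrel _ _ _ (MRel _ _ _ _) _ => apply: QRel; rrel_var
  | |- rrel _ _ _ (MX _) _ => apply: QX; rrel_var
  | |- rrel _ _ _ (MIn _) _ => apply: QIn; rrel_var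
  | |- rrel _ _ _ (MC _) _ => apply: QC; done
  end.
Ltac rrel_auto := repeat rrel_step.

(** * Fagin's theorem with arithmetic *)

Section FaginRich.
Variables (I Q : finType) (ad mu : I).

(** The three table digits plus a generous bound on quantifier nesting, including the quantifiers
    hidden in translations. *)
Definition nlevels := 40.
(** Forces D to exceed the length of [x], so that quantifiers reach every position of [x]. *)
Definition shortx : fm I Q nat := MEx (fun i => MNot (MIn i)).

Lemma rrel_arith env : rrel nlevels nlevels env (arith ad mu Q nat) (arith ad mu Q nat).
Proof. by rewrite /arith /nlevels; rrel_auto. Qed.

Lemma rrel_shortx env : rrel nlevels nlevels env shortx shortx.
Proof. rewrite /shortx /nlevels; rrel_auto. Qed.

Theorem fagin_rich (p : fm I Q nat) (L : language) (c k : nat) :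
  (forall env, rrel nlevels nlevels env p p) ->
  (forall x D (R : I -> nat -> nat -> nat -> bool), size x < D -> rden D x R p -> L x) ->
  (forall x, L x -> exists D (R : I -> nat -> nat -> nat -> bool),
     [/\ size x < D <= c * (size x).+1 ^ k, rden D x R p,
      forall i j k, R ad i j k = (i + j == k) & forall i j k, R mu i j k = (i * j == k)]) ->
  inNP L.
Proof.
move=> rp sound complete.
have noenv D (env : nat -> nat) y : nlevels <= y < nlevels -> env y < D.
  by case/andP=> h1 h2; have := leq_ltn_trans h1 h2; rewrite ltnn.
apply: (@fagin I nlevels (FAnd (tr ad mu (arith ad mu Q nat)) (FAnd (tr ad mu shortx) (tr ad mu p))) L c k isT).
- move=> env; constructor; first exact: rrel_varel (rrel_arith env) (leqnn _).
  by constructor; [exact: rrel_varel (rrel_shortx env) (leqnn _) | exact: rrel_varel (rp env) (leqnn _)].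
- move=> x D R D0 [ar [[i lti /negP nx] H]].
  rewrite -leqNgt in nx; apply: (sound x D R); first exact: leq_ltn_trans nx lti.
  (* The guessed relations first stand for themselves; the recursion equations then show them to be
     true arithmetic below D. *)
  have /arith_den [HA HM] : rdenG D x R (R ad) (R mu) (arith ad mu Q nat).
    have E := rrel_den (ad := ad) (mu := mu) x (R := R) (pa := R ad) (pm := R mu)
      (rrel_arith id) D0 (noenv D id).
    by apply/E => [*|*|]; [split|split|exact: ar].
  have E := rrel_den (ad := ad) (mu := mu) x (R := R) (rp id) D0 (noenv D id).
  apply/E; last exact: H.
    by move=> i' j l li lj ll; rewrite HA //; split=> /eqP.
  by move=> i' j l li lj ll; rewrite HM //; split=> /eqP.
move=> x /complete [D [R [/andP [xD leD] H HA HM]]].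
exists D, R; rewrite (leq_ltn_trans (leq0n _) xD) leD; split=> //.
have D0 : 0 < D by apply: leq_ltn_trans xD.
have HA' i j l : i < D -> j < D -> l < D -> R ad i j l <-> i + j = l by move=> *; rewrite HA; split=> /eqP.
have HM' i j l : i < D -> j < D -> l < D -> R mu i j l <-> i * j = l by move=> *; rewrite HM; split=> /eqP.
split; first by apply/(rrel_den (ad := ad) (mu := mu) x (rrel_arith id) D0 (noenv _ _) HA' HM'); apply/arith_den; split=> *; [exact: HA|exact: HM].
split; last by apply/(rrel_den (ad := ad) (mu := mu) x (rp id) D0 (noenv _ _) HA' HM').
by exists (size x) => //=; apply/negP; rewrite ltnn.
Qed.
End FaginRich.

(** * The sentence expressing non-isomorphism *)

(* A machine with its bound [vc * n ^ vk + vc] on the size of certificates. *)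
Record verifier := Verifier { vM :> TM; vc : nat; vk : nat }.

Section Formula.
Variable M : verifier.
Notation Q := (tm_Q M).

Definition rname : finType :=
  (bool + bool * ((Q + bool * bool) + bool * 'I_(vc M + vk M).+1))%type.
Definition rAdd : rname := inl true.
Definition rMul : rname := inl false.
(* For the graph with index [h]: state [q] at time t, the isomorphism from the
   gadget, the head position, nonblank cells and cells containing a 1. *)
Definition rSt h q : rname := inr (h, inl (inl q)).
Definition rF h : rname := inr (h, inl (inr (false, false))).
Definition rHd h : rname := inr (h, inl (inr (false, true))).
Definition rNb h : rname := inr (h, inl (inr (true, false))).
Definition rBt h : rname := inr (h, inl (inr (true, true))).
Definition rPow h j : rname := inr (h, inr (true, inord j)).
Definition rLin h j : rname := inr (h, inr (false, inord j)).

Section Builders.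
Variable V : Type.
Notation F := (fm rname Q V).

(** In a word with doubled letters the matrix entry (a, b) begins at r = 2 * (a * m + b). *)
Definition idx2 (m a b r : V) : F := MEx (fun p => MEx (fun q =>
  MAnd (MMul a m p) (MAnd (MAdd p b q) (MAdd q q r)))).

Definition gr1 (n i j : V) : F := MEx (fun r => MAnd (idx2 n i j r) (MX r)).

Definition gr2 (o n i j : V) : F := MEx (fun p => MEx (fun q => MEx (fun r =>
  MAnd (MMul i n p) (MAnd (MAdd p j q) (MAnd (MAdd o q r) (MX r)))))).

Definition adjf (G : V -> V -> F) (n : V) : F :=
  MAnd (MAll (fun i => MAll (fun j => MImp (MLt i n) (MImp (MLt j n) (MIff (G i j) (G j i))))))
       (MAll (fun i => MImp (MLt i n) (MNot (G i i)))).

(** Here [e] is the position of the separator, [o] the offset of the second matrix and [l] the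
    length of [x]; the letters before [e] are compared pair by pair. *)
Definition wf (n1 n2 o : V) : F :=
  MAnd (MEx (fun z => MEx (fun e => MEx (fun e1 => MEx (fun s => MEx (fun l =>
    MAnd (MZero z) (MAnd (idx2 n1 n1 z e) (MAnd (MSucc e e1) (MAnd (MSucc e1 o)
    (MAnd (MNot (MX e)) (MAnd (MX e1)
    (MAnd (MMul n2 n2 s) (MAnd (MAdd o s l) (MAnd (MNot (MIn l))
    (MAnd (MAll (fun j => MImp (MLt j l) (MIn j)))
      (MAll (fun q => MAll (fun r => MAll (fun r' => MImp (MAdd q q r) (MImp (MSucc r r')
         (MImp (MLt r e) (MIff (MX r) (MX r')))))))))))))))))))))))
  (MAnd (adjf (gr1 n1) n1) (adjf (gr2 o n2) n2)).

Definition bin (R : rname) (i j : V) : F := MRel R i j j.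
Definition una (R : rname) (i : V) : F := MRel R i i i.

(** The candidate canonical matrix has no relation of its own: it is read from the initial tape of
    the simulated verifier, where it is the first component of the input. *)
Definition cf h (m u v : V) : F := MEx (fun z => MEx (fun r =>
  MAnd (MZero z) (MAnd (idx2 m u v r) (bin (rBt h) z r)))).

Definition gadgetf (G : V -> V -> F) (n i j i' j' : V) : F :=
  MOr (MAnd (MEq i i') (MNot (MIff (MEq j n) (MEq j' n))))
      (MAnd (MEq i' j) (MAnd (MEq j' i) (G i i'))).

(** Besides totality and surjectivity, a single equivalence makes the guessed relation both
    functional and injective. *)
Definition isof h (G : V -> V -> F) (n m : V) : F :=
  MEx (fun a => MEx (fun b => MEx (fun c => MEx (fun n4 =>
    MAnd (MSucc n a) (MAnd (MSucc a b) (MAnd (MSucc b c) (MAnd (MSucc c n4)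
    (MAnd
      (MAll (fun i => MAll (fun j => MImp (MLt i n) (MImp (MLt j n4)
         (MEx (fun u => MAnd (MLt u m) (MRel (rF h) i j u)))))))
    (MAnd
      (MAll (fun u => MImp (MLt u m) (MEx (fun i => MEx (fun j =>
         MAnd (MLt i n) (MAnd (MLt j n4) (MRel (rF h) i j u)))))))
      (MAll (fun i => MAll (fun j => MAll (fun i' => MAll (fun j' => MAll (fun u => MAll (fun u' =>
         MImp (MLt i n) (MImp (MLt j n4) (MImp (MLt i' n) (MImp (MLt j' n4)
         (MImp (MLt u m) (MImp (MLt u' m)
         (MImp (MRel (rF h) i j u) (MImp (MRel (rF h) i' j' u')
         (MAnd (MIff (MEq u u') (MAnd (MEq i i') (MEq j j')))
               (MIff (gadgetf G n i j i' j') (cf h m u u')))))))))))))))))))))))))).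

Fixpoint andn (k : nat) (f : nat -> F) : F :=
  if k is k'.+1 then MAnd (andn k' f) (f k') else MC true.

(** If [step] is the graph of a function, [Rn j] can hold below D only of its [j]-th iterate. *)
Definition chainf (Rn : nat -> rname) (base : V -> F) (step : V -> V -> F) (k : nat) : F :=
  MAnd (MAll (fun r => MIff (una (Rn 0) r) (base r)))
       (andn k (fun j => MAll (fun r' => MIff (una (Rn j.+1) r')
          (MEx (fun r => MAnd (una (Rn j) r) (step r r')))))).

(* The values b^j (j <= vk) and j * (b^vk + 1) (j <= vc), with b = m^2, are
   carried by relation names instead of nested quantifiers. *)
Definition lenf h (m e1 l : V) : F :=
  MEx (fun b => MEx (fun P => MEx (fun P1 => MEx (fun U => MEx (fun e2 => MEx (fun s =>
    MAnd (MMul m m b)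
   (MAnd (chainf (rPow h) (fun r => MEx (fun z => MAnd (MZero z) (MSucc z r)))
            (fun r r' => MMul r b r') (vk M))
   (MAnd (una (rPow h (vk M)) P) (MAnd (MSucc P P1)
   (MAnd (chainf (rLin h) (fun r => MZero r) (fun r r' => MAdd r P1 r') (vc M))
   (MAnd (una (rLin h (vc M)) U) (MAnd (MSucc e1 e2) (MAnd (MAdd e2 U s) (MLe l s)))))))))))))).

(** The initial tape is a guessed word of length [l] that begins with [m * m] doubled letters and
    the separator. The rest is the certificate of the verifier, whose length is limited by
    [lenf]. *)
Definition initf h (m : V) : F :=
  MEx (fun z => MEx (fun e => MEx (fun e1 => MEx (fun l =>
    MAnd (MZero z) (MAnd (idx2 m m z e) (MAnd (MSucc e e1) (MAnd (MLt e1 l)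
    (MAnd (MAllQ (fun q => MIff (una (rSt h q) z) (MC (q == tm_start M))))
    (MAnd (MAll (fun p => MIff (bin (rHd h) z p) (MZero p)))
    (MAnd (MAll (fun p => MAnd (MIff (bin (rNb h) z p) (MLt p l))
                               (MImp (bin (rBt h) z p) (MLt p l))))
    (MAnd (MAll (fun q => MAll (fun r => MAll (fun r' =>
         MImp (MAdd q q r) (MImp (MSucc r r') (MImp (MLt r e)
          (MIff (bin (rBt h) z r) (bin (rBt h) z r'))))))))
    (MAnd (MNot (bin (rBt h) z e)) (MAnd (bin (rBt h) z e1) (lenf h m e1 l)))))))))))))).

Definition symf h (a : option bool) (t p : V) : F :=
  MAnd (MIff (bin (rNb h) t p) (MC (isSome a))) (MIff (bin (rBt h) t p) (MC (a == Some true))).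

Definition isL m := if m is MoveL then true else false.
Definition isR m := if m is MoveR then true else false.
Definition isS m := if m is MoveS then true else false.

Definition headf h (m : move) (p t : V) : F := MAll (fun p2 =>
  MIff (bin (rHd h) t p2)
    (MOr (MAnd (MC (isS m)) (MEq p p2))
    (MOr (MAnd (MC (isR m)) (MSucc p p2))
         (MAnd (MC (isL m)) (MOr (MSucc p2 p) (MAnd (MZero p) (MZero p2))))))).

Definition stepcase h (a : option bool) (q : Q) (t t' p : V) : F :=
  MImp (symf h a t p)
    (MAnd (MAllQ (fun q' => MIff (una (rSt h q') t') (MC (q' == (delta1 q a).1.1))))
    (MAnd (symf h (delta1 q a).1.2 t' p) (headf h (delta1 q a).2 p t'))).

Definition stepf h : F :=
  MAll (fun t => MAll (fun t' => MImp (MSucc t t') (MAll (fun p => MImp (bin (rHd h) t p)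
    (MAnd (MAll (fun p' => MImp (MNot (MEq p p'))
             (MAnd (MIff (bin (rNb h) t' p') (bin (rNb h) t p'))
                   (MIff (bin (rBt h) t' p') (bin (rBt h) t p')))))
      (MAllQ (fun q => MImp (una (rSt h q) t)
         (MAnd (stepcase h None q t t' p)
         (MAnd (stepcase h (Some true) q t t' p) (stepcase h (Some false) q t t' p)))))))))).

Definition acceptf h : F :=
  MEx (fun t => MExQ (fun q => MAnd (una (rSt h q) t) (MC (tm_halt M q && tm_accept M q)))).

Definition sidef h (G : V -> V -> F) (n m : V) : F :=
  MAnd (isof h G n m) (MAnd (initf h m) (MAnd (stepf h) (acceptf h))).

Definition difff (m1 m2 : V) : F :=
  MOr (MNot (MEq m1 m2)) (MEx (fun u => MEx (fun v => MAnd (MLt u m1) (MAnd (MLt v m1)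
    (MNot (MIff (cf false m1 u v) (cf true m2 u v))))))).

Definition bodyf (n1 n2 o : V) : F :=
  MEx (fun m1 => MEx (fun m2 =>
    MAnd (sidef false (gr1 n1) n1 m1) (MAnd (sidef true (gr2 o n2) n2 m2) (difff m1 m2)))).

(** The first disjunct accepts the words that encode no pair of graphs; they belong to the
    complement of [GI]. *)
Definition phi : F :=
  MOr (MNot (MEx (fun n1 => MEx (fun n2 => MEx (fun o => wf n1 n2 o)))))
      (MEx (fun n1 => MEx (fun n2 => MEx (fun o => MAnd (wf n1 n2 o) (bodyf n1 n2 o))))).

End Builders.

Lemma rrel_andn r env k (f g : nat -> fm rname Q nat) : 4 <= r ->
  (forall j, rrel nlevels r env (f j) (g j)) -> rrel nlevels r env (andn k f) (andn k g).
Proof. by move=> r4 H; elim: k => [|k IH] /=; [apply: QC|apply: QAnd]. Qed.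

Ltac rrel_andn :=
  match goal with
  | |- rrel ?k ?r ?e (andn _ _) (andn _ _) => apply: (@rrel_andn r e); [done | intros ?; cbv beta]
  end.

Lemma rrel_phi env : rrel nlevels nlevels env (phi nat) (phi nat).
Proof.
rewrite /phi /bodyf /difff /sidef /acceptf /stepf /stepcase /headf /symf /initf /lenf /chainf /isof
  /gadgetf /cf /bin /una /wf /adjf /gr2 /gr1 /idx2.
by rewrite {2}/nlevels; repeat first [rrel_step | rrel_andn].
Qed.

End Formula.

(** * Meaning of the clauses on encodings and isomorphisms *)

Lemma size_pair_enc s1 s2 : size (pair_enc s1 s2) = 2 * size s1 + 2 + size s2.
Proof. by rewrite pair_encE size_cat; elim: s1 => //= b s IH; lia. Qed.

Lemma nth_pair_enc s1 s2 i : nth false (pair_enc s1 s2) i =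
  if i < 2 * size s1 then nth false s1 (i %/ 2)
  else if i == 2 * size s1 then false
  else if i == 2 * size s1 + 1 then true
  else nth false s2 (i - (2 * size s1 + 2)).
Proof.
rewrite pair_encE; elim: s1 i => [|b s IH] i.
  by rewrite [size _]/= muln0 add0n; case: i => [|[|i]] //; rewrite /= !subSS subn0.
case: i => [|[|i]].
- by rewrite [size _]/= mulnS.
- by rewrite [size _]/= mulnS /= addbF.
rewrite [LHS]/= IH [size _]/= mulnS !add2n !addSn !ltnS !eqSS !subSS.
by have -> : i.+2 %/ 2 = (i %/ 2).+1 by rewrite -addn2 divnDr // addn1.
Qed.

Lemma pair_encP x m : 2 * m + 2 <= size x ->
  (forall q, q < m -> nth false x (2 * q) = nth false x (2 * q).+1) ->
  nth false x (2 * m) = false -> nth false x (2 * m).+1 = true ->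
  x = pair_enc (mkseq (fun q => nth false x (2 * q)) m) (drop (2 * m + 2) x).
Proof.
move=> le dbl e0 e1; apply: (@eq_from_nth _ false).
  by rewrite size_pair_enc size_mkseq size_drop; lia.
move=> i lti; rewrite nth_pair_enc size_mkseq.
case: ltnP => [lt|ge].
  have lt2 : i %/ 2 < m by rewrite ltn_divLR // mulnC.
  rewrite nth_mkseq //; have := divn_eq i 2; have := ltn_pmod i (isT : 0 < 2).
  case: (i %% 2) => [|[|]] // _; rewrite ?addn0 ?addn1 mulnC => {1}->.
    by [].
  by rewrite dbl.
case: eqP => [->|n0] //; case: eqP => [->|n1]; first by rewrite addn1.
by rewrite nth_drop subnKC //; lia.
Qed.

Definition wfspec (x : seq bool) (n1 n2 o : nat) (s1 s2 : seq bool) : Prop :=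
  [/\ x = pair_enc s1 s2, size s1 = n1 * n1 /\ size s2 = n2 * n2,
      is_adj_matrix (decode_mx n1 s1), is_adj_matrix (decode_mx n2 s2) &
      o = 2 * (n1 * n1) + 2].

Section Sem.
Variables (M : verifier) (D : nat) (x : seq bool).
Variable R : rname M -> nat -> nat -> nat -> bool.
Notation rd := (rden D x R).

Lemma idx2P m a b r : r < D -> rd (idx2 M m a b r) <-> r = 2 * (a * m + b).
Proof.
move=> ltr; split=> [[p _ [q _ [<- [<- <-]]]]|er] /=; first by rewrite mul2n addnn.
have l1 : a * m < D by lia.
have l2 : a * m + b < D by lia.
exists (a * m) => //; exists (a * m + b) => //; split=> //; split=> //.
by rewrite er mul2n addnn.
Qed.

Hypothesis xD : size x < D.

(** A true bit of [x] sits below [size x], hence below D, because the default of [nth] is [false];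
    so the witnesses are within range. *)
Lemma gr1P n i j : rd (gr1 M n i j) <-> nth false x (2 * (i * n + j)).
Proof.
split=> [[r ltr [/(idx2P _ _ _ ltr) -> //]]|H].
have lt : 2 * (i * n + j) < D.
  by apply: leq_trans (ltnW xD); rewrite ltnNge; apply/negP => le; rewrite nth_default in H.
by exists (2 * (i * n + j)); rewrite //; split=> //; apply/idx2P.
Qed.

Lemma gr2P o n i j : rd (gr2 M o n i j) <-> nth false x (o + (i * n + j)).
Proof.
split=> [[p _ [q _ [r _ [<- [<- [<-]]]]]] //|H].
have lt : o + (i * n + j) < D.
  by apply: leq_trans (ltnW xD); rewrite ltnNge; apply/negP => le; rewrite nth_default in H.
by exists (i * n); [lia|exists (i * n + j); [lia|exists (o + (i * n + j))]].
Qed.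

Lemma adjfP (G : nat -> nat -> fm (rname M) (tm_Q M) nat) n (A : adjm n) :
  n < D -> (forall i j : 'I_n, rd (G i j) <-> A i j) ->
  rd (adjf G n) <-> is_adj_matrix A.
Proof.
move=> ltn GE; split=> [[H1 H2]|[H1 H2]].
  split=> [i j|i].
    have lti := ltn_trans (ltn_ord i) ltn; have ltj := ltn_trans (ltn_ord j) ltn.
    have [h1 h2] := H1 i lti j ltj (ltn_ord i) (ltn_ord j).
    by apply/idP/idP => [/GE /h1 /GE|/GE /h2 /GE].
  have lti := ltn_trans (ltn_ord i) ltn.
  by have h := H2 i lti (ltn_ord i); apply/negP => /GE /h.
split=> [i _ j _ lti ltj|i _ lti].
  have E1 := GE (Ordinal lti) (Ordinal ltj); have E2 := GE (Ordinal ltj) (Ordinal lti).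
  by rewrite H1 in E1; split=> [/E1 /E2|/E2 /E1].
by move=> /(GE (Ordinal lti) (Ordinal lti)); rewrite H2.
Qed.

End Sem.

Section Sem.
Variables (M : verifier) (D : nat) (x : seq bool).
Variable R : rname M -> nat -> nat -> nat -> bool.
Notation rd := (rden D x R).
Hypothesis xD : size x < D.

Lemma mx_index_lt n i j : i < n -> j < n -> i * n + j < n * n.
Proof.
move=> lti ltj; apply: leq_trans (_ : i.+1 * n <= _); last by rewrite leq_mul2r lti orbT.
by rewrite mulSn addnC ltn_add2r.
Qed.

Lemma gr1_entry s1 s2 n i j : x = pair_enc s1 s2 -> size s1 = n * n ->
  i < n -> j < n -> rd (gr1 M n i j) <-> entry n s1 i j.
Proof.
move=> Ex sz lti ltj; rewrite gr1P // Ex nth_pair_enc sz.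
by rewrite ltn_pmul2l // mx_index_lt // mulKn.
Qed.

Lemma gr2_entry s1 s2 n o i j : x = pair_enc s1 s2 -> o = 2 * size s1 + 2 ->
  rd (gr2 M o n i j) <-> entry n s2 i j.
Proof.
move=> Ex eo; rewrite gr2P // Ex nth_pair_enc eo.
have -> : (2 * size s1 + 2 + (i * n + j) < 2 * size s1) = false by lia.
have -> : (2 * size s1 + 2 + (i * n + j) == 2 * size s1) = false by lia.
have -> : (2 * size s1 + 2 + (i * n + j) == 2 * size s1 + 1) = false by lia.
by rewrite addnC addnK.
Qed.

Lemma wfP n1 n2 o : n1 < D -> n2 < D -> o < D ->
  rd (wf M n1 n2 o) <-> exists s1 s2, wfspec x n1 n2 o s1 s2.
Proof.
move=> lt1 lt2 lto.
have adjP s1 s2 : x = pair_enc s1 s2 -> size s1 = n1 * n1 -> size s2 = n2 * n2 ->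
    o = 2 * (n1 * n1) + 2 ->
    (rd (adjf (gr1 M n1) n1) <-> is_adj_matrix (decode_mx n1 s1)) /\
    (rd (adjf (gr2 M o n2) n2) <-> is_adj_matrix (decode_mx n2 s2)).
  move=> Ex sz1 sz2 eo; split; apply: adjfP => // i j.
    exact: gr1_entry Ex sz1 _ _.
  by apply: gr2_entry Ex _; rewrite sz1.
rewrite /wf /=.
split=> [[[z _ [e lte [e1 lte1 [s lts [l ltl H]]]]] [A1 A2]]|[s1 [s2 [Ex [sz1 sz2] adj1 adj2 eo]]]].
  case: H => z0 [/(idx2P x R n1 n1 z lte) Ee [Ee1 [Eo [Xe [Xe1 [Es [El [nl [al dbl]]]]]]]]].
  rewrite {}z0 addn0 in Ee.
  have szx : size x = l.
    apply/eqP; rewrite eqn_leq leqNgt; apply/andP; split; first by apply/negP.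
    by rewrite leqNgt; apply/negP => /(al _ xD); rewrite /= ltnn.
  have eo : o = 2 * (n1 * n1) + 2 by rewrite Eo Ee1 Ee addn2.
  have Ex : x = pair_enc (mkseq (fun q => nth false x (2 * q)) (n1 * n1)) (drop (2 * (n1 * n1) + 2) x).
    apply: pair_encP.
    - by rewrite szx -El eo leq_addr.
    - move=> q ltq.
      have ltqe : 2 * q < e by rewrite Ee ltn_mul2l.
      have [l1 l2 l3] : [/\ q < D, 2 * q < D & (2 * q).+1 < D] by split; lia.
      have e2 : q + q = 2 * q by rewrite mul2n addnn.
      have [h1 h2] := dbl q l1 (2 * q) l2 (2 * q).+1 l3 e2 erefl ltqe.
      by apply/idP/idP => [/h1|/h2].
    - by rewrite -Ee; apply/negP.
    - by rewrite -Ee -Ee1.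
  have sz1 : size (mkseq (fun q => nth false x (2 * q)) (n1 * n1)) = n1 * n1 by rewrite size_mkseq.
  have sz2 : size (drop (2 * (n1 * n1) + 2) x) = n2 * n2.
    by rewrite size_drop szx -El -eo Es addKn.
  have [a1 a2] := adjP _ _ Ex sz1 sz2 eo.
  by do 2 eexists; split; [exact: Ex| split | apply/a1 | apply/a2 | ].
have [a1 a2] := adjP _ _ Ex sz1 sz2 eo.
have szx : size x = o + n2 * n2 by rewrite Ex size_pair_enc sz1 sz2 eo.
split; last by split; [apply/a1|apply/a2].
pose e := 2 * (n1 * n1).
have lte : e < D by lia.
exists 0; first by lia.
exists e => //; exists e.+1; first by lia.
exists (n2 * n2); first by lia.
exists (size x) => //; split=> //; split; first by apply/(idx2P x R n1 n1 0 lte); rewrite addn0.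
split=> //; split; first by rewrite eo; lia.
have nx q : q < n1 * n1 -> nth false x (2 * q) = nth false x (2 * q).+1.
  move=> ltq; rewrite Ex !nth_pair_enc sz1.
  have -> : 2 * q < 2 * (n1 * n1) by lia.
  have -> : (2 * q).+1 < 2 * (n1 * n1) by lia.
  have -> : (2 * q).+1 %/ 2 = q by rewrite -addn1 mulnC divnMDl // addn0.
  by rewrite mulKn.
split; first by rewrite /= Ex nth_pair_enc sz1 ltnn eqxx.
split; first by rewrite /= Ex nth_pair_enc sz1 -/e; case: ifP => [|_]; [lia|case: eqP => [|_]; [lia|rewrite addn1 eqxx]].
split=> //; split; first by rewrite szx.
split; first by rewrite /= ltnn.
split=> // q _ r _ r' _ /= Er Er' lt.
have lq : q < n1 * n1 by lia.
have := nx q lq; rewrite mul2n -addnn Er -Er' => ->; split=> //.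
Qed.

Lemma cfP h m u v : rd (cf M h m u v) <->
  2 * (u * m + v) < D /\ R (rBt M h) 0 (2 * (u * m + v)) (2 * (u * m + v)).
Proof.
rewrite /cf /=; split=> [[z _ [r ltr [z0 [/(idx2P x R m u v ltr) er H]]]]|[lt H]].
  by rewrite -er; split=> //; rewrite -{1}z0.
exists 0; first exact: leq_ltn_trans (leq0n _) lt.
exists (2 * (u * m + v)) => //; split=> //; split=> //; exact/(idx2P x R m u v lt).
Qed.

End Sem.

Section Sem.
Variables (M : verifier) (D : nat) (x : seq bool).
Variable R : rname M -> nat -> nat -> nat -> bool.
Notation rd := (rden D x R).

Section Iso.
Variables (h : bool) (G : nat -> nat -> fm (rname M) (tm_Q M) nat).
Variables (n m : nat) (A : adjm n) (C : seq bool).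
Hypothesis GE : forall i j : 'I_n, rd (G i j) <-> A i j.
Hypothesis CE : forall q, q < m * m -> nth false C q = R (rBt M h) 0 (2 * q) (2 * q).
Hypothesis mD : 2 * (m * m) <= D.

Lemma cf_entry (u v : 'I_m) : rd (cf M h m u v) <-> decode_mx m C u v.
Proof.
have lt : u * m + v < m * m by apply: mx_index_lt.
rewrite cfP /decode_mx CE //; split=> [[]//|H]; split=> //.
by apply: leq_trans mD; rewrite ltn_mul2l.
Qed.

Lemma gadgetfP (i i' : 'I_n) (j j' : 'I_(n + 4)) :
  rd (gadgetf G n i j i' j') <-> gadget A (i, j) (i', j').
Proof.
rewrite /gadgetf /gadget /=; split.
  case=> [[/val_inj -> ne]|[e1 [e2 /GE H]]]; apply/orP; [left|right].
    rewrite eqxx /=; apply/eqP => E; apply: ne.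
    by split=> e; apply/eqP; [rewrite -E|rewrite E]; apply/eqP.
  by rewrite H e1 e2 !eqxx.
case/orP => [/andP [/eqP -> ne]|/and3P [/eqP e1 /eqP e2 /GE H]]; [left|by right].
by split=> // E; case/eqP: ne; apply/eqP/eqP => /E.
Qed.

Hypothesis nD : n + 4 < D.
Hypothesis mltD : m < D.

Lemma isof_sound : rd (isof h G n m) -> iso_rel (gadget A) (decode_mx m C).
Proof.
rewrite /isof /= => -[a _ [b _ [c _ [n4 _ [ea [eb [ec [en [Htot [Hsur Hall]]]]]]]]]].
have {ea eb ec}en : n4 = n + 4 by lia.
subst n4.
have tot (p : 'I_n * 'I_(n + 4)) : exists u : 'I_m, R (rF M h) p.1 p.2 u.
  have [lt1 lt2] := (ltn_ord p.1, ltn_ord p.2).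
  have [||||u _ [ltu Hu]] := Htot p.1 _ p.2 _; try lia.
  by exists (Ordinal ltu).
have sur (u : 'I_m) : exists p : 'I_n * 'I_(n + 4), R (rF M h) p.1 p.2 u.
  have ltu := ltn_ord u.
  have [||i _ [j _ [lti [ltj H]]]] := Hsur u; try lia.
  by exists (Ordinal lti, Ordinal ltj).
(* Values and preimages are chosen separately; [key] shows afterwards that the two choices are
   inverse to each other. *)
pose g p := xchoose (tot p); pose g' u := xchoose (sur u).
have gP (p : 'I_n * 'I_(n + 4)) : R (rF M h) p.1 p.2 (g p) by exact: (xchooseP (tot p)).
have g'P (u : 'I_m) : R (rF M h) (g' u).1 (g' u).2 u by exact: (xchooseP (sur u)).
have key (p p' : 'I_n * 'I_(n + 4)) (u u' : 'I_m) :
    R (rF M h) p.1 p.2 u -> R (rF M h) p'.1 p'.2 u' ->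
    (u = u' <-> p = p') /\ (gadget A p p' <-> decode_mx m C u u').
  case: p p' => [i j] [i' j'] H1 H2.
  have := (ltn_ord i, ltn_ord i', ltn_ord j, ltn_ord j', (ltn_ord u, ltn_ord u')).
  case=> [[[[l1 l2] l3] l4] [l5 l6]].
  have lD a' : a' < n + 4 -> a' < D by move=> /leq_trans; apply; apply: ltnW.
  have lD' a' : a' < m -> a' < D by move=> /leq_trans; apply; apply: ltnW.
  have lDn a' : a' < n -> a' < D by move=> lt; apply: lD; apply: leq_trans (leq_addr _ _).
  have [E1 E2] : (u = u' :> nat <-> i = i' :> nat /\ j = j' :> nat) /\
      (rd (gadgetf G n i j i' j') <-> rd (cf M h m u u')).
    exact: (Hall i (lDn _ l1) j (lD _ l3) i' (lDn _ l2) j' (lD _ l4)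
      u (lD' _ l5) u' (lD' _ l6) l1 l3 l2 l4 l5 l6 H1 H2).
  rewrite -gadgetfP -cf_entry; split=> //.
  split=> [e|[e1 e2]]; last by apply: val_inj; apply/E1; rewrite /= e1 e2.
  have [/val_inj -> /val_inj -> //] : i = i' :> nat /\ j = j' :> nat by apply/E1; rewrite e.
exists g => [|p p'].
  exists g' => [p|u].
    by have [[H _] _] := key _ _ _ _ (g'P (g p)) (gP p); apply: H.
  by have [[_ H] _] := key _ _ _ _ (gP (g' u)) (g'P u); apply: H.
by have [_ H] := key _ _ _ _ (gP p) (gP p'); apply/idP/idP => /H.
Qed.

Lemma isof_complete (g : 'I_n * 'I_(n + 4) -> 'I_m) :
  bijective g -> (forall p p', gadget A p p' = decode_mx m C (g p) (g p')) ->
  (forall (i : 'I_n) (j : 'I_(n + 4)) u, R (rF M h) i j u = (g (i, j) == u :> nat)) ->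
  rd (isof h G n m).
Proof.
move=> bg gE FE; rewrite /isof /=.
exists n.+1; first lia. exists n.+2; first lia. exists n.+3; first lia. exists n.+4; first lia.
do 4 (split=> //).
have e4 : n.+4 = n + 4 by rewrite addnC.
rewrite e4; split; [|split].
- move=> i _ j _ lti ltj.
  exists (g (Ordinal lti, Ordinal ltj)); first exact: ltn_trans (ltn_ord _) mltD.
  by split=> //; rewrite (FE (Ordinal lti) (Ordinal ltj)).
- have [g' gK g'K] := bg.
  move=> u _ ltu; pose p := g' (Ordinal ltu).
  have l1 := ltn_ord p.1; have l2 := ltn_ord p.2.
  exists p.1; first lia. exists p.2; first lia.
  by do 2 (split=> //); rewrite FE -surjective_pairing g'K.
move=> i _ j _ i' _ j' _ u _ u' _ l1 l2 l3 l4 l5 l6.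
rewrite (FE (Ordinal l1) (Ordinal l2)) (FE (Ordinal l3) (Ordinal l4)) => /eqP E1 /eqP E2.
split.
  rewrite -E1 -E2; split=> [/val_inj /(bij_inj bg) []|[e1 e2]] //.
  by congr (nat_of_ord (g (_, _))); apply: val_inj.
suff: rd (gadgetf G n i j i' j') <-> rd (cf M h m u u') by [].
have -> := gadgetfP (Ordinal l1) (Ordinal l3) (Ordinal l2) (Ordinal l4).
by rewrite gE -cf_entry E1 E2.
Qed.

End Iso.
End Sem.

(** * Meaning of the clauses on computations *)

Section Sem.
Variables (M : verifier) (D : nat) (x : seq bool).
Variable R : rname M -> nat -> nat -> nat -> bool.
Notation rd := (rden D x R).
Variable h : bool.

(** Only positions below D are described. This suffices since after [t] steps the head is at most at
    position [t]. *)
Definition rmatch (f : fcfg M) (t : nat) : Prop :=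
  [/\ forall q, R (rSt h q) t t t = (q == fq f),
      forall p, p < D -> R (rHd M h) t p p = (p == fh f) &
      forall p, p < D -> R (rNb M h) t p p = isSome (ftape f p) /\
                         R (rBt M h) t p p = (ftape f p == Some true)].

Lemma iff_eqb (a b : bool) : (a <-> b) <-> a = b.
Proof. by split=> [E|-> //]; apply/idP/idP => /E. Qed.

Lemma symfP a t p : rd (symf M h a t p) <->
  R (rNb M h) t p p = isSome a /\ R (rBt M h) t p p = (a == Some true).
Proof. by rewrite /symf /= !iff_eqb. Qed.

Lemma headfP mv p t : p < D -> rd (headf M h mv p t) <->
  forall p2, p2 < D -> R (rHd M h) t p2 p2 = (p2 == movehead mv p).
Proof.
move=> ltp; rewrite /headf /=; case: mv => /=.
all: split=> H p2 lt2; have {H} := H p2 lt2.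
- move=> E; apply/iff_eqb; rewrite E; split.
    by case=> [[]//|[[]//|[_ [->|[-> ->]]]]] /=.
  by move=> /eqP ->; right; right; split=> //; case: (p) => [|p'] /=; [right|left].
- move=> ->; split; last by case=> [[]//|[[]//|[_ [->|[-> ->]]]]] /=.
  by move=> /eqP ->; right; right; split=> //; case: (p) => [|p'] /=; [right|left].
- move=> E; apply/iff_eqb; rewrite E; split; last by move/eqP => ->; right; left.
  by case=> [[]//|[[_ ->] //|[]//]] /=.
- move=> ->; split; last by case=> [[]//|[[_ ->] //|[]//]] /=.
  by move=> /eqP ->; right; left.
- move=> E; apply/iff_eqb; rewrite E; split; last by move/eqP => ->; left.
  by case=> [[_ ->] //|[[]//|[]//]] /=.
- move=> ->; split; last by case=> [[_ ->] //|[[]//|[]//]] /=.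
  by move=> /eqP ->; left.
Qed.

Lemma stepcaseP a q t t' p : p < D -> rd (stepcase h a q t t' p) <->
  (R (rNb M h) t p p = isSome a /\ R (rBt M h) t p p = (a == Some true) ->
   [/\ forall q', R (rSt h q') t' t' t' = (q' == (delta1 q a).1.1),
       R (rNb M h) t' p p = isSome (delta1 q a).1.2,
       R (rBt M h) t' p p = ((delta1 q a).1.2 == Some true) &
       forall p2, p2 < D -> R (rHd M h) t' p2 p2 = (p2 == movehead (delta1 q a).2 p)]).
Proof.
move=> ltp.
have -> : rd (stepcase h a q t t' p) <-> (rd (symf M h a t p) ->
   (forall q', R (rSt h q') t' t' t' <-> (q' == (delta1 q a).1.1)) /\
   rd (symf M h (delta1 q a).1.2 t' p) /\ rd (headf M h (delta1 q a).2 p t')) by [].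
rewrite !symfP headfP //; split=> H S; have {H} := H S.
  by case=> H [[H1 H2] H3]; split=> // q'; apply/iff_eqb.
by case=> H1 H2 H3 H4; split=> [q'|//]; apply/iff_eqb.
Qed.

Lemma stepfP : rd (stepf M nat h) <-> forall t, t.+1 < D -> forall p, p < D -> R (rHd M h) t p p ->
  (forall p', p' < D -> p <> p' -> R (rNb M h) t.+1 p' p' = R (rNb M h) t p' p' /\
      R (rBt M h) t.+1 p' p' = R (rBt M h) t p' p') /\
  (forall q, R (rSt h q) t t t -> forall a, rd (stepcase h a q t t.+1 p)).
Proof.
have E : rd (stepf M nat h) <-> forall t, t < D -> forall t', t' < D -> t' = t.+1 ->
  forall p, p < D -> R (rHd M h) t p p ->
  (forall p', p' < D -> p <> p' -> (R (rNb M h) t' p' p' <-> R (rNb M h) t p' p') /\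
      (R (rBt M h) t' p' p' <-> R (rBt M h) t p' p')) /\
  (forall q, R (rSt h q) t t t -> rd (stepcase h None q t t' p) /\
     rd (stepcase h (Some true) q t t' p) /\ rd (stepcase h (Some false) q t t' p)) by [].
rewrite E {E}; split=> H.
  move=> t ltt p ltp Hd; have [H1 H2] := H t (ltnW ltt) t.+1 ltt erefl p ltp Hd.
  split=> [p' lt' ne|q Hq a].
    by have [] := H1 p' lt' ne; rewrite !iff_eqb.
  by have [h1 [h2 h3]] := H2 q Hq; case: a => [[]|].
move=> t ltt t' ltt' et p ltp Hd; rewrite et in ltt' *.
have [H1 H2] := H t ltt' p ltp Hd.
split=> [p' lt' ne|q Hq]; last by have := H2 q Hq.
by rewrite !iff_eqb; apply: H1.
Qed.

Lemma frunS inp t : frun M inp t.+1 = fstep (frun M inp t). Proof. by []. Qed.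

Lemma step_sound inp t : rd (stepf M nat h) -> t.+1 < D ->
  rmatch (frun M inp t) t -> rmatch (frun M inp t.+1) t.+1.
Proof.
move=> /stepfP H ltt [St Hd Tp]; rewrite frunS.
set f := frun M inp t in St Hd Tp *.
have ltp : fh f < D by apply: leq_ltn_trans (fh_le M inp t) (ltnW ltt).
have [|H1 H2] := H t ltt (fh f) ltp; first by rewrite Hd // eqxx.
have := H2 (fq f); rewrite St eqxx => /(_ isT (ftape f (fh f))) /stepcaseP => /(_ ltp (Tp _ ltp)).
case=> S1 S2 S3 S4; split=> //= p lt; case: eqP => [->|/nesym ne]; first by [].
by have [-> ->] := H1 p lt ne; apply: Tp.
Qed.

Lemma step_complete inp : (forall t, t < D -> rmatch (frun M inp t) t) -> rd (stepf M nat h).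
Proof.
move=> Hm; apply/stepfP => t ltt p ltp Hp.
have [St Hd Tp] := Hm t (ltnW ltt); have [St' Hd' Tp'] := Hm t.+1 ltt.
move: Hp; rewrite Hd // => /eqP ep.
rewrite frunS in St' Hd' Tp'; split=> [p' lt' ne|q].
  have [-> ->] := Tp' p' lt'; have [-> ->] := Tp p' lt'.
  by rewrite /=; case: eqP => // e; case: ne; rewrite ep e.
rewrite St => /eqP -> a; apply/stepcaseP => // -[E1 E2].
have [T1 T2] := Tp p ltp.
have ea : ftape (frun M inp t) (fh (frun M inp t)) = a.
  by rewrite -ep; move: E1 E2; rewrite T1 T2; case: (ftape _ _) => [[]|]; case: (a) => [[]|].
have [T1' T2'] := Tp' p ltp.
rewrite /= ea -ep eqxx in St' Hd' T1' T2'.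
by rewrite T1' T2'; split.
Qed.

Lemma andnP (f : nat -> fm (rname M) (tm_Q M) nat) k :
  rd (andn k f) <-> forall j, j < k -> rd (f j).
Proof.
elim: k => [|k IH] /=; first by split.
rewrite IH; split=> [[H Hk] j|H]; last by split=> [j lt|]; apply: H => //; apply: ltnW.
by rewrite ltnS leq_eqVlt => /orP [/eqP ->|/H].
Qed.

Lemma chain_sound Rn (base : nat -> fm (rname M) (tm_Q M) nat) step v0 f k r :
  rd (chainf Rn base step k) ->
  (forall r, r < D -> rd (base r) -> r = v0) ->
  (forall r r', r < D -> r' < D -> rd (step r r') -> r' = f r) ->
  r < D -> R (Rn k) r r r -> r = iter k f v0.
Proof.
move=> [H0 /andnP Hs] Hb Hst; elim: k r Hs => [|k IH] r Hs ltr Hr.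
  by apply: Hb => //; apply/(H0 r ltr).
have [r0 lt0 [H1 H2]] := (Hs k (ltnSn k) r ltr).1 Hr.
by rewrite iterS -(IH r0) //; [apply: Hst|move=> j lt; apply: Hs; apply: ltnW].
Qed.

Lemma chain_complete Rn (base : nat -> fm (rname M) (tm_Q M) nat) step v0 f k :
  (forall r, r < D -> rd (base r) <-> r = v0) ->
  (forall r r', r < D -> r' < D -> rd (step r r') <-> r' = f r) ->
  (forall j, j <= k -> iter j f v0 < D) ->
  (forall j r, j <= k -> R (Rn j) r r r = (r == iter j f v0)) ->
  rd (chainf Rn base step k).
Proof.
move=> Hb Hst ltD RE; split.
  by move=> r ltr /=; rewrite RE //=; rewrite (Hb r ltr); split=> /eqP.
apply/andnP => j ltj r' ltr' /=; rewrite RE // iterS; split.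
  move=> /eqP er; exists (iter j f v0); first by apply: ltD; apply: ltnW.
  by rewrite RE ?eqxx ?(ltnW ltj) //; split=> //; apply/Hst; rewrite ?ltD // ltnW.
by case=> r ltr [] /=; rewrite RE ?(ltnW ltj) // => /eqP er /Hst -> //; rewrite er.
Qed.

Definition cbound (m : nat) := vc M * (m * m) ^ vk M + vc M.

Lemma iter_mul b k : iter k (fun r => r * b) 1 = b ^ k.
Proof. by elim: k => // k IH; rewrite iterS IH expnSr. Qed.

Lemma iter_add b k : iter k (fun r => r + b) 0 = k * b.
Proof. by elim: k => // k IH; rewrite iterS IH mulSn addnC. Qed.

Lemma lenf_sound m e1 l : rd (lenf M h m e1 l) -> l <= e1.+1 + cbound m.
Proof.
case=> b ltb [P ltP [P1 ltP1 [U ltU [e2 _ [s _ H]]]]].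
have {H} [eb [Hc [HP [eP1 [Hl [HU [ee [es les]]]]]]]] : m * m = b /\
  rd (chainf (rPow M h) (fun r => MEx (fun z => MAnd (MZero z) (MSucc z r)))
            (fun r r' => MMul r b r') (vk M)) /\
  R (rPow M h (vk M)) P P P /\ P1 = P.+1 /\
  rd (chainf (rLin M h) (fun r => MZero r) (fun r r' => MAdd r P1 r') (vc M)) /\
  R (rLin M h (vc M)) U U U /\ e2 = e1.+1 /\ e2 + U = s /\ l <= s by [].
have EP : P = b ^ vk M.
  rewrite -iter_mul; apply: (chain_sound Hc) HP => //.
  by move=> r _ [z _ [-> ->]].
have EU : U = vc M * P1.
  by rewrite -iter_add; apply: (chain_sound Hl) HU.
apply: leq_trans les _.
by rewrite /cbound -ee -es EU eP1 EP eb mulnS leq_add2l addnC.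
Qed.

Lemma lenf_complete m e1 l : m * m < D -> e1.+1 + cbound m < D -> l <= e1.+1 + cbound m ->
  (forall j, j <= vk M -> (m * m) ^ j < D) -> ((m * m) ^ vk M).+1 < D ->
  (forall j r, j <= vk M -> R (rPow M h j) r r r = (r == (m * m) ^ j)) ->
  (forall j r, j <= vc M -> R (rLin M h j) r r r = (r == j * ((m * m) ^ vk M).+1)) ->
  rd (lenf M h m e1 l).
Proof.
move=> ltb lts le ltP ltP1 EP EL.
have EU : vc M * ((m * m) ^ vk M).+1 = cbound m by rewrite /cbound mulnS addnC.
exists (m * m) => //; exists ((m * m) ^ vk M); first exact: ltP.
exists ((m * m) ^ vk M).+1 => //; exists (cbound m); first by apply: leq_ltn_trans lts; apply: leq_addl.
exists e1.+1; first by apply: leq_ltn_trans lts; apply: leq_addr.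
exists (e1.+1 + cbound m) => //.
suff: rd (chainf (rPow M h) (fun r => MEx (fun z => MAnd (MZero z) (MSucc z r)))
            (fun r r' => MMul r (m * m) r') (vk M)) /\
  R (rPow M h (vk M)) ((m * m) ^ vk M) ((m * m) ^ vk M) ((m * m) ^ vk M) /\
  rd (chainf (rLin M h) (fun r => MZero r) (fun r r' => MAdd r ((m * m) ^ vk M).+1 r') (vc M)) /\
  R (rLin M h (vc M)) (cbound m) (cbound m) (cbound m) by case=> H1 [H2 [H3 H4]].
have D0 : 0 < D by apply: leq_ltn_trans ltb.
split; [|split; [by rewrite EP|split; [|by rewrite EL ?EU]]].
- apply: (@chain_complete _ _ _ 1 (fun r => r * (m * m))) => [r _|r r' _ _|j lej|j r lej].
  + by split=> [[z _ [-> ->]] //|->]; exists 0.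
  + by split=> ->.
  + by rewrite iter_mul; exact: ltP.
  + by rewrite iter_mul EP.
- apply: (@chain_complete _ _ _ 0 (fun r => r + ((m * m) ^ vk M).+1)) => [r _|r r' _ _|j lej|j r lej].
  + by [].
  + by split=> ->.
  + rewrite iter_add; apply: leq_ltn_trans lts.
    by apply: leq_trans (leq_addl _ _); rewrite -EU leq_mul2r lej orbT.
  + by rewrite iter_add EL.
Qed.

Lemma tab_sound m : rd (initf M h m) -> rd (stepf M nat h) -> rd (acceptf M nat h) ->
  exists C w t, [/\ size C = m * m, faccept M (pair_enc C w) t,
    forall q, q < m * m -> nth false C q = R (rBt M h) 0 (2 * q) (2 * q),
    2 * (m * m) <= D & size w <= cbound m].
Proof.
move=> Hi Hs [t ltt [q [Sq acc]]].
have [z _ [e lte [e1 _ [l ltl H]]]] := Hi.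
have {H} [z0 [Ee [Ee1 [lt1 [St [Hd [Tp [dbl [B0 [B1 Hlen]]]]]]]]]] :
  z = 0 /\ rd (idx2 M m m z e) /\ e1 = e.+1 /\ e1 < l /\
  (forall q, R (rSt h q) z z z <-> (q == tm_start M)) /\
  (forall p, p < D -> (R (rHd M h) z p p <-> p = 0)) /\
  (forall p, p < D -> (R (rNb M h) z p p <-> p < l) /\ (R (rBt M h) z p p -> p < l)) /\
  (forall q, q < D -> forall r, r < D -> forall r', r' < D -> q + q = r -> r' = r.+1 -> r < e ->
     (R (rBt M h) z r r <-> R (rBt M h) z r' r')) /\
  ~ R (rBt M h) z e e /\ R (rBt M h) z e1 e1 /\ rd (lenf M h m e1 l) by [].
have {Hlen} lenl := lenf_sound Hlen.
rewrite {z}z0 ?addn0 in Ee St Hd Tp dbl B0 B1.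
move/(idx2P x R m m 0 lte): Ee; rewrite addn0 => Ee.
(* The input of the verifier is recovered from the first [l] cells of the guessed tape at time 0;
   the matrix and its certificate are the two components. *)
pose inp := mkseq (fun p => R (rBt M h) 0 p p) l.
have ninp p : p < l -> nth false inp p = R (rBt M h) 0 p p by move=> lt; rewrite nth_mkseq.
have Einp : inp = pair_enc (mkseq (fun q => nth false inp (2 * q)) (m * m)) (drop (2 * (m * m) + 2) inp).
  apply: pair_encP; rewrite ?size_mkseq -?Ee.
  - by move: lt1; rewrite Ee1 addn2.
  - move=> q' ltq; have ltqe : 2 * q' < e by rewrite Ee ltn_mul2l.
    have [l1 [l2 [l3 [l4 l5]]]] : q' < D /\ 2 * q' < D /\ (2 * q').+1 < D /\ 2 * q' < l /\ (2 * q').+1 < l.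
      by move: lt1 ltl lte ltqe; rewrite Ee1; clear; lia.
    rewrite !ninp //; apply/iff_eqb.
    by apply: (dbl q' l1) => //; rewrite mul2n addnn.
  - by rewrite ninp; [apply/negP|move: lt1; rewrite Ee1; clear; lia].
  - by rewrite ninp -Ee1.
set C := mkseq _ _ in Einp.
exists C, (drop (2 * (m * m) + 2) inp), t; split; first by rewrite size_mkseq.
- rewrite -Einp.
  have match_t : rmatch (frun M inp t) t.
    elim: (t) ltt => [|t' IH] ltt; last by apply: step_sound => //; apply: IH; apply: ltnW.
    split=> [q'|p ltp|p ltp].
    + by apply/iff_eqb; apply: St.
    + apply/iff_eqb; split; [by move/(Hd p ltp) => ->|move/eqP => e0; apply/(Hd p ltp); exact: e0].
    rewrite /= onthTE size_mkseq; split; first by apply/iff_eqb; case: (Tp p ltp).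
    have [lt|ge] := ltnP p l.
      by rewrite onthE (nth_map false) ?size_mkseq // ninp //; case: (R _ _ _ _).
    rewrite onth_default ?size_mkseq //; apply/negP => Hb.
    by have [_ /(_ Hb)] := Tp p ltp; rewrite ltnNge ge.
  have [E _ _] := match_t.
  by move: Sq; rewrite /= E => /eqP eq; rewrite /faccept -eq.
- move=> q' ltq; rewrite nth_mkseq // ninp //.
  have : 2 * q' < e by rewrite Ee ltn_mul2l.
  by move: lt1; rewrite Ee1; clear; lia.
- by rewrite -Ee ltnW.
by rewrite size_drop size_mkseq leq_subLR (leq_trans lenl) // Ee1 Ee addn2.
Qed.

Lemma tab_complete m C w T : size C = m * m -> faccept M (pair_enc C w) T -> T < D ->
  size (pair_enc C w) < D ->
  (forall t, t < D -> rmatch (frun M (pair_enc C w) t) t) ->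
  size w <= cbound m -> 2 * (m * m) + 2 + cbound m < D ->
  (forall j, j <= vk M -> (m * m) ^ j < D) -> ((m * m) ^ vk M).+1 < D ->
  (forall j r, j <= vk M -> R (rPow M h j) r r r = (r == (m * m) ^ j)) ->
  (forall j r, j <= vc M -> R (rLin M h j) r r r = (r == j * ((m * m) ^ vk M).+1)) ->
  rd (initf M h m) /\ rd (stepf M nat h) /\ rd (acceptf M nat h).
Proof.
move=> szC acc ltT ltD Hm lew ltcb ltP ltP1 EP EL; split; [|split; first exact: step_complete Hm]; last first.
  exists T => //; exists (fq (frun M (pair_enc C w) T)).
  by have [St _ _] := Hm T ltT; split=> /=; rewrite ?St.
have D0 : 0 < D by apply: leq_ltn_trans ltT.
have [St Hd Tp] := Hm 0 D0.
have szi : size (pair_enc C w) = 2 * (m * m) + 2 + size w by rewrite size_pair_enc szC.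
set inp := pair_enc C w in St Hd Tp szi ltD *.
have lte : 2 * (m * m) < D by move: ltD; rewrite szi; clear; lia.
have lte1 : (2 * (m * m)).+1 < D by move: ltD; rewrite szi; clear; lia.
have bit p : p < size inp -> R (rBt M h) 0 p p = nth false inp p.
  move=> lt; have [_ ->] := Tp p (ltn_trans lt ltD).
  by rewrite /= -odflt_onth; move: lt; rewrite -onthTE; case: (onth _ _) => [[]|].
exists 0 => //; exists (2 * (m * m)) => //; exists (2 * (m * m)).+1 => //.
exists (size inp) => //.
suff: rd (idx2 M m m 0 (2 * (m * m))) /\ (2 * (m * m)).+1 < size inp /\
  (forall q, R (rSt h q) 0 0 0 <-> (q == tm_start M)) /\
  (forall p, p < D -> (R (rHd M h) 0 p p <-> p = 0)) /\
  (forall p, p < D -> (R (rNb M h) 0 p p <-> p < size inp) /\ (R (rBt M h) 0 p p -> p < size inp)) /\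
  (forall q, q < D -> forall r, r < D -> forall r', r' < D -> q + q = r -> r' = r.+1 -> r < 2 * (m * m) ->
     (R (rBt M h) 0 r r <-> R (rBt M h) 0 r' r')) /\
  ~ R (rBt M h) 0 (2 * (m * m)) (2 * (m * m)) /\ R (rBt M h) 0 (2 * (m * m)).+1 (2 * (m * m)).+1 /\
  rd (lenf M h m (2 * (m * m)).+1 (size inp)).
  by case=> H1 [H2 H3].
split; first by apply/(idx2P x R m m 0 lte); rewrite addn0.
split; first by rewrite szi; clear; lia.
split; first by move=> q; rewrite St.
split; first by move=> p ltp; rewrite Hd //=; split=> [/eqP|->].
split.
  move=> p ltp; have [-> ->] := Tp p ltp; rewrite /= onthTE; split=> //.
  by rewrite -onthTE; case: (onth _ _).
have lt1 : (2 * (m * m)).+1 < size inp by rewrite szi; clear; lia.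
split.
  move=> q _ r _ r' _ er er' lt; rewrite er'.
  rewrite !bit; try by (move: lt lt1; clear; lia).
  rewrite !nth_pair_enc szC.
  have -> : r < 2 * (m * m) by [].
  have -> : r.+1 < 2 * (m * m) by move: lt er; clear; lia.
  have -> : r = q * 2 by rewrite -er muln2 addnn.
  have -> : (q * 2).+1 %/ 2 = q by rewrite -addn1 divnMDl // addn0.
  by rewrite mulnK.
split; first by rewrite bit ?nth_pair_enc ?szC ?ltnn ?eqxx //; move: lt1; clear; lia.
split; last first.
  apply: lenf_complete => //; first by move: lte; clear; lia.
    by rewrite -addn2.
  by rewrite -addn2 szi leq_add2l.
rewrite bit // nth_pair_enc szC addn1 eqxx.
have -> : ((2 * (m * m)).+1 < 2 * (m * m)) = false by clear; lia.
by have -> : ((2 * (m * m)).+1 == 2 * (m * m)) = false by clear; lia.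
Qed.

End Sem.

(** * Polynomial bounds *)

Definition polyb (f : nat -> nat) : Prop := exists c k, forall n, f n <= c * n.+1 ^ k.

Lemma polyb_const a : polyb (fun=> a).
Proof. by exists a, 0 => n; rewrite muln1. Qed.

Lemma polyb_id : polyb id.
Proof. by exists 1, 1 => n; rewrite mul1n expn1. Qed.

Lemma polybD f g : polyb f -> polyb g -> polyb (fun n => f n + g n).
Proof.
case=> c [k Hf] [c' [k' Hg]]; exists (c + c'), (k + k') => n.
rewrite mulnDl; apply: leq_add.
  by apply: leq_trans (Hf n) _; rewrite leq_mul2l leq_pexp2l ?leq_addr ?orbT.
by apply: leq_trans (Hg n) _; rewrite leq_mul2l leq_pexp2l ?leq_addl ?orbT.
Qed.

Lemma polybM f g : polyb f -> polyb g -> polyb (fun n => f n * g n).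
Proof.
case=> c [k Hf] [c' [k' Hg]]; exists (c * c'), (k + k') => n.
by rewrite expnD mulnACA leq_mul.
Qed.

Lemma polybX f k : polyb f -> polyb (fun n => f n ^ k).
Proof.
move=> Hf; elim: k => [|k IH]; first exact: polyb_const.
by have [c [k' H]] := polybM Hf IH; exists c, k' => n; rewrite expnS.
Qed.

(** * Soundness and completeness of the sentence *)

Section Final.
Variables (M : verifier) (V : language) (c k : nat).
Hypothesis acceptV : forall x t, faccept M x t -> V x.
Hypothesis Vaccept : forall x, V x -> faccept M x (c * size x ^ k + c).
Hypothesis canonV : forall s, CANON_SQFREE s <->
  exists y, size y <= vc M * size s ^ vk M + vc M /\ V (pair_enc s y).

Lemma isof_lt D x R h (G : nat -> nat -> fm (rname M) (tm_Q M) nat) n m :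
  rden D x R (isof h G n m) -> n + 4 < D.
Proof.
case=> a _ [b _ [d _ [n4 lt [ea [eb [ec [en _]]]]]]].
by move: lt; rewrite en ec eb ea addnC.
Qed.

Lemma side_sound D x R h (G : nat -> nat -> fm (rname M) (tm_Q M) nat) n m (A : adjm n) : m < D ->
  (forall i j : 'I_n, rden D x R (G i j) <-> A i j) ->
  rden D x R (sidef h G n m) ->
  exists C, [/\ CANON_SQFREE C, size C = m * m, iso_rel (gadget A) (decode_mx m C),
    2 * (m * m) <= D &
    forall q, q < m * m -> nth false C q = R (rBt M h) 0 (2 * q) (2 * q)].
Proof.
move=> ltm GE [Hiso [Hi [Hs Ha]]].
have [C [w [t [szC acc CE leD lew]]]] := tab_sound Hi Hs Ha.
exists C; split=> //; last exact: isof_sound GE CE leD (isof_lt Hiso) ltm Hiso.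
apply/canonV; exists w; split; first by rewrite szC.
exact: acceptV acc.
Qed.

Lemma phi_sound x D (R : rname M -> nat -> nat -> nat -> bool) :
  size x < D -> rden D x R (phi M nat) -> ~ GI x.
Proof.
move=> xD Hphi [n1 [n2 [A1 [A2 [s1 [s2 [Ex [[sz1 [E1 adj1]] [[sz2 [E2 adj2]] iso]]]]]]]]].
subst A1 A2.
have spec : wfspec x n1 n2 (2 * (n1 * n1) + 2) s1 s2 by [].
have szx : size x = 2 * (n1 * n1) + 2 + n2 * n2 by rewrite Ex size_pair_enc sz1 sz2.
have sq a : a <= a * a by case: a => // a; rewrite leq_pmulr.
have [l1 l2 l3] : [/\ n1 < D, n2 < D & 2 * (n1 * n1) + 2 < D].
  by move: xD (sq n1) (sq n2); rewrite szx; clear; split; lia.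
have Hwf : rden D x R (wf M n1 n2 (2 * (n1 * n1) + 2)).
  by apply/(wfP R xD l1 l2 l3); exists s1, s2.
case: Hphi => [no|[k1 lk1 [k2 lk2 [o lo [Hw Hb]]]]].
  by apply: no; exists n1 => //; exists n2 => //; exists (2 * (n1 * n1) + 2).
have [t1 [t2 [Ex' [sz1' sz2'] _ _ eo]]] := (wfP R xD lk1 lk2 lo).1 Hw.
(* The matrices and orders found by the sentence are the given ones: pair encodings are injective
   and a square determines its root. *)
have [e1 e2] : s1 = t1 /\ s2 = t2 by apply: pair_enc_inj; rewrite -Ex -Ex'.
subst t1 t2.
have sqi a b : a * a = b * b -> a = b by move/eqP; rewrite !mulnn eqn_sqr => /eqP.
have ek1 : k1 = n1 by apply: sqi; rewrite -sz1 -sz1'.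
have ek2 : k2 = n2 by apply: sqi; rewrite -sz2 -sz2'.
subst k1 k2.
case: Hb => m1 lm1 [m2 lm2 [S1 [S2 Hd]]].
have [|C1 [can1 szC1 iso1 le1 CE1]] := side_sound (h := false) (G := gr1 M n1) (A := decode_mx n1 s1) lm1 _ S1.
  by move=> i j; exact: (gr1_entry R xD Ex sz1 (ltn_ord i) (ltn_ord j)).
have [|C2 [can2 szC2 iso2 le2 CE2]] := side_sound (h := true) (G := gr2 M o n2) (A := decode_mx n2 s2) lm2 _ S2.
  by move=> i j; apply: (gr2_entry R xD _ _ _ Ex); rewrite eo sz1.
apply: (canon_sound can1 can2 szC1 szC2 iso1 iso2 _ iso).
have [em|ne] := eqVneq m1 m2; last by left; apply/eqP.
case: Hd => // -[u _ [v _ [ltu [ltv ne]]]]; right; exists u, v; split=> //.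
move=> ee; apply: ne.
have c1 := cf_entry x CE1 le1 (Ordinal ltu) (Ordinal ltv).
subst m2.
have c2 := cf_entry x CE2 le2 (Ordinal ltu) (Ordinal ltv).
suff: rden D x R (cf M false m1 u v) <-> rden D x R (cf M true m1 u v) by [].
by rewrite c1 c2 /decode_mx /= -/(entry m1 C1 u v) ee.
Qed.

Definition liftF n m (g : 'I_n * 'I_(n + 4) -> 'I_m) (i j u : nat) : bool :=
  if (insub i : option 'I_n, insub j : option 'I_(n + 4)) is (Some i', Some j')
  then g (i', j') == u :> nat else false.

(** The intended interpretation: true arithmetic, given isomorphisms, actual runs of the verifier on
    [inp], and singletons for the auxiliary numbers of [lenf]. *)
Definition stdR (Fg : bool -> nat -> nat -> nat -> bool) (inp : bool -> seq bool)
    (m : bool -> nat) (l : rname M) (i j u : nat) : bool :=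
  match l with
  | inl true => i + j == u
  | inl false => i * j == u
  | inr (h, inl (inl q)) => q == fq (frun M (inp h) i)
  | inr (h, inl (inr (false, false))) => Fg h i j u
  | inr (h, inl (inr (false, true))) => j == fh (frun M (inp h) i)
  | inr (h, inl (inr (true, false))) => isSome (ftape (frun M (inp h) i) j)
  | inr (h, inl (inr (true, true))) => ftape (frun M (inp h) i) j == Some true
  | inr (h, inr (true, e)) => i == (m h * m h) ^ e
  | inr (h, inr (false, e)) => i == e * ((m h * m h) ^ vk M).+1
  end.

Lemma side_complete D x Fg inp mm h (G : nat -> nat -> fm (rname M) (tm_Q M) nat)
    n m (A : adjm n) C w T (g : 'I_n * 'I_(n + 4) -> 'I_m) :
  let R := stdR Fg inp mm in
  (forall i j : 'I_n, rden D x R (G i j) <-> A i j) ->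
  bijective g -> (forall p p', gadget A p p' = decode_mx m C (g p) (g p')) ->
  inp h = pair_enc C w -> mm h = m -> Fg h = liftF g ->
  size C = m * m -> faccept M (pair_enc C w) T -> size w <= cbound M m ->
  n + 4 < D -> m < D -> T < D -> 2 * (m * m) + 2 + cbound M m < D ->
  (forall j, j <= vk M -> (m * m) ^ j < D) -> ((m * m) ^ vk M).+1 < D ->
  rden D x R (sidef h G n m) /\
  forall q, q < m * m -> nth false C q = R (rBt M h) 0 (2 * q) (2 * q).
Proof.
move=> R GE bg gE Einp Emm EF szC acc lew ltn4 ltm ltT ltcb ltP ltP1.
have szi : size (pair_enc C w) = 2 * (m * m) + 2 + size w by rewrite size_pair_enc szC.
have ltD : size (pair_enc C w) < D.
  by rewrite szi; apply: leq_ltn_trans ltcb; rewrite leq_add2l.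
have CE q : q < m * m -> nth false C q = R (rBt M h) 0 (2 * q) (2 * q).
  move=> lt; rewrite /R /= Einp.
  have lt2 : 2 * q < 2 * (m * m) by rewrite ltn_mul2l.
  have ltq : 2 * q < size (pair_enc C w) by rewrite szi; move: lt2; clear; lia.
  have -> : nth false C q = nth false (pair_enc C w) (2 * q).
    by rewrite nth_pair_enc szC lt2 mulKn.
  by rewrite -odflt_onth; move: ltq; rewrite -onthTE; case: (onth _ _) => [[]|].
split=> //.
have le2 : 2 * (m * m) <= D by move: ltcb; clear; lia.
split.
  apply: (isof_complete GE CE le2 ltn4 ltm bg gE) => i j u.
  by rewrite /R /= EF /liftF !valK.
have tab := @tab_complete M D x R h m C w T szC acc ltT ltD.
apply: tab => //.
- by move=> t ltt; split=> [q|p ltp|p ltp]; rewrite /R /= Einp.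
- by move=> j r lej; rewrite /R /= Emm inordK // ltnS (leq_trans lej) ?leq_addl.
- by move=> j r lej; rewrite /R /= Emm inordK // ltnS (leq_trans lej) ?leq_addr.
Qed.

(** For graphs of order at most [N], these bound in turn the order of the gadget, the size of its
    matrix, the powers of that size, the certificate, the input and the running time of the
    verifier; [bD] exceeds them all. *)
Definition bM N := N * (N + 4).
Definition bB N := bM N * bM N.
(** Adding 1 keeps the base positive, so that all smaller exponents are covered too. *)
Definition bP N := (bB N + 1) ^ vk M.
Definition bC N := vc M * bP N + vc M.
Definition bI N := 2 * bB N + 2 + bC N.
Definition bT N := c * bI N ^ k + c.
Definition bD N := (N + bM N + bB N) + (bP N + bI N + bT N) + 10.

Lemma polyb_bD : polyb bD.
Proof.
have pM : polyb bM.
  by apply: polybM polyb_id _; apply: polybD polyb_id (polyb_const _).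
have pB : polyb bB by apply: polybM.
have pP : polyb bP by apply: polybX; apply: polybD pB (polyb_const _).
have pC : polyb bC.
  by apply: polybD (polyb_const _); apply: polybM (polyb_const _) _.
have pI : polyb bI.
  apply: polybD pC; apply: polybD (polyb_const _); exact: polybM (polyb_const _) _.
have pT : polyb bT.
  by apply: polybD (polyb_const _); apply: polybM (polyb_const _) _; apply: polybX.
apply: polybD (polyb_const _); apply: polybD; apply: polybD => //.
  by apply: polybD => //; exact: polyb_id.
exact: polybD.
Qed.

Lemma bounds N n C w : let m := n * (n + 4) in n <= N -> size C = m * m -> size w <= cbound M m ->
  [/\ n + 4 < bD N, m < bD N, c * size (pair_enc C w) ^ k + c < bD N,
      2 * (m * m) + 2 + cbound M m < bD N /\ ((m * m) ^ vk M).+1 < bD N &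
      forall j, j <= vk M -> (m * m) ^ j < bD N].
Proof.
move=> m leN szC lew.
have lm : m <= bM N by rewrite /m /bM leq_mul // leq_add2r.
have lB : m * m <= bB N by rewrite leq_mul.
have lP j : j <= vk M -> (m * m) ^ j <= bP N.
  move=> lej; apply: leq_trans (_ : (bB N + 1) ^ j <= _).
    by case: j {lej} => // j; rewrite leq_exp2r // (leq_trans lB) // leq_addr.
  by rewrite leq_pexp2l // addn1.
have lC : cbound M m <= bC N by rewrite leq_add2r leq_mul2l lP ?orbT.
have lI : 2 * (m * m) + 2 + cbound M m <= bI N.
  by rewrite leq_add // leq_add2r leq_mul2l lB.
have li : size (pair_enc C w) <= bI N.
  by apply: leq_trans lI; rewrite size_pair_enc szC leq_add2l.
have lT : c * size (pair_enc C w) ^ k + c <= bT N.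
  rewrite leq_add2r leq_mul2l; apply/orP; right.
  by case: (k) => // k'; rewrite leq_exp2r.
split; last by move=> j lej; move: (lP j lej); rewrite /bD; clear; lia.
- by move: leN; rewrite /bD; clear; lia.
- by move: lm; rewrite /bD; clear; lia.
- by move: lT; rewrite /bD; clear; lia.
- by move: lI (lP _ (leqnn _)); rewrite /bD; clear; lia.
Qed.

Lemma phi_complete x : ~ GI x -> exists R : rname M -> nat -> nat -> nat -> bool,
  [/\ rden (bD (size x)) x R (phi M nat),
    forall i j u, R (rAdd M) i j u = (i + j == u) & forall i j u, R (rMul M) i j u = (i * j == u)].
Proof.
move=> nGI; set D := bD (size x).
have xD : size x < D by rewrite /D /bD; clear; lia.
pose R0 := stdR (fun _ _ _ _ => false) (fun=> [::]) (fun=> 0).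
have [[n1 [n2 [o [s1 [s2 spec]]]]]|no] :=
  classic (exists n1 n2 o s1 s2, wfspec x n1 n2 o s1 s2); last first.
  (* The word encodes no pair of graphs, so the first disjunct holds whatever the relations other
     than arithmetic are. *)
  exists R0; split=> //; left; case=> n1 l1 [n2 l2 [o lo Hw]]; apply: no.
  by have [s1 [s2 H]] := (wfP R0 xD l1 l2 lo).1 Hw; exists n1, n2, o, s1, s2.
have [Ex [sz1 sz2] adj1 adj2 eo] := spec.
have niso : ~ isomorphic (decode_mx n1 s1) (decode_mx n2 s2).
  move=> iso; apply: nGI; exists n1, n2, (decode_mx n1 s1), (decode_mx n2 s2), s1, s2.
  by split.
have [C1 [C2 [[can1 szC1 [g1 bg1 gE1]] [[can2 szC2 [g2 bg2 gE2]] df]]]] := canon_complete adj1 adj2 niso.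
move: szC1 g1 bg1 gE1 szC2 g2 bg2 gE2 df.
set m1 := n1 * (n1 + 4); set m2 := n2 * (n2 + 4) => szC1 g1 bg1 gE1 szC2 g2 bg2 gE2 df.
have [w1 [lw1 /Vaccept acc1]] := (canonV _).1 can1.
have [w2 [lw2 /Vaccept acc2]] := (canonV _).1 can2.
rewrite szC1 in lw1; rewrite szC2 in lw2.
have szx : size x = o + n2 * n2 by rewrite Ex size_pair_enc sz1 sz2 eo.
have sq a : a <= a * a by case: a => // a; rewrite leq_pmulr.
have [le1 le2] : n1 <= size x /\ n2 <= size x.
  by move: (sq n1) (sq n2); rewrite szx eo; clear; split; lia.
have [a1 a2 a3 [a4 a5] a6] := bounds le1 szC1 lw1.
have [b1 b2 b3 [b4 b5] b6] := bounds le2 szC2 lw2.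
pose Fg h := if h then liftF g2 else liftF g1.
pose inp h := if h then pair_enc C2 w2 else pair_enc C1 w1.
pose mm h := if h then m2 else m1.
pose R := stdR Fg inp mm.
have [|S1 CE1] := @side_complete D x Fg inp mm false (gr1 M n1) n1 m1 (decode_mx n1 s1)
  C1 w1 _ g1 _ bg1 gE1 erefl erefl erefl szC1 acc1 lw1 a1 a2 a3 a4 a6 a5.
  by move=> i j; exact: (gr1_entry R xD Ex sz1 (ltn_ord i) (ltn_ord j)).
have [|S2 CE2] := @side_complete D x Fg inp mm true (gr2 M o n2) n2 m2 (decode_mx n2 s2)
  C2 w2 _ g2 _ bg2 gE2 erefl erefl erefl szC2 acc2 lw2 b1 b2 b3 b4 b6 b5.
  by move=> i j; apply: (gr2_entry R xD _ _ _ Ex); rewrite eo sz1.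
exists R; split=> //; right.
have ltn1 : n1 < D by move: le1 xD; apply: leq_ltn_trans.
have ltn2 : n2 < D by move: le2 xD; apply: leq_ltn_trans.
have lto : o < D by apply: leq_ltn_trans xD; rewrite szx leq_addr.
exists n1 => //; exists n2 => //; exists o => //; split.
  by apply/(wfP R xD ltn1 ltn2 lto); exists s1, s2.
exists m1 => //; exists m2 => //; split; [exact: S1|split; [exact: S2|]].
case: df => [ne|[u [v [ltu ltv ne]]]]; first by left.
have [em|nem] := eqVneq m1 m2; last by left; apply/eqP.
right; exists u; first exact: ltn_trans ltu a2.
exists v; first exact: ltn_trans ltv a2.
split=> //; split=> // E; apply: ne.
have d1 : 2 * (m1 * m1) <= D by move: a4; rewrite -/D; clear; lia.
have d2 : 2 * (m2 * m2) <= D by move: b4; rewrite -/D; clear; lia.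
have ltu2 : u < m2 by rewrite -em.
have ltv2 : v < m2 by rewrite -em.
have c1 := cf_entry x CE1 d1 (Ordinal ltu) (Ordinal ltv).
have c2 := cf_entry x CE2 d2 (Ordinal ltu2) (Ordinal ltv2).
have {}E : rden D x R (cf M false m1 u v) <-> rden D x R (cf M true m2 u v) by [].
by apply/iff_eqb; rewrite -[entry _ _ _ _]/(decode_mx m1 C1 (Ordinal ltu) (Ordinal ltv))
  -[entry m2 _ _ _]/(decode_mx m2 C2 (Ordinal ltu2) (Ordinal ltv2)) -c1 -c2.
Qed.

End Final.

Theorem mainTheorem11 : inNP CANON_SQFREE -> inCoNP GI.
Proof.
case=> V [[M0 [c [k HM]]] [c0 [k0 HV]]].
have [accV Vacc] := inP_faccept HM.
pose M := Verifier M0 c0 k0.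
have [cD [kD HD]] := @polyb_bD M c k.
apply: (@fagin_rich (rname M) (tm_Q M) (rAdd M) (rMul M) (phi M nat) _ cD kD).
- exact: rrel_phi.
- move=> x D R xD H; exact: (@phi_sound M V accV HV x D R xD H).
move=> x nGI; have [R [H HA HMu]] := @phi_complete M V c k Vacc HV x nGI.
exists (bD M c k (size x)), R; split=> //; rewrite HD andbT.
by rewrite /bD; clear; lia.
Qed.
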